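(* Let $B:\mathbb{R}^2\to\mathbb{R}$ be continuous with compact support, and suppose that $\Phi_B:=\frac{1}{2\pi}\int_{\mathbb{R}^2}B(x)\,dx\notin\mathbb{Z}$. Then the operator $L_s$ converges to $L_\infty$ in the strong-resolvent sense as $s\to\infty$, i.e. $$\forall F\in L^2(\mathbb{R}^2),\qquad \lim_{s\to\infty}\big\|L_s^{-1}F-L_\infty^{-1}F\big\|_{L^2(\mathbb{R}^2)}=0.$$
   Context: All function spaces consist of complex-valued functions; $\|\cdot\|$ is the norm of $L^2(\mathbb{R}^2)$. For a real-valued continuous compactly supported $B$ on $\mathbb{R}^2$, the magnetic potential is taken in the transversal gauge $A(x):=(-x_2,x_1)\int_0^1 B(\tau x_1,\tau x_2)\,\tau\,d\tau$, and for $s\ge0$ one puts $A_s(y):=e^{s/2}A(e^{s/2}y)$. For $s\in[0,\infty)$, $L_s=(-i\nabla-A_s)^2+\frac1{16}|y|^2$ is the self-adjoint operator associated in $L^2(\mathbb{R}^2)$ with the closed quadratic form $l_s[v]:=\|\nabla v-iA_sv\|^2+\frac1{16}\|yv\|^2$ with domain $W^{1,2}(\mathbb{R}^2)\cap L^2(\mathbb{R}^2,|y|^2dy)$. In polar coordinates $y=(r\cos\theta,r\sin\theta)$, $(r,\theta)\in[0,\infty)\times[0,2\pi)$, let $\alpha(r,\theta):=\int_0^rB(\tau\cos\theta,\tau\sin\theta)\,\tau\,d\tau$ and $\alpha_\infty(\theta):=\lim_{r\to\infty}\alpha(r,\theta)$, and let $A_\infty(y):=(-\sin\theta,\cos\theta)\,\frac{\alpha_\infty(\theta)}{r}$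 for $y\ne0$ (Aharonov–Bohm potential). $L_\infty=(-i\nabla-A_\infty)^2+\frac1{16}|y|^2$ is the self-adjoint operator associated in $L^2(\mathbb{R}^2)$ with the closed quadratic form $l_\infty[v]:=\|\nabla v-iA_\infty v\|^2+\frac1{16}\|yv\|^2$ whose domain is the closure of $C_0^\infty(\mathbb{R}^2\setminus\{0\})$ with respect to the norm $(l_\infty[v]+\|v\|^2)^{1/2}$ (Friedrichs extension). The number $0$ belongs to the resolvent sets of $L_\infty$ and of all $L_s$, $s\ge0$. *)

(* Defs.v *)
(* MathComp / MathComp-Analysis development: R is an arbitrary [realType],
   the plane is [R * R], complex-valued functions take values in [R[i]].
   L^2 functions are handled through representatives (no quotient by a.e.
   equality), so [norm2] below is a seminorm on functions. *)
From HB Require Import structures.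
From mathcomp Require Import all_boot all_order all_algebra.
From mathcomp Require Import all_classical all_reals all_analysis.
From mathcomp Require Import complex.

Set Implicit Arguments.
Unset Strict Implicit.
Unset Printing Implicit Defensive.

Import Order.TTheory GRing.Theory Num.Theory.
Import numFieldNormedType.Exports.

Local Open Scope classical_set_scope.
Local Open Scope ring_scope.
Local Open Scope complex_scope.

Notation leb2 R := (@lebesgue_measure R \x @lebesgue_measure R)%E.

Section L2_plane.
Context {R : realType}.
Implicit Types f g : R * R -> R[i].

Definition eucl (y : R * R) : R := Num.sqrt (y.1 ^+ 2 + y.2 ^+ 2).

Definition cintegral f : R[i] :=
  (\int[leb2 R]_x complex.Re (f x)) +i* (\int[leb2 R]_x complex.Im (f x)).

Definition L2 f : Prop :=
  (fun x => complex.Re (f x)) \in Lfun (leb2 R) 2%:E /\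
  (fun x => complex.Im (f x)) \in Lfun (leb2 R) 2%:E.

Definition norm2 f : R :=
  fine ('N[leb2 R]_(2%:E)[EFin \o (fun x => Normc.normc (f x))])%E.

Definition inner2 f g : R[i] := cintegral (fun x => f x * (g x)^*%C).

Definition locally_integrable2 (O : set (R * R)) f : Prop :=
  forall K, compact K -> K `<=` O ->
    (leb2 R).-integrable K (fun x => (complex.Re (f x))%:E) /\
    (leb2 R).-integrable K (fun x => (complex.Im (f x))%:E).

End L2_plane.

Section weak_derivatives.
Context {R : realType}.
Implicit Types (h : R * R -> R) (v phi : R * R -> R[i]).

Definition compact_support (T : nmodType) (f : R * R -> T) : Prop :=
  compact (closure [set x | f x != 0]).

(* [false] stands for the first coordinate and [true] for the second one. *)
Definition dir (j : bool) : R * R := if j then (0, 1) else (1, 0).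

Definition partial (j : bool) h : R * R -> R := fun x => 'D_(dir j) h x.

Definition smooth h : Prop :=
  forall (s : seq bool) (x : R * R),
    {for x, continuous (foldr partial h s)} /\
    forall j, derivable (foldr partial h s) x (dir j).

Definition cpartial (j : bool) phi : R * R -> R[i] := fun x =>
  partial j (fun y => complex.Re (phi y)) x +i*
  partial j (fun y => complex.Im (phi y)) x.

(* C_0^oo(O), as functions on the whole plane. *)
Definition test_function (O : set (R * R)) phi : Prop :=
  [/\ smooth (fun x => complex.Re (phi x)),
      smooth (fun x => complex.Im (phi x)),
      compact_support phi &
      closure [set x | phi x != 0] `<=` O].

Definition is_weak_grad (O : set (R * R)) v (g : R * R -> R[i] * R[i]) : Prop :=
  [/\ locally_integrable2 O v,
      locally_integrable2 O (fun x => (g x).1),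
      locally_integrable2 O (fun x => (g x).2) &
      forall phi, test_function O phi ->
        cintegral (fun x => v x * cpartial false phi x) =
          - cintegral (fun x => (g x).1 * phi x) /\
        cintegral (fun x => v x * cpartial true phi x) =
          - cintegral (fun x => (g x).2 * phi x)].

(* The weak gradient in O, which is unique up to a.e. equality in O. *)
Definition weak_grad (O : set (R * R)) v : R * R -> R[i] * R[i] :=
  xget (fun=> (0, 0)) [set g | is_weak_grad O v g].

Definition W12 v : Prop :=
  L2 v /\ exists g, [/\ is_weak_grad setT v g,
    L2 (fun x => (g x).1) & L2 (fun x => (g x).2)].

End weak_derivatives.

Section form_operators.
Context {R : realType}.
Local Notation E := (R * R -> R[i]).

Definition polarization (q : E -> R) (u v : E) : R[i] :=
  4^-1 * ((q (fun x => u x + v x))%:C - (q (fun x => u x - v x))%:C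
          + 'i%C * (q (fun x => u x + 'i%C * v x))%:C
          - 'i%C * (q (fun x => u x - 'i%C * v x))%:C).

(* Graph of the operator associated in L^2 with the quadratic form q of domain
   D by the first representation theorem: [form_operator D q u f] means that u
   is in the domain of the operator, which maps u to f. *)
Definition form_operator (D : set E) (q : E -> R) (u f : E) : Prop :=
  [/\ D u, L2 f & forall v, D v -> polarization q u v = inner2 f v].

(* The preimage of F under the operator of graph G, with the conventional
   value 0 if there is none. *)
Definition operator_inv (G : E -> E -> Prop) (F : E) : E :=
  xget (fun=> 0) [set u | G u F].

Definition mag_grad1 (O : set (R * R)) (A : R * R -> R * R) (v : E) : E :=
  fun y => (weak_grad O v y).1 - 'i%C * ((A y).1)%:C * v y.

Definition mag_grad2 (O : set (R * R)) (A : R * R -> R * R) (v : E) : E :=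
  fun y => (weak_grad O v y).2 - 'i%C * ((A y).2)%:C * v y.

Definition weighted (v : E) : E := fun y => (eucl y)%:C * v y.

(* ||grad v - i A v||^2 + 1/16 ||y v||^2, grad being the weak gradient in O. *)
Definition mag_form (O : set (R * R)) (A : R * R -> R * R) (v : E) : R :=
  norm2 (mag_grad1 O A v) ^+ 2 + norm2 (mag_grad2 O A v) ^+ 2
  + 16^-1 * norm2 (weighted v) ^+ 2.

End form_operators.

Section magnetic_operators.
Context {R : realType} (B : R * R -> R).
Local Notation E := (R * R -> R[i]).

Definition flux : R := (2 * pi)^-1 * \int[leb2 R]_x B x.

Definition vpot (x : R * R) : R * R :=
  let c := \int[lebesgue_measure]_(t in `[0, 1]) (B (t * x.1, t * x.2) * t) in
  (- x.2 * c, x.1 * c).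

Definition vpot_s (s : R) (y : R * R) : R * R :=
  let a := vpot (expR (s / 2) * y.1, expR (s / 2) * y.2) in
  (expR (s / 2) * a.1, expR (s / 2) * a.2).

Definition form_s (s : R) : E -> R := mag_form setT (vpot_s s).

Definition dom_s : set E := [set v | W12 v /\ L2 (weighted v)].

Definition L_s (s : R) : E -> E -> Prop := form_operator dom_s (form_s s).

Definition alpha (r theta : R) : R :=
  \int[lebesgue_measure]_(t in `[0, r]) (B (t * cos theta, t * sin theta) * t).

Definition alpha_oo (theta : R) : R := lim (alpha r theta @[r --> +oo]).

Definition polar_angle (y : R * R) : R :=
  xget 0 [set t | 0 <= t < 2 * pi /\ y = (eucl y * cos t, eucl y * sin t)].

(* At the origin, where the Aharonov-Bohm potential is not defined, this is
   (0, 0) because of the convention x / 0 = 0. *)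
Definition vpot_oo (y : R * R) : R * R :=
  let t := polar_angle y in
  (- sin t * (alpha_oo t / eucl y), cos t * (alpha_oo t / eucl y)).

Definition punctured : set (R * R) := [set y | y != (0, 0)].

Definition form_oo : E -> R := mag_form punctured vpot_oo.

(* The largest space on which [form_oo] makes sense with a finite value; it
   contains C_0^oo(R^2 \ {0}) and is complete for the form norm, so that the
   closure in [dom_oo] below realizes the abstract completion. *)
Definition maxdom_oo : set E := [set v |
  [/\ L2 v, L2 (weighted v) &
      (exists g, is_weak_grad punctured v g) /\
      L2 (mag_grad1 punctured vpot_oo v) /\
      L2 (mag_grad2 punctured vpot_oo v)]].

Definition form_norm_oo (v : E) : R := Num.sqrt (form_oo v + norm2 v ^+ 2).

Definition dom_oo : set E := [set v | maxdom_oo v /\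
  forall e : R, 0 < e -> exists2 phi, test_function punctured phi &
    form_norm_oo (fun y => v y - phi y) < e].

Definition L_oo : E -> E -> Prop := form_operator dom_oo form_oo.

End magnetic_operators.

(* Main.v *)
Require Import Defs.
From HB Require Import structures.
From mathcomp Require Import all_boot all_order all_algebra.
From mathcomp Require Import all_classical all_reals all_analysis.
From mathcomp Require Import complex measurable_realfun ring lra zify.
Import Order.TTheory GRing.Theory Num.Theory.
Import numFieldNormedType.Exports.
Set Implicit Arguments.
Unset Strict Implicit.
Unset Printing Implicit Defensive.
Local Open Scope classical_set_scope.
Local Open Scope ring_scope.

(** The proof compares two minima.  For each of the operators involved, [u = L^-1 F]
    minimises [J v = q v - 2 Re <F, v>], where [q] is the quadratic form, the minimum is
    [- E] with [E = Re <F, u>], and [q (u - v) = E + J v] for every [v] of the form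
    domain.  Moreover [q v] dominates [|v|^2 / 2] whatever the magnetic potential is
    (lemma [coercive]), so that a function whose energy is almost minimal is close to
    the solution in L^2.  Write [E_s], [E_oo] for the two values of [E].

    Fix a test function [phi] that vanishes near the origin and is close to
    [L_oo^-1 F] for the form norm.  The field is supported in a disc of radius [R0], and
    in the transversal gauge this makes [A_s] and [A_oo] equal at distance at least
    [exp (- s / 2) * R0] of the origin ([vpot_ooE]).  Hence [J_s phi = J_oo phi] for large
    [s], and [L_s^-1 F] is close to [phi], thus to [L_oo^-1 F], as soon as
    [limsup E_s <= E_oo] ([solutions_close]).

    The last inequality ([energy_upper]) requires to cut [L_s^-1 F] off near the origin at
    a small energy cost, uniformly in [s]; the result may then be used in the variational
    principle of [L_oo].  This is possible because a point of the plane has zero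
    capacity.  The cutoff is a function of an iterated logarithm of the distance
    to the origin, and since no uniform bound on [L_s^-1 F] is at hand, the
    price [|v grad eta|^2] is estimated by a Hardy inequality with a logarithmic weight
    ([log_hardy], [cut_bf]), which holds for the magnetic gradient with a constant
    that does not depend on the potential: completing the square with a radial vector
    field, the potential drops out ([hardy]).

    What remains is to show that the solutions exist in the sense of weak gradients.  A
    minimising sequence of test functions converges for the form norm to a
    solution, tested against test functions ([weak_solution]), since the
    maximal form domain is complete ([md_complete]); this is the Friedrichs
    realisation, which is all that is needed for [L_oo].  For [L_s] the equation has to be
    tested against every function [w] with a weak gradient in L^2.  Instead of proving
    that test functions are dense among those, one regularises the equation and [w]
    simultaneously: integrating both against the same mollifying kernel of two
    variables, the integrations by parts are legitimate and the kernel tends to the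
    diagonal ([compact_pairing]).  A radial truncation reduces to compactly supported [w]
    ([full_domain]). *)

(** * Square integrable functions *)

Section L2.
Context d (T : measurableType d) (R : realType) (mu : {measure set T -> \bar R}).
Implicit Types f g h : T -> R.

Lemma aeS (P Q : T -> Prop) : (forall x, P x -> Q x) ->
  {ae mu, forall x, P x} -> {ae mu, forall x, Q x}.
Proof. exact: filterS. Qed.

Lemma aeS2 (P Q W : T -> Prop) : (forall x, P x -> Q x -> W x) ->
  {ae mu, forall x, P x} -> {ae mu, forall x, Q x} -> {ae mu, forall x, W x}.
Proof. exact: filterS2. Qed.

Definition intg f := mu.-integrable setT (EFin \o f).
Definition sqi f := measurable_fun setT f /\ intg (fun x => f x ^+ 2).
(** Square integrable functions are plain functions, without quotient: [ip mu f f = 0] means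
    that [f] vanishes almost everywhere ([ip0_ae]). *)
Definition ip f g : R := \int[mu]_x (f x * g x).

Lemma intg_meas f : intg f -> measurable_fun setT f.
Proof. by move=> /measurable_int /measurable_EFinP. Qed.

Lemma intg_dom f g : measurable_fun setT f -> intg g ->
  (forall x, `|f x| <= g x) -> intg f.
Proof.
move=> mf ig fg; apply: (le_integrable _ _ _ ig) => //.
  exact/measurable_EFinP.
by move=> x _ /=; rewrite lee_fin (le_trans (fg x))// ler_norm.
Qed.

Lemma intgD f g : intg f -> intg g -> intg (fun x => f x + g x).
Proof.
move=> i j; have := integrableD measurableT i j.
by apply: eq_integrable => // x _; rewrite /= EFinD.
Qed.

Lemma intgZ c f : intg f -> intg (fun x => c * f x).
Proof.
move=> i; have := integrableZl measurableT c i.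
by apply: eq_integrable => // x _; rewrite /= EFinM.
Qed.

Lemma intgN f : intg f -> intg (fun x => - f x).
Proof.
by move=> /(intgZ (-1)); apply: eq_integrable => // x _; rewrite /= mulN1r.
Qed.

Lemma intgB f g : intg f -> intg g -> intg (fun x => f x - g x).
Proof. by move=> i j; exact: intgD i (intgN j). Qed.

Lemma sqi_meas f : sqi f -> measurable_fun setT f. Proof. by case. Qed.

Lemma sqi_mul f g : sqi f -> sqi g -> intg (fun x => f x * g x).
Proof.
move=> [mf f2] [mg g2]; apply: (@intg_dom _ (fun x => f x ^+ 2 + g x ^+ 2)).
- exact: measurable_funM.
- exact: intgD.
- move=> x; rewrite ler_norml; apply/andP; split.
    by rewrite -subr_ge0; have := sqr_ge0 (f x + g x); have := sqr_ge0 (f x);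
       have := sqr_ge0 (g x); nra.
  by have := sqr_ge0 (f x - g x); have := sqr_ge0 (f x);
       have := sqr_ge0 (g x); nra.
Qed.

Lemma sqi_dom f g c : measurable_fun setT f -> sqi g ->
  (forall x, `|f x| <= c * `|g x|) -> sqi f.
Proof.
move=> mf [mg g2] fg; split => //.
apply: (@intg_dom _ (fun x => c ^+ 2 * g x ^+ 2)).
- exact: measurable_funX.
- exact: intgZ.
- move=> x; rewrite normrX -exprMn -[leRHS]ger0_norm ?sqr_ge0// normrX normrM.
  rewrite lerXn2r ?nnegrE ?mulr_ge0//; apply: le_trans (fg x) _.
  by rewrite ler_wpM2r// ler_norm.
Qed.

Lemma sqi_bmul f g c : measurable_fun setT f -> sqi g ->
  (forall x, `|f x| <= c) -> sqi (fun x => f x * g x).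
Proof.
move=> mf g2 fc; apply: (@sqi_dom _ g c) => //.
  by apply: measurable_funM => //; case: g2.
by move=> x; rewrite normrM ler_wpM2r.
Qed.

Lemma sqiZ c f : sqi f -> sqi (fun x => c * f x).
Proof.
by move=> h; apply: (@sqi_bmul (fun=> c) f `|c|).
Qed.

Lemma sqiN f : sqi f -> sqi (fun x => - f x).
Proof.
move=> h; apply: (@sqi_dom _ f 1) => //; last by move=> x; rewrite normrN mul1r.
by apply: measurableT_comp; [exact: oppr_measurable|case: h].
Qed.

Lemma sqiD f g : sqi f -> sqi g -> sqi (fun x => f x + g x).
Proof.
move=> [mf f2] [mg g2]; split; first exact: measurable_funD.
apply: (@intg_dom _ (fun x => 2 * (f x ^+ 2 + g x ^+ 2))).
- by apply: measurable_funX; exact: measurable_funD.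
- by apply: intgZ; exact: intgD.
- move=> x; rewrite ger0_norm ?sqr_ge0//.
  by have := sqr_ge0 (f x - g x); nra.
Qed.

Lemma sqiB f g : sqi f -> sqi g -> sqi (fun x => f x - g x).
Proof. by move=> h k; exact: sqiD h (sqiN k). Qed.

Lemma ipC f g : ip f g = ip g f.
Proof. by apply: eq_Rintegral => x _; rewrite mulrC. Qed.

Lemma ip_ge0 f : 0 <= ip f f.
Proof. by apply: Rintegral_ge0 => x _; rewrite -expr2 sqr_ge0. Qed.

Lemma ipDr f g h : sqi f -> sqi g -> sqi h ->
  ip f (fun x => g x + h x) = ip f g + ip f h.
Proof.
move=> sf sg sh; rewrite /ip -RintegralD//; [|exact: sqi_mul..].
by apply: eq_Rintegral => x _; rewrite mulrDr.
Qed.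

Lemma ipZr c f g : sqi f -> sqi g -> ip f (fun x => c * g x) = c * ip f g.
Proof.
move=> sf sg; rewrite /ip -RintegralZl//; last exact: sqi_mul.
by apply: eq_Rintegral => x _; rewrite mulrCA.
Qed.

Lemma Rint_ae f g : measurable_fun setT f -> measurable_fun setT g ->
  {ae mu, forall x, f x = g x} -> \int[mu]_x f x = \int[mu]_x g x.
Proof.
move=> mf mg fg; congr fine; apply: ae_eq_integral => //.
- exact/measurable_EFinP.
- exact/measurable_EFinP.
- by apply: filterS fg => x + _ => ->.
Qed.

Lemma intg_ae f g : intg f -> measurable_fun setT g ->
  {ae mu, forall x, f x = g x} -> intg g.
Proof.
move=> /[dup] /intg_meas mf /integrableP[_ fi] mg fg; apply/integrableP; split.
  exact/measurable_EFinP.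
apply: le_lt_trans fi; rewrite le_eqVlt; apply/orP; left; apply/eqP.
apply: ae_eq_integral => //=.
- by rewrite -[X in measurable_fun _ X]/(abse \o (EFin \o _)); apply: measurableT_comp => //; apply/measurable_EFinP.
- by rewrite -[X in measurable_fun _ X]/(abse \o (EFin \o _)); apply: measurableT_comp => //; apply/measurable_EFinP.
- by apply: filterS fg => x + _ /= => ->.
Qed.

Lemma sqi_ae f g : sqi f -> measurable_fun setT g ->
  {ae mu, forall x, f x = g x} -> sqi g.
Proof.
move=> [mf f2] mg fg; split => //; apply: (intg_ae f2).
  exact: measurable_funX.
by apply: filterS fg => x /= ->.
Qed.

Lemma ip_ae f g h : measurable_fun setT f -> measurable_fun setT g ->
  measurable_fun setT h ->
  {ae mu, forall x, f x = g x} -> ip h f = ip h g.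
Proof.
move=> mf mg mh fg; apply: Rint_ae; [exact: measurable_funM..|].
by apply: filterS fg => x ->.
Qed.

Lemma ip0_ae f : sqi f -> ip f f = 0 -> {ae mu, forall x, f x = 0}.
Proof.
move=> [mf f2] f0.
have : ae_eq mu setT (fun x => (f x ^+ 2)%:E) (cst 0%E).
  apply/ae_eq_integral_abs => //.
    by apply/measurable_EFinP; exact: measurable_funX.
  transitivity (\int[mu]_x (f x ^+ 2)%:E)%E.
    by apply: eq_integral => x _; rewrite gee0_abs ?lee_fin ?sqr_ge0.
  rewrite -[LHS]fineK ?integrable_fin_num//; congr EFin; rewrite -f0 /ip.
  by apply: eq_Rintegral => x _; rewrite expr2.
apply: filterS => x /(_ I) /= [] /eqP; rewrite sqrf_eq0 => /eqP //.
Qed.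

(** The exponent 2 of the Lebesgue space is a real power of an absolute value; it is
    traded for a square here, once and for all. *)
Lemma sqi_LfunP f : (f \in Lfun mu 2%:E) <-> sqi f.
Proof.
split=> [h|[mf f2]].
  split; last exact: Lfun2_integrable_sqr.
  by move: h; rewrite inE => /andP[]; rewrite inE.
rewrite inE; apply/andP; split; first by rewrite inE.
rewrite inE/= /finite_norm.
apply: (@lty_poweRy _ _ 2); rewrite // powR_Lnorm//.
move: f2 => /integrableP[_]; apply: le_lt_trans; apply: ge0_le_integral => //.
- by move=> x _; rewrite poweR_ge0.
- apply/measurable_EFinP; apply: (measurableT_comp (measurable_powR _)).
  exact: measurableT_comp.
- by apply: measurableT_comp => //; apply/measurable_EFinP; exact: measurable_funX.
- by move=> x _ /=; rewrite lee_fin powR_mulrn// normrX.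
Qed.
End L2.

(** * Completeness of L^2 *)

Section L2_complete.
Context d (T : measurableType d) (R : realType) (mu : {measure set T -> \bar R}).

(** The increments are dominated by the geometric sequence of ratio 1/2. *)
Lemma fast_cauchy_cvg (u : R^nat) (M : R) :
  (forall k, 4 ^+ k * (u k.+1 - u k) ^+ 2 <= M) -> cvgn u.
Proof.
move=> uM; have M0 : 0 <= M.
  by apply: le_trans (uM 0%N); rewrite mulr_ge0// sqr_ge0.
have bnd k : `|u k.+1 - u k| <= geometric (M + 1) (2^-1) k.
  rewrite /geometric/= -(@ler_pXn2r _ 2)// ?nnegrE ?mulr_ge0 ?addr_ge0 ?exprn_ge0//.
  rewrite real_normK ?num_real// exprMn -exprM mulnC exprM.
  have -> : (2^-1 : R) ^+ 2 = 4^-1 by rewrite exprVn; congr (_^-1); rewrite -natrX.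
  rewrite exprVn ler_pdivlMr ?exprn_gt0// mulrC; apply: le_trans (uM k) _.
  by nra.
have cs : cvgn (series (fun k => u k.+1 - u k)).
  apply: normed_cvg; apply: series_le_cvg bnd _ => //.
    by move=> k; rewrite /geometric/= mulr_ge0 ?addr_ge0// exprn_ge0.
  by apply: is_cvg_geometric_series; rewrite ger0_norm//; lra.
have -> : u = (fun n => u 0%N + series (fun k => u k.+1 - u k) n).
  by apply/funext => n; rewrite /series/= telescope_sumr// addrC subrK.
by apply: is_cvgD => //; exact: is_cvg_cst.
Qed.

(** Riesz-Fischer.  Along a subsequence with fast decreasing distances, the series of
    [4 ^ k * (increment) ^ 2] has a finite integral, hence is finite almost everywhere, and there
    the subsequence converges pointwise; Fatou's lemma gives the limit in norm. *)
Lemma sqi_complete (f : nat -> T -> R) : (forall n, sqi mu (f n)) ->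
  (forall e, 0 < e -> exists N, forall n m, (N <= n)%N -> (N <= m)%N ->
    ip mu (fun x => f n x - f m x) (fun x => f n x - f m x) <= e) ->
  exists g, sqi mu g /\ forall e, 0 < e -> exists N, forall n, (N <= n)%N ->
    ip mu (fun x => f n x - g x) (fun x => f n x - g x) <= e.
Proof.
move=> sf Cf.
(* the rates 16 ^ - k leave a convergent series after multiplication by 4 ^ k *)
have e16 k : 0 < ((4 ^+ k) ^+ 2)^-1 :> R by rewrite invr_gt0 !exprn_gt0.
have /choice[N NP] k := Cf _ (e16 k).
pose phi k := (k + \sum_(i < k.+1) N i)%N.
have phiN k : (N k <= phi k)%N.
  by rewrite /phi big_ord_recr/= addnA leq_addl.
have phiS k : (phi k <= phi k.+1)%N.
  by rewrite /phi [in X in (_ <= X)%N]big_ord_recr/= leq_add// leq_addr.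
pose h k x := f (phi k.+1) x - f (phi k) x.
have sh k : sqi mu (h k) by exact: sqiB.
have hk k : ip mu (h k) (h k) <= ((4 ^+ k) ^+ 2)^-1.
  by apply: NP => //; apply: leq_trans (phiN k) _.
pose a k x := (4 ^+ k * h k x ^+ 2)%:E.
have a0 k x : (0 <= a k x)%E by rewrite lee_fin; apply: mulr_ge0; [exact: exprn_ge0|exact: sqr_ge0].
have ia k : intg mu (fun x => 4 ^+ k * h k x ^+ 2) by apply: intgZ; case: (sh k).
have ma k : measurable_fun setT (a k) by apply/measurable_EFinP; exact: intg_meas (ia k).
pose H x := (\sum_(k <oo) a k x)%E.
have mH : measurable_fun setT H by apply: (@ge0_emeasurable_sum _ _ _ setT a xpredT).
have iH : mu.-integrable setT H.
  apply/integrableP; split => //.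
  under eq_integral do rewrite gee0_abs ?nneseries_ge0//.
  rewrite integral_nneseries//.
  apply: (@le_lt_trans _ _ (\sum_(k <oo) (geometric 1 4^-1 k)%:E)%E).
    apply: lee_nneseries => // [k _ _|k _]; first by apply: integral_ge0 => x _; exact: a0.
    rewrite -[leLHS]fineK; last by apply: integrable_fin_num => //; exact: ia.
    rewrite lee_fin -/(Rintegral _ _ _) RintegralZl//; last by case: (sh k).
    apply: (@le_trans _ _ (4 ^+ k * ((4 ^+ k) ^+ 2)^-1)).
      rewrite ler_wpM2l ?exprn_ge0//; apply: le_trans (hk k).
      by rewrite /ip; under [leRHS]eq_Rintegral do rewrite -expr2.
    by rewrite /geometric/= mul1r exprVn expr2 invfM mulrA mulfV ?mul1r// expf_neq0.
  have /cvg_ex[/= l] : cvgn (series (geometric 1 (4^-1 : R))).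
    by apply: is_cvg_geometric_series; rewrite ger0_norm//; lra.
  move=> cl; rewrite (_ : limn _ = l%:E) ?ltry//; apply/cvg_lim => //.
  under eq_fun do rewrite sumEFin; apply: cvg_EFin; first exact: nearW.
  exact: cl.
pose G := [set x | (H x < +oo)%E].
have mG : measurable G.
  by rewrite -[G]setTI; exact: emeasurable_fun_infty_o.
have aeG : {ae mu, forall x, \1_G x = 1 :> R}.
  have := integrable_ae measurableT iH; apply: filterS => x /(_ I) Hx.
  by rewrite indicE mem_set//= /G/= ltey_eq Hx.
have cvgG x : cvgn (fun k => \1_G x * f (phi k) x).
  have [xG|xG] := boolP (x \in G); last first.
    rewrite (_ : (fun k => _) = fun=> 0); first exact: is_cvg_cst.
    by apply/funext => k; rewrite indicE (negbTE xG) mul0r.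
  apply: (@fast_cauchy_cvg _ (fine (H x))) => k.
  rewrite indicE xG !mul1r -/(h k x) -lee_fin fineK; last first.
    by rewrite ge0_fin_numE ?nneseries_ge0//; move: xG; rewrite inE.
  apply: (@le_trans _ _ (\sum_(0 <= i < k.+1) a i x)%E).
    by rewrite big_nat_recr//= leeDr// sume_ge0.
  exact: nneseries_lim_ge.
pose g (x : T) : R := limn (fun k => \1_G x * f (phi k) x).
have mf n : measurable_fun setT (f n) by case: (sf n).
have m1f n : measurable_fun setT (fun x => \1_G x * f n x).
  by apply: measurable_funM.
have mg : measurable_fun setT g.
  apply: (@measurable_fun_cvg _ _ _ _ (fun k x => \1_G x * f (phi k) x)) => //.
have key e : 0 < e -> exists N0, forall n, (N0 <= n)%N ->
    (\int[mu]_x ((f n x - g x) ^+ 2)%:E <= e%:E)%E.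
  move=> e0; have [N0 HN0] := Cf _ e0; exists N0 => n nN.
  pose F k x := ((f n x - \1_G x * f (phi (N0 + k)%N) x) ^+ 2)%:E.
  have mF k : measurable_fun setT (F k).
    by apply/measurable_EFinP; apply: measurable_funX; exact: measurable_funB.
  rewrite (_ : (\int[mu]_x _)%E = (\int[mu]_x limn_einf (F ^~ x))%E); last first.
    apply: eq_integral => x _; apply/esym.
    suff : F ^~ x @ \oo --> ((f n x - g x) ^+ 2)%:E by case/cvg_limn_einf_sup.
    apply: cvg_EFin; first exact: nearW.
    have c : (f n x - \1_G x * f (phi (N0 + k)%N) x) @[k --> \oo] --> f n x - g x.
      apply: cvgB; first exact: cvg_cst.
      under eq_fun do rewrite addnC.
      apply: (@cvg_comp _ _ _ (fun k => (k + N0)%N) (fun k => \1_G x * f (phi k) x)).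
        exact: cvg_addnr.
      exact: cvgG.
    rewrite [X in _ --> X]expr2; apply: cvg_trans (cvgM c c).
    by apply: near_eq_cvg; apply: nearW => k /=; rewrite expr2.
  apply: le_trans (fatou _ _ _ _) _ => //.
    by move=> k x _; rewrite lee_fin sqr_ge0.
  have Fe k : (\int[mu]_x F k x <= e%:E)%E.
    have Nk : (N0 <= phi (N0 + k))%N.
      by rewrite /phi -!addnA leq_addr.
    have s1 : sqi mu (fun x => f n x - f (phi (N0 + k)%N) x) by exact: sqiB.
    rewrite (_ : (\int[mu]_x _)%E = (\int[mu]_x ((f n x - f (phi (N0 + k)%N) x) ^+ 2)%:E)%E).
      rewrite -[leLHS]fineK; last by apply: integrable_fin_num => //; case: s1.
      rewrite lee_fin; apply: le_trans (HN0 _ _ nN Nk).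
      by rewrite /ip; under [leRHS]eq_Rintegral do rewrite -expr2.
    apply: ae_eq_integral => //.
      by case: s1 => _ /measurable_int.
    by apply: filterS aeG => x G1 _; rewrite /F G1 mul1r.
  rewrite limn_einf_lim; apply: lime_le; first exact: is_cvg_einfs.
  apply: nearW => k; apply: le_trans (Fe k); apply: ereal_inf_lbound.
  by exists k => /=.
have sg : sqi mu g.
  have [N0 /(_ N0 (leqnn _)) key1] := key 1 ltr01.
  have : sqi mu (fun x => f N0 x - g x).
    split; first exact: measurable_funB.
    apply/integrableP; split.
      by apply/measurable_EFinP; apply: measurable_funX; exact: measurable_funB.
    apply: le_lt_trans (ltry 1); apply: le_trans key1.
    rewrite le_eqVlt; apply/orP; left; apply/eqP; apply: eq_integral => x _.
    by rewrite /= ger0_norm// sqr_ge0.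
  move=> /(sqiB (sf N0)); congr (sqi mu _); apply/funext => x.
  by rewrite opprB addrC subrK.
exists g; split => // e e0; have [N0 HN0] := key _ e0; exists N0 => n nN.
rewrite -lee_fin /ip /Rintegral fineK; last first.
  by apply: integrable_fin_num => //; apply: sqi_mul; exact: sqiB.
by under eq_integral do rewrite -expr2; exact: HN0.
Qed.
End L2_complete.

(** * Boxes, compact sets and measurability in the plane *)

Section plane.
Context {R : realType}.
Local Notation mu := (leb2 R).
Local Notation plane := (measurableTypeR R * measurableTypeR R)%type.
Implicit Types (f : R * R -> R) (y : R * R).

Definition box (M : R) : set (R * R) := [set y | `|y.1| <= M /\ `|y.2| <= M].

Lemma boxE M : box M = `[- M, M] `*` `[- M, M].
Proof.
by apply/seteqP; split => -[a b] /=; rewrite /box/= !in_itv/= -!ler_norml.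
Qed.

Lemma compact_box M : compact (box M).
Proof. by rewrite boxE; apply: compact_setX; exact: segment_compact. Qed.

Lemma box_compact (K : set (R * R)) : compact K -> exists2 M, 0 < M & K `<=` box M.
Proof.
move=> /compact_bounded[M [Mr HM]]; exists (`|M| + 1); first by rewrite ltr_pwDr.
move=> y Ky; have /= := HM (`|M| + 1) _ y Ky.
rewrite (le_lt_trans (ler_norm M)) ?ltrDl// => /(_ isT).
by rewrite prod_normE/= ge_max => /andP[].
Qed.

(** An open set is a countable union of products of rational balls, whereas the
    product sigma-algebra is generated by rectangles. *)
Lemma open_measurable2 (O : set (R * R)) : open O -> measurable (O : set plane).
Proof.
move=> oO; pose Q (p : rat * rat * nat) : set (R * R) :=
  ball (ratr p.1.1 : R) (p.2.+1%:R^-1 : R) `*` ball (ratr p.1.2 : R) (p.2.+1%:R^-1).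
have -> : O = \bigcup_(p in [set p | Q p `<=` O]) Q p.
  apply/seteqP; split=> [[a b] Oab|y [p /= QO Qy]]; last exact: QO.
  have /nbhs_ballP[e /= e0 be] : nbhs (a, b) O by exact: open_nbhs_nbhs.
  have [n en] : exists n : nat, n.+1%:R^-1 < e / 2.
    have e2 : 0 < e / 2 by rewrite divr_gt0.
    exists (Num.truncn (e / 2)^-1); rewrite invf_plt ?posrE//; last exact: truncnS_gt.
  have n0 : 0 < (n.+1%:R^-1 : R) by rewrite invr_gt0.
  have rr (c d : R) : 0 < d -> exists q : rat, `|ratr q - c| < d.
    move=> d0; have [|q] := @rat_in_itvoo R (c - d) (c + d); first by lra.
    by rewrite in_itv/= => /andP[q1 q2]; exists q; rewrite ltr_norml; apply/andP; split; lra.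
  have [qa Ha] := rr a _ n0; have [qb Hb] := rr b _ n0.
  exists ((qa, qb), n) => /=; last by split => /=; rewrite /ball/=.
  move=> [x z] [/= bx bz]; apply: be; split => /=; rewrite /ball/= in bx bz Ha Hb *.
    rewrite (_ : a - x = (ratr qa - x) - (ratr qa - a)); last ring.
    by rewrite (le_lt_trans (ler_normB _ _))// (lt_trans (ltrD bx Ha))//; move: en; set i := _^-1; lra.
  rewrite (_ : b - z = (ratr qb - z) - (ratr qb - b)); last ring.
  by rewrite (le_lt_trans (ler_normB _ _))// (lt_trans (ltrD bz Hb))//; move: en; set i := _^-1; lra.
rewrite bigcup_mkcond; apply: countable_bigcupT_measurable => // p.
by case: ifP => // _; apply: measurableX; exact: measurable_ball.
Qed.

Lemma cont_meas2 f : continuous f -> measurable_fun (setT : set plane) f.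
Proof.
move=> cf; apply: (measurability (RGenOpens.G (R:=R))).
  exact: RGenOpens.measurableE.
move=> _ -[_ [a [b ->]] <-]; rewrite setTI.
by apply: open_measurable2; apply: open_comp; [move=> y _; exact: cf|exact: interval_open].
Qed.

Lemma compact_measurable2 (K : set (R * R)) : compact K -> measurable (K : set plane).
Proof.
move=> cK; rewrite -[K]setCK; apply: measurableC; apply: open_measurable2.
by rewrite openC; apply: compact_closed => //; exact: norm_hausdorff.
Qed.

Lemma measurable_box M : measurable (box M : set plane).
Proof. by apply: compact_measurable2; exact: compact_box. Qed.

Lemma mu_box M : (mu (box M) < +oo)%E.
Proof.
rewrite boxE product_measure1E//.
have fin : (lebesgue_measure (`[(- M)%R, M]%classic : set R) < +oo)%E.
  by rewrite lebesgue_measure_itv/=; case: ifP => //; rewrite -EFinD ltry.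
by rewrite lte_mul_pinfty// ge0_fin_numE.
Qed.

Lemma cont_bounded f (K : set (R * R)) : compact K -> continuous f ->
  exists2 M, 0 < M & forall y, K y -> `|f y| <= M.
Proof.
move=> cK cf.
have [M [Mr HM]] : bounded_set (f @` K).
  apply: compact_bounded; apply: continuous_compact => //.
  exact: continuous_subspaceT.
exists (`|M| + 1); first by rewrite ltr_pwDr.
move=> y Ky; apply: (HM (`|M| + 1)); last by exists y.
by rewrite (le_lt_trans (ler_norm M)) ?ltrDl.
Qed.
End plane.

(** * Smooth functions *)

Section Sm.
Context {R : realType} {V : normedModType R} {J : Type} (dirs : J -> V).
Implicit Types f g h : V -> R.

(** Smoothness as a coinductive property: a function is smooth when it belongs to some
    class of continuous functions that is stable under the derivatives along [dirs].  Exhibiting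
    such a class avoids formulas for iterated derivatives. *)
Definition Sm f := exists C : set (V -> R), C f /\ forall h, C h ->
  continuous h /\ forall j, exists k, C k /\ forall x, is_derive x (dirs j) h (k x).

Lemma is_deriveI (W : normedModType R) (f : V -> W) x v l :
  (fun t => t^-1 *: ((f \o shift x) (t *: v) - f x)) @ 0^' --> l ->
  is_derive x v f l.
Proof.
by move=> fl; apply: DeriveDef; [apply/cvg_ex; exists l|exact/cvg_lim].
Qed.

(** Derivative lemmas produce functions and values written with the operations of
    function spaces; this restates them in the wanted form. *)
Lemma is_derive_conv (W : normedModType R) (f g : V -> W) x v a b :
  is_derive x v f a -> f =1 g -> a = b -> is_derive x v g b.
Proof. by move=> + /funext <- <-. Qed.

Lemma Sm_cont f : Sm f -> continuous f.
Proof. by move=> [C [Cf HC]]; case: (HC f Cf). Qed.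

Lemma Sm_der f j : Sm f -> exists k, Sm k /\ forall x, is_derive x (dirs j) f (k x).
Proof.
move=> [C [Cf HC]]; have [_ /(_ j)[k [Ck kE]]] := HC f Cf.
by exists k; split => //; exists C.
Qed.

Lemma Sm_coind (C : set (V -> R)) : (forall h, C h ->
    continuous h /\ forall j, exists k, C k /\ forall x, is_derive x (dirs j) h (k x)) ->
  forall f, C f -> Sm f.
Proof. by move=> HC f Cf; exists C. Qed.

Lemma Sm_cst (c : R) : Sm (fun=> c).
Proof.
apply: (@Sm_coind [set h | exists c, h = fun=> c]); last by exists c.
move=> _ [{}c ->]; split; first by move=> x; exact: cvg_cst.
by move=> j; exists (fun=> 0); split; [exists 0|move=> x; exact: is_derive_cst].
Qed.

(** Finite sums of functions of a class: derivatives of products and of composites leave the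
    class of products, not the class of sums of such. *)
Inductive Sm_alg (P : (V -> R) -> Prop) : (V -> R) -> Prop :=
| Sm_alg_base f : P f -> Sm_alg P f
| Sm_alg_add f g : Sm_alg P f -> Sm_alg P g -> Sm_alg P (fun x => f x + g x).

Lemma Sm_alg_closed (P : (V -> R) -> Prop) :
  (forall h, P h -> continuous h /\
     forall j, exists k, Sm_alg P k /\ forall x, is_derive x (dirs j) h (k x)) ->
  forall h, Sm_alg P h -> Sm h.
Proof.
move=> HP; apply: Sm_coind => h; elim=> {h} [h|f g _ [cf df] _ [cg dg]]; first exact: HP.
split; first by move=> x; apply: cvgD; [exact: cf|exact: cg].
move=> j; have [k [Pk dk]] := df j; have [l [Pl dl]] := dg j.
exists (fun x => k x + l x); split; first exact: Sm_alg_add.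
by move=> x; exact: is_deriveD.
Qed.

Lemma SmD f g : Sm f -> Sm g -> Sm (fun x => f x + g x).
Proof.
move=> sf sg; apply: (@Sm_alg_closed Sm); last by apply: Sm_alg_add; exact: Sm_alg_base.
move=> h sh; split; first exact: Sm_cont.
by move=> j; have [k [sk dk]] := Sm_der j sh; exists k; split => //; exact: Sm_alg_base.
Qed.

Lemma SmM f g : Sm f -> Sm g -> Sm (fun x => f x * g x).
Proof.
pose P (h : V -> R) := exists a b, [/\ Sm a, Sm b & h = fun x => a x * b x].
move=> sf sg; apply: (@Sm_alg_closed P); last by apply: Sm_alg_base; exists f, g.
move=> _ [a [b [sa sb ->]]]; split.
  by move=> x; apply: cvgM; exact: Sm_cont.
move=> j; have [k [sk dk]] := Sm_der j sa; have [l [sl dl]] := Sm_der j sb.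
exists (fun x => a x * l x + b x * k x); split.
  by apply: Sm_alg_add; apply: Sm_alg_base; [exists a, l|exists b, k].
by move=> x; exact: is_deriveM.
Qed.

Lemma SmZ c f : Sm f -> Sm (fun x => c * f x).
Proof. by move=> sf; apply: SmM => //; exact: Sm_cst. Qed.

Lemma SmN f : Sm f -> Sm (fun x => - f x).
Proof.
by move=> /(SmZ (-1)); congr Sm; apply/funext => x; rewrite mulN1r.
Qed.

Lemma SmB f g : Sm f -> Sm g -> Sm (fun x => f x - g x).
Proof. by move=> sf sg; apply: SmD => //; exact: SmN. Qed.

Lemma is_derive_comp1 (G : R -> R) h x v a b :
  is_derive x v h a -> is_derive (h x) 1 G b -> is_derive x v (fun y => G (h y)) (b * a).
Proof.
move=> dh dG; pose ht (t : R) := h (t *: v + x).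
have ht0 : ht 0 = h x by rewrite /ht scale0r add0r.
have dht : is_derive (0 : R) (1 : R) ht a.
  have [/derivable1P d1 e1] := dh; apply: is_derive_eq (derivableP d1) _.
  rewrite -e1 /derive; rewrite (_ : (fun t : R => t^-1 *: ((ht \o shift 0) (t *: 1) - ht 0)) =
    (fun t => t^-1 *: ((h \o shift x) (t *: v) - h x)))//.
  by apply/funext => t /=; rewrite ht0 /ht addr0 [_%:A]mulr1.
have dGt : is_derive (ht 0) (1 : R) G b by rewrite ht0.
have [dc dce] := is_derive1_comp dGt dht.
have d2 : derivable (fun y => G (h y)) x v by apply/derivable1P.
apply: is_derive_eq (derivableP d2) _.
rewrite -[RHS]dce /derive; rewrite (_ : (fun t : R => t^-1 *: (((G \o ht) \o shift 0) (t *: 1) - (G \o ht) 0)) =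
  (fun t => t^-1 *: (((fun y => G (h y)) \o shift x) (t *: v) - G (h x))))//.
by apply/funext => t /=; rewrite ht0 /ht addr0 [_%:A]mulr1.
Qed.

(** The derivatives of [G \o h] are sums of products of a function [G' \o h], for [G'] in a
    class of derivatives of [G], with a derivative of [h].  The class is only differentiable on
    [I], which covers the inverse and the logarithm. *)
Lemma Sm_comp (I : set R) (CG : set (R -> R)) h G :
  (forall G, CG G -> exists G', CG G' /\ forall t, I t -> is_derive t 1 G (G' t)) ->
  Sm h -> (forall x, I (h x)) -> CG G -> Sm (fun x => G (h x)).
Proof.
move=> HG sh Ih GG.
pose P (f : V -> R) := exists G a, [/\ CG G, Sm a & f = fun x => G (h x) * a x].
apply: (@Sm_alg_closed P); last first.
  apply: Sm_alg_base; exists G, (fun=> 1); split => //; first exact: Sm_cst.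
  by apply/funext => x; rewrite mulr1.
move=> _ [{GG}G [a [GG sa ->]]]; have [G' [GG' dG]] := HG G GG; split.
  move=> x; apply: cvgM; last exact: Sm_cont.
  apply: (@continuous_comp _ _ _ h G); first exact: Sm_cont.
  apply/differentiable_continuous/derivable1_diffP.
  by have [] := dG _ (Ih x).
move=> j; have [k [sk dk]] := Sm_der j sa; have [l [sl dl]] := Sm_der j sh.
exists (fun x => G (h x) * k x + G' (h x) * (l x * a x)); split.
  apply: Sm_alg_add; apply: Sm_alg_base; first by exists G, k.
  by exists G', (fun x => l x * a x); split => //; exact: SmM.
move=> x; have D := is_deriveM (is_derive_comp1 (dl x) (dG _ (Ih x))) (dk x).
apply: (@is_derive_eq _ _ _ (fun y => G (h y) * a y) x (dirs j) _ _ D).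
by rewrite /= -![_ *: _]/(_ * _); ring.
Qed.

End Sm.

Section Sm_real.
Context {R : realType}.

Definition Sm1 : (R -> R) -> Prop := @Sm R R unit (fun=> 1).

Lemma Sm1_id : Sm1 id.
Proof.
apply: (@Sm_coind _ _ _ _ [set h | h = id \/ exists c, h = fun=> c]); last by left.
move=> _ [->|[c ->]].
  split; first by move=> x; exact: cvg_id.
  move=> _; exists (fun=> 1); split; first by right; exists 1.
  by move=> x; exact: is_derive_id.
split; first by move=> x; exact: cvg_cst.
move=> _; exists (fun=> 0); split; first by right; exists 0.
by move=> x; exact: is_derive_cst.
Qed.

Lemma Sm_comp1 (V : normedModType R) (J : Type) (dirs : J -> V) h (G : R -> R) :
  Sm1 G -> Sm dirs h -> Sm dirs (fun x => G (h x)).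
Proof.
move=> [C [CG HC]] sh; apply: (@Sm_comp _ _ _ _ setT C) => // {CG}G CG.
have [_ /(_ tt)[k [Ck kE]]] := HC G CG.
by exists k; split => // t _; exact: kE.
Qed.

Lemma Sm_inv (V : normedModType R) (J : Type) (dirs : J -> V) h :
  Sm dirs h -> (forall x, h x != 0) -> Sm dirs (fun x => (h x)^-1).
Proof.
move=> sh h0; apply: (@Sm_comp _ _ _ _ [set t | t != 0]
  [set G | exists (c : R) n, G = fun t => c * t ^- n.+1] _ (fun t => t^-1)) => //; last first.
  by exists 1, 0%N; apply/funext => t; rewrite mul1r expr1.
move=> _ [c [n ->]]; exists (fun t => (- n.+1%:R * c) * t ^- n.+2); split.
  by exists (- n.+1%:R * c), n.+1.
move=> t t0; have D1 := is_deriveV (t0 : id t != 0) (is_derive_id t (1 : R)).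
have D2 := is_deriveZ c (is_deriveX n.+1 D1).
apply: (is_derive_conv D2) => [u|].
  by rewrite /= !fctE -![_ *: _]/(_ * _) exprVn.
rewrite /= -![_ *: _]/(_ * _) exprVn mulr1 !exprS; move: (t ^+ n) => u.
by rewrite !invfM expr0 invr1; ring.
Qed.

Lemma Sm_ln (V : normedModType R) (J : Type) (dirs : J -> V) h :
  Sm dirs h -> (forall x, 0 < h x) -> Sm dirs (fun x => ln (h x)).
Proof.
move=> sh h0.
pose CG := [set G : R -> R | G = @ln R \/ exists (c : R) n, G = fun t => c * t ^- n.+1].
apply: (@Sm_comp _ _ _ _ [set t | 0 < t] CG _ (@ln R)) => //; last by left.
move=> _ [->|[c [n ->]]].
  exists (fun t => 1 * t ^- 1); split; first by right; exists 1, 0%N.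
  by move=> t t0; apply: (is_derive_conv (is_derive1_ln t0)) => //; rewrite mul1r expr1.
exists (fun t => (- n.+1%:R * c) * t ^- n.+2); split.
  by right; exists (- n.+1%:R * c), n.+1.
move=> t t0; have tn0 : id t != 0 by rewrite gt_eqF.
have D1 := is_deriveV tn0 (is_derive_id t (1 : R)).
have D2 := is_deriveZ c (is_deriveX n.+1 D1).
apply: (is_derive_conv D2) => [u|].
  by rewrite /= !fctE -![_ *: _]/(_ * _) exprVn.
rewrite /= -![_ *: _]/(_ * _) exprVn mulr1 !exprS; move: (t ^+ n) => u.
by rewrite !invfM expr0 invr1; ring.
Qed.

(** The functions [p (1/x) * exp (-1/x)] extended by 0: the class is stable under derivation
    because the derivative replaces [p] by [(p - p') * X^2], see [is_derive_flat]. *)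
Definition flat (p : {poly R}) (x : R) : R :=
  if 0 < x then p.[x^-1] * expR (- x^-1) else 0.

(** Exponential decay beats every polynomial; this is what makes the functions [flat]
    differentiable at 0. *)
Lemma poly_expRN_bounded (p : {poly R}) :
  exists M, forall z, 0 <= z -> `|p.[z] * expR (- z)| <= M.
Proof.
have mono n (z : R) : 0 <= z -> `|z ^+ n * expR (- z)| <= n`!%:R.
  move=> z0; rewrite ger0_norm ?mulr_ge0 ?expR_ge0 ?exprn_ge0//.
  rewrite expRN ler_pdivrMr ?expR_gt0//; case: n => [|n].
    by rewrite expr0 fact0 mul1r; have := expR_ge1Dx z; lra.
  rewrite mulrC -ler_pdivrMr ?ltr0n ?fact_gt0//.
  by have := expR_ge1Dxn n z0; lra.
exists (\sum_(i < size p) `|p`_i| * i`!%:R) => z z0.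
rewrite horner_coef mulr_suml; apply: le_trans (ler_norm_sum _ _ _) _.
apply: ler_sum => i _; rewrite -mulrA normrM ler_wpM2l//; exact: mono.
Qed.

Lemma is_derive_flat p (x : R) : is_derive x (1 : R) (flat p) (flat ((p - p^`()) * 'X^2) x).
Proof.
have [x0|x0|<-] := ltgtP 0 x.
- have near_x : \near x, p.[x^-1] * expR (- x^-1) = flat p x.
    near=> t; rewrite /flat ifT//; near: t; exact: (cvgr_gt x (@cvg_id _ _) _ x0).
  apply: near_eq_is_derive near_x _.
  have xn0 : id x != 0 by rewrite gt_eqF.
  have D1 := is_deriveV xn0 (is_derive_id x (1 : R)).
  have D2 := @is_derive_comp1 _ _ (horner p) (fun t : R => t^-1) x 1 _ _ D1 (is_derive_poly p x^-1).
  have D3 := @is_derive_comp1 _ _ expR (fun t : R => - t^-1) x 1 _ _ (is_deriveN D1) (is_derive_expR (- x^-1)).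
  apply: (is_derive_conv (is_deriveM D2 D3)) => //.
  rewrite /= -![_ *: _]/(_ * _) /flat x0 !hornerE /=.
  by rewrite -exprVn; move: (x^-1) => u; ring.
- have near_x : \near x, 0 = flat p x.
    by near=> t; rewrite /flat ifF//; apply/negbTE; rewrite -leNgt ltW//; near: t; exact: lt_nbhsl.
  apply: near_eq_is_derive near_x _.
  by rewrite [X in is_derive _ _ _ X]/flat ifF ?(lt_gtF x0)//; exact: is_derive_cst.
- have [M HM] := poly_expRN_bounded (p * 'X^2).
  rewrite [X in is_derive _ _ _ X]/flat ltxx; apply: is_deriveI.
  apply/cvgrPdist_le => e e0; near=> t.
  rewrite sub0r normrN /= /shift/= addr0 [flat p 0]/flat ltxx subr0.
  rewrite [t *: 1]mulr1 -[_ *: _]/(_ * _) /flat.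
  case: ifPn => [t0|_]; last by rewrite mulr0 normr0 ltW.
  have tb : t <= e / (`|M| + 1).
    apply: ltW; rewrite (le_lt_trans (ler_norm _))//.
    by near: t; apply: dnbhs0_lt; rewrite divr_gt0// ltr_pwDr.
  have := HM t^-1; rewrite invr_ge0 (ltW t0) => /(_ isT).
  rewrite hornerM hornerXn => HMt.
  have -> : t^-1 * (p.[t^-1] * expR (- t^-1)) = t * (p.[t^-1] * t^-1 ^+ 2 * expR (- t^-1)).
    by field; rewrite gt_eqF.
  rewrite normrM (ger0_norm (ltW t0)); apply: le_trans (_ : t * (`|M| + 1) <= _).
    rewrite ler_wpM2l// ?(ltW t0)//; apply: le_trans HMt _.
    by rewrite (le_trans (ler_norm _))// lerDl.
  by rewrite -ler_pdivlMr// ltr_pwDr.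
Unshelve. all: by end_near. Qed.

Lemma Sm1_flat p : Sm1 (flat p).
Proof.
apply: (@Sm_coind _ _ _ _ [set h | exists p, h = flat p]); last by exists p.
move=> _ [{}p ->]; split.
  move=> x; apply/differentiable_continuous/derivable1_diffP.
  by have [] := is_derive_flat p x.
move=> _; exists (flat ((p - p^`()) * 'X^2)); split; first by exists ((p - p^`()) * 'X^2).
by move=> x; exact: is_derive_flat.
Qed.
End Sm_real.

(** * A smooth step, and calculus with partial derivatives *)

Section step.
Context {R : realType}.
Implicit Types x : R.

Lemma flat0 (p : {poly R}) x : x <= 0 -> flat p x = 0.
Proof. by move=> x0; rewrite /flat ltNge x0. Qed.

Lemma flat1_ge0 x : 0 <= flat 1 x.
Proof.
by rewrite /flat; case: ifP => // _; rewrite hornerC mul1r expR_ge0.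
Qed.

Lemma flat1_gt0 x : 0 < x -> 0 < flat 1 x.
Proof. by move=> x0; rewrite /flat x0 hornerC mul1r expR_gt0. Qed.

Definition dflat x := flat ((1 - 1^`()) * 'X^2) x.

Lemma dflat_ge0 x : 0 <= dflat x.
Proof.
rewrite /dflat /flat; case: ifP => // x0.
by rewrite derivC subr0 mul1r hornerXn mulr_ge0 ?expR_ge0 ?sqr_ge0.
Qed.

Definition sden x := flat 1 x + flat 1 (1 - x).

Lemma sden_gt0 x : 0 < sden x.
Proof.
rewrite /sden; have [x0|x0] := ltP 0 x.
  by rewrite ltr_pwDl ?flat1_gt0 ?flat1_ge0.
by rewrite ltr_wpDl ?flat1_gt0 ?flat1_ge0//; lra.
Qed.

(** The classical partition of unity of the line: the denominator never vanishes, since one of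
    the two arguments is positive. *)
Definition step x := flat 1 x / sden x.

Definition dstep x := (dflat x * flat 1 (1 - x) + flat 1 x * dflat (1 - x)) / sden x ^+ 2.

Lemma step0 x : x <= 0 -> step x = 0.
Proof. by move=> x0; rewrite /step flat0 ?mul0r. Qed.

Lemma step1 x : 1 <= x -> step x = 1.
Proof.
by move=> x1; rewrite /step /sden (@flat0 _ (1 - x)) ?addr0 ?divff ?gt_eqF ?flat1_gt0//; lra.
Qed.

Lemma step_ge0 x : 0 <= step x.
Proof. by rewrite /step divr_ge0 ?flat1_ge0 ?(ltW (sden_gt0 _)). Qed.

Lemma step_gt0 x : 0 < x -> 0 < step x.
Proof. by move=> x0; rewrite /step divr_gt0 ?flat1_gt0 ?sden_gt0. Qed.

Lemma step_le1 x : step x <= 1.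
Proof. by rewrite /step ler_pdivrMr ?sden_gt0// mul1r /sden lerDl flat1_ge0. Qed.

Lemma Sm1_1B (f : R -> R) : Sm1 f -> Sm1 (fun x => f (1 - x)).
Proof.
move=> sf; apply: Sm_comp1 sf _; apply: SmB; first exact: Sm_cst.
exact: Sm1_id.
Qed.

Lemma Sm1_step : Sm1 step.
Proof.
apply: SmM; first exact: Sm1_flat.
apply: Sm_inv; last by move=> x; rewrite gt_eqF ?sden_gt0.
by apply: SmD; [exact: Sm1_flat|apply: Sm1_1B; exact: Sm1_flat].
Qed.

Lemma Sm1_dstep : Sm1 dstep.
Proof.
have sf p := Sm1_flat p; apply: SmM.
  by apply: SmD; apply: SmM; rewrite ?/dflat; try apply: Sm1_1B; exact: sf.
apply: Sm_inv; last by move=> x; rewrite expf_eq0/= gt_eqF ?sden_gt0.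
have ss : Sm1 sden by apply: SmD; [exact: sf|apply: Sm1_1B; exact: sf].
exact: SmM.
Qed.

Lemma is_derive_step x : is_derive x (1 : R) step (dstep x).
Proof.
have d1 := is_derive_flat 1 x.
have d1x := is_deriveB (is_derive_cst (1 : R) x (1 : R)) (is_derive_id x (1 : R)).
have d2 := is_derive_comp1 d1x (is_derive_flat 1 (1 - x)).
have d3 := is_deriveD d1 d2.
have s0 : (flat 1 + (fun y => flat 1 (1 - y))) x != 0.
  by rewrite gt_eqF//; exact: sden_gt0.
apply: (is_derive_conv (is_deriveM d1 (is_deriveV s0 d3))) => //.
have := sden_gt0 x; rewrite /dstep /dflat /= -![_ *: _]/(_ * _) !fctE -/(sden x).
rewrite {2}/sden; rewrite /sden.
move: (flat 1 x) (flat 1 (1 - x)) => a b ab.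
by field; rewrite gt_eqF.
Qed.

Lemma dstep_ge0 x : 0 <= dstep x.
Proof.
by rewrite /dstep divr_ge0 ?sqr_ge0// addr_ge0// mulr_ge0 ?dflat_ge0 ?flat1_ge0.
Qed.

Lemma dstep0 x : x <= 0 \/ 1 <= x -> dstep x = 0.
Proof.
move=> [x0|x1]; rewrite /dstep /dflat.
  by rewrite !(@flat0 _ x)// !mul0r addr0 mul0r.
by rewrite !(@flat0 _ (1 - x)) ?mulr0 ?addr0 ?mul0r//; lra.
Qed.

(** The derivative is continuous and vanishes outside [[0, 1]]. *)
Lemma dstep_bounded : exists2 C, 0 < C & forall x, dstep x <= C.
Proof.
have [c _ Hc] : exists2 c : R, c \in `[0, 1]%R & forall t, t \in `[0, 1]%R -> dstep t <= dstep c.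
  apply: EVT_max => //; apply: continuous_subspaceT; exact: Sm_cont Sm1_dstep.
exists (dstep c + 1); first by rewrite ltr_wpDl ?dstep_ge0.
move=> x; have [x0|x0] := leP 0 x; have [x1|x1] := leP x 1.
- by have := Hc x; rewrite in_itv/= x0 x1 => /(_ isT); lra.
- by rewrite dstep0 ?addr_ge0 ?dstep_ge0//; right; exact: ltW.
- by rewrite dstep0 ?addr_ge0 ?dstep_ge0//; left; exact: ltW.
- by rewrite dstep0 ?addr_ge0 ?dstep_ge0//; left; exact: ltW.
Qed.
End step.

Section smooth.
Context {R : realType}.
Implicit Types (h : R * R -> R) (j : bool).

(** Smoothness in terms of all words in the partial derivatives amounts to membership in the
    class of these iterated derivatives. *)
Lemma smoothP h : smooth h <-> Sm (@dir R) h.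
Proof.
split=> [sh|[C [Ch HC]] s].
  apply: (@Sm_coind _ _ _ _ [set k | exists s, k = foldr partial h s]); last by exists [::].
  move=> _ [s ->]; split; first by move=> x; case: (sh s x).
  move=> j; exists (foldr partial h (j :: s)); split; first by exists (j :: s).
  by move=> x; apply: derivableP; case: (sh s x).
have Cs : C (foldr partial h s).
  elim: s => [//|j s /HC[_ /(_ j)[k [Ck dk]]]] /=.
  suff -> : partial j (foldr partial h s) = k by [].
  by apply/funext => x; have [_ <-] := dk x.
move=> x; have [cs ds] := HC _ Cs; split; first exact: cs.
by move=> j; have [k [_ /(_ x)[]]] := ds j.
Qed.

Lemma smooth_is_derive h j x : smooth h -> is_derive x (dir j) h (partial j h x).
Proof. by move=> /(_ [::] x)[_ /(_ j) /derivableP]. Qed.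

Lemma smooth_partial h j : smooth h -> smooth (partial j h).
Proof. by move=> sh s; have := sh (rcons s j); rewrite -cats1 foldr_cat. Qed.

Lemma smooth_cont h : smooth h -> continuous h.
Proof. by move=> /smoothP; exact: Sm_cont. Qed.

Lemma partialE h j x l : is_derive x (dir j) h l -> partial j h x = l.
Proof. by move=> [_ <-]. Qed.

Lemma partialD h k j x : smooth h -> smooth k ->
  partial j (fun x => h x + k x) x = partial j h x + partial j k x.
Proof.
by move=> sh sk; apply: partialE; apply: is_deriveD; exact: smooth_is_derive.
Qed.

Lemma partialM h k j x : smooth h -> smooth k ->
  partial j (fun x => h x * k x) x = h x * partial j k x + k x * partial j h x.
Proof.
by move=> sh sk; apply: partialE; apply: is_deriveM; exact: smooth_is_derive.
Qed.

Lemma partial_cst (c : R) j x : partial j (fun=> c) x = 0.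
Proof. by apply: partialE; exact: is_derive_cst. Qed.

Lemma smooth_cst (c : R) : smooth (fun=> c).
Proof. by apply/smoothP; exact: Sm_cst. Qed.

Lemma smoothD h k : smooth h -> smooth k -> smooth (fun x => h x + k x).
Proof. by move=> /smoothP sh /smoothP sk; apply/smoothP; exact: SmD. Qed.

Lemma smoothM h k : smooth h -> smooth k -> smooth (fun x => h x * k x).
Proof. by move=> /smoothP sh /smoothP sk; apply/smoothP; exact: SmM. Qed.

Lemma smoothB h k : smooth h -> smooth k -> smooth (fun x => h x - k x).
Proof. by move=> /smoothP sh /smoothP sk; apply/smoothP; exact: SmB. Qed.

Lemma smooth_comp1 h (G : R -> R) : Sm1 G -> smooth h -> smooth (fun x => G (h x)).
Proof. by move=> sG /smoothP sh; apply/smoothP; exact: Sm_comp1. Qed.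

Definition pr j (y : R * R) : R := if j then y.2 else y.1.

Lemma is_derive_pr i j (x : R * R) : is_derive x (dir j) (pr i) ((i == j)%:R).
Proof.
apply: is_deriveI.
have E : \forall t \near (0 : R)^', ((i == j)%:R : R) =
    t^-1 *: ((pr i \o shift x) (t *: dir j) - pr i x).
  near=> t; have t0 : t != 0 by near: t; exact: nbhs_dnbhs_neq.
  rewrite /= -[_ *: _]/(_ * _).
  by rewrite /shift/= /pr /dir; case: i; case: j; rewrite /= -?[t *: _]/(t * _)
    ?mulr1 ?mulr0 ?add0r ?addrK ?subrr ?mulr0 ?mulVf.
by apply: cvg_trans (near_eq_cvg E) _; exact: cvg_cst.
Unshelve. all: by end_near. Qed.

Lemma smooth_pr i : smooth (pr i).
Proof.
apply/smoothP; apply: (@Sm_coind _ _ _ _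
  [set h | h = pr i \/ exists c, h = fun=> c]); last by left.
move=> _ [->|[c ->]]; split.
- by move=> x; rewrite /pr; case: i; [exact: cvg_snd|exact: cvg_fst].
- move=> j; exists (fun=> (i == j)%:R); split; first by right; exists ((i == j)%:R).
  by move=> x; exact: is_derive_pr.
- by move=> x; exact: cvg_cst.
- move=> j; exists (fun=> 0); split; first by right; exists 0.
  by move=> x; exact: is_derive_cst.
Qed.

(** The squared euclidean norm, which is smooth, contrary to [eucl]. *)
Definition sqn (y : R * R) : R := y.1 ^+ 2 + y.2 ^+ 2.

Lemma sqn_ge0 y : 0 <= sqn y. Proof. by rewrite addr_ge0 ?sqr_ge0. Qed.

Lemma smooth_sqn : smooth sqn.
Proof.
apply: (@smoothD (fun y => pr false y * pr false y) (fun y => pr true y * pr true y));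
  by apply: smoothM; exact: smooth_pr.
Qed.

Lemma is_derive_sqn j x : is_derive x (dir j) sqn (2 * pr j x).
Proof.
have D i := is_deriveM (is_derive_pr i j x) (is_derive_pr i j x).
apply: (is_derive_conv (is_deriveD (D false) (D true))) => [y //|].
by rewrite /= -![_ *: _]/(_ * _); case: j {D}; rewrite /=; ring.
Qed.
End smooth.

(** * Real test functions and integration by parts *)

Section rtest.
Context {R : realType}.
Local Notation mu := (leb2 R).
Local Notation plane := (measurableTypeR R * measurableTypeR R)%type.
Local Notation leb := (@lebesgue_measure R).
Implicit Types (f h psi eta : R * R -> R) (j : bool) (O : set (R * R)).

(** The real analogue of [test_function]; a complex function is a test function when both
    of its components are ([testP]). *)
Definition rtest O psi := [/\ smooth psi, compact_support psi &
  closure [set x | psi x != 0] `<=` O].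

Lemma rtest_smooth O psi : rtest O psi -> smooth psi. Proof. by case. Qed.

Lemma rtestI O psi (K : set (R * R)) : smooth psi -> compact K -> K `<=` O ->
  (forall y, ~ K y -> psi y = 0) -> rtest O psi.
Proof.
move=> sp cK KO pK.
have clK : closure [set x | psi x != 0] `<=` K.
  have /closure_id -> : closed K by apply: compact_closed => //; exact: norm_hausdorff.
  by apply: closure_subset => y /= /eqP py; apply: contrapT => /pK.
split => //; last exact: subset_trans KO.
by apply: subclosed_compact cK clK; exact: closed_closure.
Qed.

Lemma rtest_out O psi : rtest O psi ->
  exists K, [/\ compact K, K `<=` O, closed K & forall y, ~ K y -> psi y = 0].
Proof.
move=> [sp cp sO]; exists (closure [set x | psi x != 0]); split => //.
  exact: closed_closure.
by move=> y; apply: contra_notP => /eqP py; exact: subset_closure.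
Qed.

Lemma rtestS O O' psi : O `<=` O' -> rtest O psi -> rtest O' psi.
Proof. by move=> OO' [sp cp sO]; split => //; exact: subset_trans OO'. Qed.

Lemma rtestMl O eta psi : smooth eta -> rtest O psi -> rtest O (fun y => eta y * psi y).
Proof.
move=> se /[dup] tp /rtest_out[K [cK KO _ pK]]; apply: (rtestI _ cK KO).
  by apply: smoothM => //; case: tp.
by move=> y /pK ->; rewrite mulr0.
Qed.

Lemma rtestZ O c psi : rtest O psi -> rtest O (fun y => c * psi y).
Proof. by apply: rtestMl; exact: smooth_cst. Qed.

Lemma rtestN O psi : rtest O psi -> rtest O (fun y => - psi y).
Proof.
by move=> /(rtestZ (-1)); congr rtest; apply/funext => y; rewrite mulN1r.
Qed.

Lemma rtest0 O : rtest O (fun=> 0).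
Proof.
apply: (@rtestI _ _ set0) => //; first exact: smooth_cst.
exact: compact0.
Qed.

Lemma rtestD O psi eta : rtest O psi -> rtest O eta -> rtest O (fun y => psi y + eta y).
Proof.
move=> /[dup] tp /rtest_out[K [cK KO _ pK]] /[dup] te /rtest_out[K' [cK' KO' _ pK']].
apply: (@rtestI _ _ (K `|` K')).
- by apply: smoothD; [case: tp|case: te].
- exact: compactU.
- by move=> y [/KO|/KO'].
- by move=> y /not_orP[/pK -> /pK' ->]; rewrite addr0.
Qed.

(** Near a point of the complement of the closed set [K] the function is constant. *)
Lemma partial_out h j (K : set (R * R)) : closed K -> (forall y, ~ K y -> h y = 0) ->
  forall y, ~ K y -> partial j h y = 0.
Proof.
move=> cK hK y Ky; apply: partialE.
have D : is_derive y (dir j) (fun=> 0 : R) (0 : R) by exact: is_derive_cst.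
apply: near_eq_is_derive D.
have : nbhs y (~` K) by apply: open_nbhs_nbhs; split => //; exact: closed_openC.
by apply: filterS => z /hK ->.
Qed.

Lemma rtest_partial O j psi : rtest O psi -> rtest O (partial j psi).
Proof.
move=> /[dup] tp /rtest_out[K [cK KO clK pK]]; apply: (rtestI _ cK KO).
  by apply: smooth_partial; case: tp.
exact: partial_out.
Qed.

Lemma rtest_bounded O psi : rtest O psi -> exists2 M, 0 < M & forall y, `|psi y| <= M.
Proof.
move=> /[dup] tp /rtest_out[K [cK KO clK pK]].
have [M M0 HM] := cont_bounded cK (smooth_cont (rtest_smooth tp)).
exists M => // y; have [/HM//|/pK ->] := pselect (K y).
by rewrite normr0 ltW.
Qed.

Lemma rtest_meas O psi : rtest O psi -> measurable_fun (setT : set plane) psi.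
Proof. by move=> [sp _ _]; apply: cont_meas2; exact: smooth_cont. Qed.

Lemma intg_on (K : set (R * R)) f : measurable (K : set plane) -> mu.-integrable K (EFin \o f) ->
  (forall y, ~ K y -> f y = 0) -> intg mu f.
Proof.
move=> mK; rewrite integrable_mkcond// => fK f0.
rewrite /intg (_ : EFin \o f = ((EFin \o f) \_ K))//.
apply/funext => y; rewrite patchE; case: ifPn => //.
by rewrite notin_setE => /f0 /= ->.
Qed.

Lemma intg_box (M c : R) f : measurable_fun (setT : set plane) f -> (forall y, `|f y| <= c) ->
  (forall y, ~ box M y -> f y = 0) -> intg mu f.
Proof.
move=> mf fc f0; apply: (@intg_on (box M)) => //; first exact: measurable_box.
apply: measurable_bounded_integrable; [exact: measurable_box|exact: mu_box| |].
  exact: measurable_funS mf.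
by exists c; split; [exact: num_real|move=> x cx y _ /=; rewrite (le_trans (fc y))// ltW].
Qed.

Lemma rtest_box O psi : rtest O psi -> exists2 M, 0 < M & forall y, ~ box M y -> psi y = 0.
Proof.
move=> /rtest_out[K [/box_compact[M M0 KM] _ _ pK]]; exists M => // y yM.
by apply: pK => /KM.
Qed.

Lemma rtest_intg O psi : rtest O psi -> intg mu psi.
Proof.
move=> /[dup] /rtest_meas mp /[dup] /rtest_bounded[c _ pc] /rtest_box[M _ pM].
exact: (intg_box mp pc pM).
Qed.

Lemma rtest_sqi O psi : rtest O psi -> sqi mu psi.
Proof.
move=> tp; split; first exact: rtest_meas tp.
by apply: (@rtest_intg O); apply: rtestMl => //; exact: rtest_smooth tp.
Qed.

Definition locint O f := forall K, compact K -> K `<=` O -> mu.-integrable K (EFin \o f).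

Lemma locint_mul O f psi : locint O f -> rtest O psi -> intg mu (fun y => f y * psi y).
Proof.
move=> lf /[dup] tp /rtest_out[K [cK KO _ pK]].
have mK := compact_measurable2 cK; apply: (@intg_on K) => //; last first.
  by move=> y /pK ->; rewrite mulr0.
suff : mu.-integrable K ((EFin \o f) \* (EFin \o psi))%E by apply: eq_integrable.
apply: integrableMl => //.
- exact: lf.
- exact: measurable_funS (rtest_meas tp).
- have [c c0 pc] := rtest_bounded tp; exists c; split; first exact: num_real.
  by move=> x cx y _ /=; rewrite (le_trans (pc y))// ltW.
Qed.

Lemma sqi_locint O f : sqi mu f -> locint O f.
Proof.
move=> [mf f2] K cK KO; have mK := compact_measurable2 cK.
have [M M0 KM] := box_compact cK.
have i1 : mu.-integrable K (EFin \o (fun=> 1 : R)).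
  apply: measurable_bounded_integrable => //.
    apply: le_lt_trans (mu_box M); apply: le_measure; rewrite ?inE//.
    exact: measurable_box.
  by exists 1; split => // x x1 y _ /=; rewrite normr1 ltW.
have i2 : mu.-integrable K (EFin \o (fun x => 1 + f x ^+ 2)).
  have := integrableD mK i1 (integrableS measurableT mK (@subsetT _ _) f2).
  by apply: eq_integrable.
apply: (le_integrable _ _ _ i2) => //.
  by apply/measurable_EFinP; exact: measurable_funS mf.
move=> x _ /=; rewrite lee_fin [leRHS]ger0_norm ?addr_ge0 ?sqr_ge0//.
have := sqr_ge0 (f x + 1); have := sqr_ge0 (f x - 1); have := sqr_ge0 (f x).
by case: (ger0P (f x)) => _; nra.
Qed.

Definition slice j (b t : R) : R * R := if j then (b, t) else (t, b).

Lemma cont_slice j b : continuous (slice j b).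
Proof.
move=> t; have c1 : (fun=> b : R) @ t --> b by exact: cvg_cst.
have c2 : (fun u : R => u) @ t --> t by exact: cvg_id.
by rewrite /slice; case: j; [exact: cvg_pair c1 c2|exact: cvg_pair c2 c1].
Qed.

(** A partial derivative is a derivative along a coordinate line, on which the
    fundamental theorem of calculus is available. *)
Lemma is_derive_slice j b t h l : is_derive (slice j b t) (dir j) h l ->
  is_derive t (1 : R) (fun u => h (slice j b u)) l.
Proof.
move=> [/cvg_ex[/= m hm] <-]; have dE : 'D_(dir j) h (slice j b t) = m by exact/cvg_lim.
rewrite dE; apply: is_deriveI; move: hm; rewrite (_ : (fun t0 : R => _) = 
   (fun t0 : R => t0^-1 *: (((fun u => h (slice j b u)) \o shift t) (t0 *: 1) - h (slice j b t))))//.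
apply/funext => u; congr (_ *: (h _ - _)); rewrite /= /shift /slice /dir; case: j {dE} => /=;
  by rewrite -[_ *: (_, _)]/(_, _)/= -[(_, _) + (_, _)]/(_, _)/= scaler0 add0r.
Qed.

Lemma ftc (F f : R -> R) a b : a < b -> (forall x, is_derive x (1 : R) F (f x)) ->
  continuous f -> (\int[leb]_(x in `[a, b]) (f x)%:E = (F b - F a)%:E)%E.
Proof.
move=> ab dF cf; rewrite (@continuous_FTC2 _ _ F)//.
- exact: continuous_subspaceT.
- have cF : continuous F.
    by move=> x; apply/differentiable_continuous/derivable1_diffP; have [] := dF x.
  split; first by move=> x _; have [] := dF x.
  + exact/cvg_at_right_filter/cF.
  + exact/cvg_at_left_filter/cF.
- by move=> x _; rewrite derive1E; have [_ ->] := dF x.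
Qed.

Lemma int_slice_partial0 j h M b : 0 < M -> smooth h -> (forall y, ~ box M y -> h y = 0) ->
  (\int[leb]_t (partial j h (slice j b t))%:E = 0)%E.
Proof.
move=> M0 sh hM.
have cB : closed (box M : set (R * R)).
  by apply: compact_closed; [exact: norm_hausdorff|exact: compact_box].
have pM := partial_out j cB hM.
have out t : ~ (`[- (M + 1), M + 1]%classic t) -> ~ box M (slice j b t).
  rewrite /= in_itv/= -ler_norml => H [] H1 H2; apply: H.
  by move: H1 H2; rewrite /slice; case: (j) => /= H1 H2; lra.
have -> : (\int[leb]_t (partial j h (slice j b t))%:E =
    \int[leb]_(t in `[(- (M + 1))%R, (M + 1)%R]) (partial j h (slice j b t))%:E)%E.
  rewrite [RHS]integral_mkcond; apply: eq_integral => t _.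
  rewrite patchE; case: ifPn => //; rewrite notin_setE => /out /pM -> //.
have sl t : is_derive t (1 : R) (fun u => h (slice j b u)) (partial j h (slice j b t)).
  by apply: is_derive_slice; exact: smooth_is_derive.
rewrite (ftc _ sl); first last.
- by move=> t; apply: continuous_comp; [exact: cont_slice|exact/smooth_cont/smooth_partial].
- by lra.
by rewrite !hM ?subrr// => -[]; rewrite /slice; case: (j) => /=;
  rewrite ?normrN ?(@ger0_norm _ (M + 1)); lra.
Qed.

(** Fubini, and the fundamental theorem of calculus along each coordinate line.  Applied to
    products it is the formula of integration by parts. *)
Lemma int_partial0 O j h : rtest O h -> \int[mu]_x partial j h x = 0.
Proof.
move=> th; have [M M0 hM] := rtest_box th; have sh := rtest_smooth th.
have ip : intg mu (partial j h) by exact/(@rtest_intg O)/rtest_partial.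
rewrite /Rintegral; case: j ip => ip.
- rewrite -integral12_prod_meas1//= /fubini_F.
  under eq_integral do rewrite (int_slice_partial0 true _ M0 sh hM).
  by rewrite integral0.
- rewrite -integral21_prod_meas1//= /fubini_G.
  under eq_integral do rewrite (int_slice_partial0 false _ M0 sh hM).
  by rewrite integral0.
Qed.

End rtest.

(** * A locally integrable function orthogonal to test functions vanishes *)

Section dynkin.
Context d (T : measurableType d) (R : realType) (mu : {measure set T -> \bar R}).

(** The sets over which the integral of [g] vanishes form a Dynkin system, so it is
    enough to test a stable generating family. *)
Lemma integral_dynkin d' (T' : measurableType d') (phi : T -> T')
    (G : set (set T')) (g : T -> \bar R) (D : set T) :
  measurable_fun setT phi -> measurable D ->
  @measurable _ T' = <<s G >> -> setI_closed G -> mu.-integrable setT g ->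
  (\int[mu]_(x in D) g x = 0)%E ->
  (forall A, G A -> (\int[mu]_(x in phi @^-1` A `&` D) g x = 0)%E) ->
  forall S, measurable S -> (\int[mu]_(x in phi @^-1` S `&` D) g x = 0)%E.
Proof.
move=> mphi mD GE GI ig gT gG S; rewrite {1}GE; move: S.
have mpre S : measurable S -> measurable (phi @^-1` S `&` D).
  by move=> mS; apply: measurableI => //; rewrite -[_ @^-1` _]setTI; exact: mphi.
apply: (dynkin_induction GE GI) => //=; first by rewrite preimage_setT setTI.
  move=> S mS gS; have mCS := measurableC mS.
  have E : phi @^-1` S `&` D `|` phi @^-1` (~` S) `&` D = D.
    by rewrite -setIUl preimage_setC setUv setTI.
  have mU : measurable_fun (phi @^-1` S `&` D `|` phi @^-1` (~` S) `&` D) g.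
    by rewrite E; apply: measurable_funS (measurable_int _ ig).
  have dj : [disjoint phi @^-1` S `&` D & phi @^-1` (~` S) `&` D].
    by apply/disj_setPS => x [[Sx _] [nSx _]]; exact: nSx.
  have := integral_setU mu (mpre _ mS) (mpre _ mCS) mU dj.
  by rewrite E gT gS add0e => <-.
move=> F mF tF gF; rewrite preimage_bigcup setI_bigcupl integral_bigcup//.
- by rewrite eseries0// => i _ _; exact: gF.
- apply: trivIset_setIr => i j _ _ [x [Fi Fj]]; apply: tF => //; by exists (phi x).
- by move=> k; exact: mpre.
- rewrite -setI_bigcupl -preimage_bigcup; apply: integrableS ig => //; apply: mpre.
  exact: bigcupT_measurable.
Qed.

Lemma Rint_dct (f : nat -> T -> R) (F G : T -> R) :
  (forall k, measurable_fun setT (f k)) ->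
  (forall x, f k x @[k --> \oo] --> F x) -> intg mu G ->
  (forall k x, `|f k x| <= G x) ->
  intg mu F /\ \int[mu]_x f k x @[k --> \oo] --> \int[mu]_x F x.
Proof.
move=> mf fF iG fG; have mF : measurable_fun setT F.
  by apply: (measurable_fun_cvg mf) => x _; exact: fF.
have [|||||i _ c] := @dominated_convergence _ _ _ mu setT measurableT
  (fun k => EFin \o f k) (EFin \o F) (EFin \o G).
- by move=> k; exact/measurable_EFinP.
- exact/measurable_EFinP.
- by apply: aeW => x _; apply: cvg_EFin; [exact: nearW|exact: fF].
- exact: iG.
- by apply: aeW => x k _ /=; rewrite lee_fin.
split => //; rewrite /Rintegral; apply: fine_cvg; rewrite fineK//.
exact: integrable_fin_num.
Qed.
End dynkin.

Section fundamental.
Context {R : realType}.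
Local Notation mu := (leb2 R).
Local Notation plane := (measurableTypeR R * measurableTypeR R)%type.
Implicit Types (g psi : R * R -> R) (O : set (R * R)).

(** A stable family that generates the Borel sets, and whose indicators are pointwise limits of
    smooth functions ([ray_approx]). *)
Definition ray : set (set R) := [set A | A = setT \/ exists a, A = `]-oo, a[%classic].

Lemma rayI : setI_closed ray.
Proof.
move=> A B [->|[a ->]] [->|[b ->]]; rewrite ?setTI ?setIT; first by left.
- by right; exists b.
- by right; exists a.
- right; exists (Num.min a b); apply/seteqP; split => x /=; rewrite !in_itv/= lt_min.
    by move=> [-> ->].
  by move=> /andP[].
Qed.

Lemma measurable_ray : @measurable _ (measurableTypeR R) = <<s ray >>.
Proof.
rewrite [LHS](@RGenInftyO.measurableE R); apply/seteqP; split.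
  apply: smallest_sub; first exact: smallest_sigma_algebra.
  by move=> A [a ->]; apply: sub_sigma_algebra; right; exists a.
apply: smallest_sub; first exact: smallest_sigma_algebra.
move=> A [->|[a ->]]; first by exact: (@measurableT _ (g_sigma_algebraType (@RGenInftyO.G R))).
by apply: sub_sigma_algebra; exists a.
Qed.

Lemma ray_approx A : ray A -> exists s : nat -> R -> R,
  [/\ forall k, Sm1 (s k), forall k x, 0 <= s k x <= 1 &
      forall x, s k x @[k --> \oo] --> (\1_A x : R)].
Proof.
move=> [->|[a ->]].
  exists (fun _ _ => 1); split => [k|k x|x]; [exact: Sm_cst|by rewrite ler01 lexx|].
  by rewrite indicT; exact: cvg_cst.
exists (fun k x => step (k%:R * (a - x))); split => [k|k x|x].
- apply: (@Sm_comp1 _ _ _ _ (fun x => k%:R * (a - x)) step); first exact: Sm1_step.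
  by apply: SmZ; apply: SmB; [exact: Sm_cst|exact: Sm1_id].
- by rewrite step_ge0 step_le1.
- apply: cvg_near_cst; rewrite indicE; have [xa|xa] := ltP x a.
    rewrite mem_set/= ?in_itv//=; exists (Num.truncn (a - x)^-1).+1 => // k /= Hk.
    apply: step1; rewrite -ler_pdivrMr ?subr_gt0// mul1r.
    by rewrite ltW// (lt_le_trans (truncnS_gt _))// ler_nat.
  rewrite memNset/= ?in_itv/= ?ltNge ?xa//; apply: nearW => k.
  by apply: step0; rewrite mulr_ge0_le0// subr_le0.
Qed.

Lemma ray2_int0 g : intg mu g ->
  (forall s1 s2 : R -> R, Sm1 s1 -> Sm1 s2 -> (forall x, 0 <= s1 x <= 1) ->
     (forall x, 0 <= s2 x <= 1) -> \int[mu]_y (g y * (s1 y.1 * s2 y.2)) = 0) ->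
  forall A B, ray A -> ray B -> (\int[mu]_(x in snd @^-1` B `&` fst @^-1` A) (g x)%:E = 0)%E.
Proof.
move=> ig H A B /ray_approx[s [ss s01 sA]] /ray_approx[t [st t01 tB]].
have := intg_meas ig => mg.
have ms k : measurable_fun (setT : set plane) (fun y => s k y.1 * t k y.2).
  apply: cont_meas2; apply/smooth_cont/smoothM; apply: smooth_comp1 => //.
    exact: (smooth_pr false).
  exact: (smooth_pr true).
have [] := @Rint_dct _ _ _ mu (fun k y => g y * (s k y.1 * t k y.2))
  (fun y => g y * (\1_A y.1 * \1_B y.2)) (fun y => `|g y|).
- by move=> k; exact: measurable_funM.
- by move=> y; apply: cvgM; [exact: cvg_cst|apply: cvgM; [exact: sA|exact: tB]].
- exact: integrable_norm.
- move=> k y; have /andP[s0 s1] := s01 k y.1; have /andP[t0 t1] := t01 k y.2.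
  by rewrite normrM ler_piMr// ger0_norm ?mulr_ge0// mulr_ile1.
move=> iF cF; have int0 : \int[mu]_y (g y * (\1_A y.1 * \1_B y.2)) = 0.
  apply/esym/(cvg_unique _ _ cF) => //.
  rewrite (_ : (fun k => _) = fun=> 0); first exact: cvg_cst.
  by apply/funext => k; exact: H.
have E : (EFin \o g) \_ (snd @^-1` B `&` fst @^-1` A) =
   EFin \o (fun y => g y * (\1_A y.1 * \1_B y.2)).
  apply/funext => y; rewrite patchE /= !indicE; case: ifPn.
    by rewrite inE/= => -[yB yA]; rewrite !mem_set// !mulr1.
  by rewrite notin_setE/= => /not_andP[] n; rewrite (memNset n) ?mul0r ?mulr0.
rewrite integral_mkcond E -[LHS]fineK; first by congr EFin.
exact: integrable_fin_num.
Qed.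

(** Passing to the limit, the integral of [g] over all products of half-lines vanishes,
    hence over all measurable sets; then over the sets where [g] has a sign. *)
Lemma null_of_smooth g : intg mu g ->
  (forall s1 s2 : R -> R, Sm1 s1 -> Sm1 s2 -> (forall x, 0 <= s1 x <= 1) ->
     (forall x, 0 <= s2 x <= 1) -> \int[mu]_y (g y * (s1 y.1 * s2 y.2)) = 0) ->
  {ae mu, forall y, g y = 0}.
Proof.
move=> ig H; have rr := ray2_int0 ig H.
have m1 : measurable_fun (setT : set plane) (fst : plane -> measurableTypeR R) by exact: measurable_fst.
have m2 : measurable_fun (setT : set plane) (snd : plane -> measurableTypeR R) by exact: measurable_snd.
have mr A : ray A -> measurable (A : set (measurableTypeR R)).
  by move=> rA; rewrite measurable_ray; exact: sub_sigma_algebra.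
have rT : ray setT by left.
have st1 A (B : set (measurableTypeR R)) : ray A -> measurable B ->
    (\int[mu]_(x in snd @^-1` B `&` fst @^-1` A) (g x)%:E = 0)%E.
  move=> rA; apply: (integral_dynkin m2 _ measurable_ray rayI ig) => //.
  - by rewrite -[_ @^-1` _]setTI; apply: m1 => //; exact: mr.
  - by have := rr A setT rA rT; rewrite preimage_setT setTI.
  - by move=> C rC; exact: rr.
have st2 (A B : set (measurableTypeR R)) : measurable A -> measurable B ->
    (\int[mu]_(x in fst @^-1` A `&` snd @^-1` B) (g x)%:E = 0)%E.
  move=> mA mB; move: A mA; apply: (integral_dynkin m1 _ measurable_ray rayI ig).
  - by rewrite -[_ @^-1` _]setTI; apply: m2.
  - by have := st1 setT B rT mB; rewrite preimage_setT setIT.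
  - by move=> C rC; rewrite setIC; exact: st1.
have mid : measurable_fun (setT : set plane) (id : plane -> plane) by exact: measurable_id.
have st3 (S : set plane) : measurable S -> (\int[mu]_(x in S) (g x)%:E = 0)%E.
  move=> mS; rewrite -[S]setIT.
  apply: (integral_dynkin mid measurableT
    (measurable_prod_measurableType _ _) _ ig) mS.
  - move=> _ _ [A mA [B mB <-]] [C mC [D mD <-]]; rewrite -setXI.
    exists (A `&` C); first exact: measurableI.
    by exists (B `&` D) => //; exact: measurableI.
  - by have := st2 setT setT measurableT measurableT; rewrite !preimage_setT setTI.
  - by move=> _ [A mA [B mB <-]]; rewrite setIT; exact: st2.
have E : ae_eq mu setT (EFin \o g) (cst 0%E).
  apply: integral_ae_eq => // E _ mE.
  by rewrite integral_cst// mul0e; exact: st3.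
by apply: filterS E => y /(_ I) [].
Qed.

(** Both domains of interest, the plane and the punctured plane, are exhausted by the
    positivity sets of countably many test functions, up to the origin, which is a null set. *)
Definition test_exhausted O := (exists chi : nat -> R * R -> R,
  [/\ forall n, rtest O (chi n), forall n y, 0 <= chi n y &
      forall y, O y -> exists n, 0 < chi n y]) /\ ~` O `<=` [set (0, 0)].

Lemma mu_origin : mu [set (0, 0)] = 0%E.
Proof.
have -> : [set (0, 0)] = [set 0] `*` [set 0] :> set (R * R).
  by apply/seteqP; split => [_ ->//|[a b] [/= -> ->]].
by rewrite product_measure1E//= lebesgue_measure_set1 mul0e.
Qed.

(** For a test function [chi] on [O], the product [g * chi] is integrable on the plane and
    orthogonal to bounded smooth functions, hence null; the functions [chi] exhaust [O]. *)
Lemma ae0_of_tests O g : test_exhausted O -> locint O g ->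
  (forall psi, rtest O psi -> \int[mu]_y (g y * psi y) = 0) ->
  {ae mu, forall y, g y = 0}.
Proof.
move=> [[chi [tchi chi0 chiO]] O0] lg H.
have ae_n n : {ae mu, forall y, g y * chi n y = 0}.
  apply: null_of_smooth; first exact: locint_mul lg (tchi n).
  move=> s1 s2 S1 S2 _ _; rewrite -[RHS](H (fun y => s1 y.1 * s2 y.2 * chi n y)).
    by apply: eq_Rintegral => y _; rewrite -mulrA [chi n y * _]mulrC.
  apply: rtestMl => //; apply: smoothM; apply: smooth_comp1 => //.
    exact: (smooth_pr false).
  exact: (smooth_pr true).
have ae0 : {ae mu, forall y, y != (0, 0) :> R * R}.
  exists [set (0, 0)]; split; [by apply: compact_measurable2; exact: compact_set1|exact: mu_origin|].
  by move=> y /= /negP; rewrite negbK => /eqP.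
have aeA := @ae_foralln _ _ _ mu (fun n y => g y * chi n y = 0) ae_n.
apply: aeS2 ae0 aeA => y y0 Hy.
have [Oy|/O0 /eqP] := pselect (O y); last by rewrite (negbTE y0).
have [n chin] := chiO y Oy; have /eqP := Hy n.
by rewrite mulf_eq0 (gt_eqF chin) orbF => /eqP.
Qed.

Lemma test_exhausted_meas O g : test_exhausted O -> locint O g -> measurable_fun (setT : set plane) g.
Proof.
move=> [[chi [tchi chi0 chiO]] O0] lg.
have oN : open [set t : R | t != 0] by exact: open_neq.
have mpos n : measurable ([set y | 0 < chi n y] : set plane).
  apply: open_measurable2; rewrite -[X in open X]/(chi n @^-1` [set t : R | 0 < t]).
  apply: open_comp; last exact: open_gt.
  by move=> y _; apply: smooth_cont; exact: rtest_smooth (tchi n).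
have -> : [set: plane] = (\bigcup_n [set y | 0 < chi n y]) `|` [set (0, 0)].
  apply/seteqP; split => // y _; have [Oy|/O0 ->] := pselect (O y); last by right.
  by left; have [n] := chiO y Oy; exists n.
apply/measurable_funU; [exact: bigcupT_measurable|by apply: compact_measurable2; exact: compact_set1|split].
  apply/measurable_fun_bigcup => // n.
  apply: (@eq_measurable_fun _ _ _ _ _ (fun y => g y * chi n y / chi n y)).
    by move=> y; rewrite inE/= => cy; rewrite mulfK// gt_eqF.
  apply: measurable_funM.
    exact: measurable_funS (intg_meas (locint_mul lg (tchi n))).
  apply: (@measurable_comp _ _ _ _ _ _ [set t : R | t != 0] GRing.inv) => //.
  - by apply: open_measurable; exact: oN.
  - by move=> _ [y /= cy <-]; rewrite gt_eqF.
  - apply: open_continuous_measurable_fun => //.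
    by move=> t; rewrite inE => t0; exact: inv_continuous.
  - exact: measurable_funS (rtest_meas (tchi n)).
exact: measurable_fun_set1.
Qed.
End fundamental.

(** * Minimisation of a quadratic functional *)

Section minimisation.
Context {R : realType} {E : zmodType} (sc : R -> E -> E) (D : set E).
Variables (q : E -> R) (b : E -> E -> R) (l : E -> R) (C : R).
Hypothesis sc1 : forall u, sc 1 u = u.
Hypothesis D0 : D !=set0.
Hypothesis DB : forall u v, D u -> D v -> D (u - v).
Hypothesis DZ : forall c u v, D u -> D v -> D (u + sc c v).
Hypothesis q0 : forall u, D u -> 0 <= q u.
Hypothesis qZ : forall c u v, D u -> D v ->
  q (u + sc c v) = q u + 2 * c * b u v + c ^+ 2 * q v.
Hypothesis lZ : forall c u v, D u -> D v -> l (u + sc c v) = l u + c * l v.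
Hypothesis lC : forall u, D u -> l u ^+ 2 <= C * q u.

(** Lax-Milgram without completeness.  The functional [q v - 2 l v] is bounded below
    by [- |C|]; along a sequence with values [1 / (n + 1)]-close to the infimum, the parallelogram
    identity makes the sequence Cauchy, and varying [v] along [w] makes its first variation small. *)
Lemma minimising_sequence : exists v : nat -> E,
  [/\ forall n, D (v n),
      forall n m N, (N <= n)%N -> (N <= m)%N -> q (v m - v n) <= 4 / N.+1%:R &
      forall n w, D w -> (b (v n) w - l w) ^+ 2 <= (q w + 1) / n.+1%:R].
Proof.
pose J u := q u - 2 * l u.
have JC u : D u -> - `|C| <= J u.
  move=> Du; rewrite /J; have := lC Du; have := q0 Du.
  have : C * q u <= `|C| * q u by rewrite ler_wpM2r ?q0// ler_norm.
  move: (l u) (q u) `|C| (normr_ge0 C) => y x c c0 cx x0 ly.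
  suff : 2 * y <= x + c by lra.
  have [y0|y0] := leP y 0; first by nra.
  rewrite -(@ler_pXn2r _ 2) ?nnegrE ?addr_ge0//; last by lra.
  by have := sqr_ge0 (x - c); nra.
have hi : has_inf [set J u | u in D].
  split; first by have [u Du] := D0; exists (J u), u.
  by exists (- `|C|) => _ [u Du <-]; exact: JC.
set m := inf [set J u | u in D].
have mJ u : D u -> m <= J u by move=> Du; apply: (ge_inf hi.2); exists u.
have /choice[v vP] : forall n : nat, exists u, D u /\ J u < m + n.+1%:R^-1.
  move=> n; have n0 : 0 < n.+1%:R^-1 :> R by rewrite invr_gt0.
  by have [_ [u Du <-] Ju] := inf_adherent n0 hi; exists u.
exists v; split.
- by move=> n; case: (vP n).
- move=> n k N Nn Nk; have [Dn Jn] := vP n; have [Dk Jk] := vP k.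
  have Dw := DB Dk Dn; have vk : v k = v n + sc 1 (v k - v n).
    by rewrite sc1 addrC subrK.
  have e1 : J (v k) = J (v n) + 2 * (b (v n) (v k - v n) - l (v k - v n)) + q (v k - v n).
    by rewrite {1}vk /J qZ// lZ//; ring.
  have := mJ _ (DZ (1 / 2) Dn Dw); rewrite /J qZ// lZ// => e2.
  have iN p : (N <= p)%N -> (p.+1%:R : R)^-1 <= N.+1%:R^-1.
    by move=> Np; rewrite lef_pV2 ?posrE// ler_nat.
  move: Jn Jk e1 e2 (iN n Nn) (iN k Nk); rewrite /J.
  move: (n.+1%:R^-1) (k.+1%:R^-1) (N.+1%:R^-1) => z y x *; lra.
- move=> n w Dw; have [Dn Jn] := vP n; set r := b (v n) w - l w.
  have qw := q0 Dw; have q1 : 0 < q w + 1 by lra.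
  have := mJ _ (DZ (- r / (q w + 1)) Dn Dw); rewrite /J qZ// lZ// => e2.
  have : r ^+ 2 / (q w + 1) <= n.+1%:R^-1.
    move: Jn e2; rewrite /J; set x := n.+1%:R^-1 => Jn e2.
    have e3 : 2 * r ^+ 2 / (q w + 1) - (r / (q w + 1)) ^+ 2 * q w <= x.
      have -> : 2 * r ^+ 2 / (q w + 1) - (r / (q w + 1)) ^+ 2 * q w =
        - (2 * (- r / (q w + 1)) * r + (- r / (q w + 1)) ^+ 2 * q w).
        by field; rewrite gt_eqF.
      by rewrite {2}/r; lra.
    apply: le_trans e3; rewrite -subr_ge0.
    have -> : 2 * r ^+ 2 / (q w + 1) - (r / (q w + 1)) ^+ 2 * q w - r ^+ 2 / (q w + 1) =
      (r / (q w + 1)) ^+ 2 by field; rewrite gt_eqF.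
    exact: sqr_ge0.
  by rewrite ler_pdivrMr// mulrC.
Qed.
End minimisation.

Section ip_more.
Context d (T : measurableType d) (R : realType) (mu : {measure set T -> \bar R}).
Implicit Types f g h : T -> R.

Lemma ip_sqrD f g c : sqi mu f -> sqi mu g ->
  ip mu (fun x => f x + c * g x) (fun x => f x + c * g x) =
  ip mu f f + 2 * c * ip mu f g + c ^+ 2 * ip mu g g.
Proof.
move=> sf sg; have scg := sqiZ c sg; have sfg := sqiD sf scg.
rewrite ipDr// ipZr// ![ip mu (fun x => _ + _) _]ipC !ipDr// !ipZr// [ip mu g f]ipC.
by ring.
Qed.

(** The discriminant of the nonnegative polynomial [c |-> |f + c g|^2]. *)
Lemma ip_CS f g : sqi mu f -> sqi mu g -> ip mu f g ^+ 2 <= ip mu f f * ip mu g g.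
Proof.
move=> sf sg.
have H c : 0 <= ip mu f f + 2 * c * ip mu f g + c ^+ 2 * ip mu g g.
  by rewrite -ip_sqrD// ip_ge0.
have [g0|g0] := eqVneq (ip mu g g) 0.
  rewrite g0 mulr0; have [->|fg0] := eqVneq (ip mu f g) 0; first by rewrite expr0n.
  have := H (- (ip mu f f + 1) / (2 * ip mu f g)); rewrite g0 mulr0 addr0.
  rewrite [X in _ + X](_ : _ = - (ip mu f f + 1)); first by lra.
  by field.
have {}g0 : 0 < ip mu g g by rewrite lt_def g0 ip_ge0.
have := H (- ip mu f g / ip mu g g).
rewrite (_ : _ + _ = (ip mu f f * ip mu g g - ip mu f g ^+ 2) / ip mu g g).
  by rewrite pmulr_lge0 ?invr_gt0// subr_ge0.
by field; rewrite gt_eqF.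
Qed.
End ip_more.

(** * Exhaustions of domains and density of test functions *)

Section density.
Context {R : realType}.
Local Notation mu := (leb2 R).
Local Notation plane := (measurableTypeR R * measurableTypeR R)%type.
Implicit Types (f g psi : R * R -> R) (O : set (R * R)).

Lemma compact_annulus (a b : R) : compact [set y : R * R | a <= sqn y <= b].
Proof.
have cs := smooth_cont (@smooth_sqn R).
apply: (@subclosed_compact _ _ (box (`|b| + 1))); last 2 first.
- exact: compact_box.
- move=> y /= /andP[_ yb]; have b0 : 0 <= `|b| by [].
  have {}yb : sqn y <= `|b| by rewrite (le_trans yb)// ler_norm.
  have E (t : R) : t ^+ 2 <= `|b| -> `|t| <= `|b| + 1.
    move=> tb; rewrite -(@ler_pXn2r _ 2) ?nnegrE ?addr_ge0// real_normK ?num_real//.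
    by apply: le_trans tb _; nra.
  by move: yb; rewrite /sqn => yb; split; apply: E; apply: le_trans yb; rewrite ?lerDl ?lerDr sqr_ge0.
- rewrite (_ : [set y | _] = sqn @^-1` [set t | a <= t] `&` sqn @^-1` [set t | t <= b]).
    by apply: closedI; apply: closed_comp => [y _|]; [exact: cs|exact: closed_ge|exact: cs|exact: closed_le].
  by apply/seteqP; split => y /=; [move=> /andP[]|move=> [-> ->]].
Qed.

Lemma smooth_step_sqn (a c : R) : smooth (fun y => step (a + c * sqn y)).
Proof.
apply: (@smooth_comp1 _ (fun y => a + c * sqn y)); first exact: Sm1_step.
by apply: smoothD; [exact: smooth_cst|apply: smoothM; [exact: smooth_cst|exact: smooth_sqn]].
Qed.

Lemma natr_gt (x : R) : exists n : nat, x < n.+1%:R.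
Proof.
have [x0|x0] := ltP x 0; first by exists 0%N; apply: lt_trans x0 _.
by exists (Num.truncn x); exact: truncnS_gt.
Qed.

Lemma test_exhausted_setT : test_exhausted (setT : set (R * R)).
Proof.
split; last by rewrite setCT.
exists (fun n y => step (n.+1%:R + (-1) * sqn y)); split => [n|n y|y _].
- apply: (rtestI _ (@compact_annulus 0 n.+1%:R)) => //; first exact: smooth_step_sqn.
  move=> y /negP; rewrite sqn_ge0/= -ltNge => yn; apply: step0.
  by rewrite mulN1r subr_le0 ltW.
- exact: step_ge0.
- by have [n yn] := natr_gt (sqn y); exists n; apply: step_gt0; rewrite mulN1r subr_gt0.
Qed.

Lemma test_exhausted_punctured : test_exhausted (@punctured R).
Proof.
split; last by move=> y /negP; rewrite negbK => /eqP.
exists (fun n y => step (n.+1%:R + (-1) * sqn y) * step (- n.+1%:R^-1 + 1 * sqn y)).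
split => [n|n y|y].
- apply: (rtestI _ (@compact_annulus n.+1%:R^-1 n.+1%:R)).
  + by apply: smoothM; exact: smooth_step_sqn.
  + move=> y /= /andP[y0 _]; apply/eqP => yE; move: y0; rewrite yE /sqn/= expr0n addr0.
    by rewrite leNgt invr_gt0 ltr0n.
  + move=> y /negP; rewrite negb_and -!ltNge => /orP[yn|yn].
      have -> : step (- n.+1%:R^-1 + 1 * sqn y) = 0.
        by apply: step0; rewrite mul1r addrC subr_le0 ltW.
      by rewrite mulr0.
    have -> : step (n.+1%:R + (-1) * sqn y) = 0.
      by apply: step0; rewrite mulN1r subr_le0 ltW.
    by rewrite mul0r.
- by rewrite mulr_ge0 ?step_ge0.
- rewrite /punctured/= => y0; have y1 : 0 < sqn y.
    rewrite lt_def sqn_ge0 andbT; apply: contra y0.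
    rewrite /sqn paddr_eq0 ?sqr_ge0// !sqrf_eq0.
    by case: y => a b /= /andP[/eqP -> /eqP ->].
  have [n yn] := natr_gt (Num.max (sqn y) (sqn y)^-1); exists n.
  move: yn; rewrite gt_max => /andP[yn yn'].
  rewrite mulr_gt0// step_gt0//; first by rewrite mulN1r subr_gt0.
  by rewrite mul1r addrC subr_gt0 invf_plt ?posrE.
Qed.

Lemma inv_nat_lt (e : R) : 0 < e -> exists n : nat, n.+1%:R^-1 < e.
Proof.
by move=> e0; have [n ne] := natr_gt e^-1; exists n; rewrite invf_plt ?posrE.
Qed.

Lemma rtestB O f g : rtest O f -> rtest O g -> rtest O (fun y => f y - g y).
Proof. by move=> tf tg; apply: rtestD => //; exact: rtestN. Qed.

Lemma sqr_small0 (x C : R) : (forall e, 0 < e -> x ^+ 2 <= C * e) -> x = 0.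
Proof.
move=> H; apply/eqP; rewrite -sqrf_eq0 eq_le sqr_ge0 andbT.
apply/ler_addgt0Pl => e e0; rewrite addr0.
have C0 : 0 < `|C| + 1 by rewrite ltr_pwDr.
have := H _ (divr_gt0 e0 C0); move/le_trans; apply.
rewrite mulrA ler_pdivrMr// mulrC ler_wpM2l ?(ltW e0)//.
by have := ler_norm C; lra.
Qed.

(** A projection argument: minimising the distance to [f] over test functions produces a
    limit [p] such that [f - p] is orthogonal to all test functions, hence null. *)
Lemma rtest_dense O f : test_exhausted O -> sqi mu f -> forall e, 0 < e ->
  exists2 psi, rtest O psi & ip mu (fun y => f y - psi y) (fun y => f y - psi y) <= e.
Proof.
move=> gO sf e e0; have tsq v := @rtest_sqi R O v.
have [] := @minimising_sequence R ((R * R) -> R) (fun c v y => c * v y) (rtest O)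
  (fun v => ip mu v v) (ip mu) (ip mu f) (ip mu f f).
- by move=> u; apply/funext => y; rewrite mul1r.
- by exists (fun=> 0); exact: rtest0.
- by move=> u v; exact: rtestB.
- by move=> c u v tu tv; apply: rtestD => //; exact: rtestZ.
- by move=> u _; exact: ip_ge0.
- by move=> c u v /tsq su /tsq sv; exact: ip_sqrD.
- by move=> c u v /tsq su /tsq sv; rewrite ipDr ?ipZr//; exact: sqiZ.
- by move=> u /tsq su; exact: ip_CS.
move=> v [tv Cv bv]; have sv n := tsq _ (tv n).
have [p [sp vp]] : exists p, sqi mu p /\ forall e, 0 < e -> exists N, forall n, (N <= n)%N ->
    ip mu (fun x => v n x - p x) (fun x => v n x - p x) <= e.
  apply: sqi_complete => // d d0.
  have d4 : 0 < d / 4 by rewrite divr_gt0.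
  have [N Nd] := inv_nat_lt d4.
  exists N => n m Nn Nm; apply: le_trans (Cv m n N Nm Nn) _.
  by rewrite mulrC -ler_pdivlMr// ltW.
have sfp := sqiB sf sp.
have fp : {ae mu, forall y, f y - p y = 0}.
  apply: (ae0_of_tests gO) => [|w tw]; first exact: sqi_locint.
  have sw := tsq _ tw; rewrite -/(ip mu (fun y => f y - p y) w).
  apply: (@sqr_small0 _ (2 * (ip mu w w + 1) + 2 * ip mu w w)) => d d0.
  have [N1 N1d] := inv_nat_lt d0; have [N2 N2d] := vp _ d0.
  pose n := maxn N1 N2.
  have h1 := bv n w tw; have h2 := ip_CS (sqiB (sv n) sp) sw.
  have h3 := N2d n (leq_maxr _ _).
  have h4 : n.+1%:R^-1 <= d.
    by apply: le_trans (ltW N1d); rewrite lef_pV2 ?posrE// ler_nat ltnS leq_maxl.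
  have e1 : ip mu (fun y => f y - p y) w =
     (ip mu (fun y => v n y - p y) w) - (ip mu (v n) w - ip mu f w).
    have ipB (a c : R * R -> R) : sqi mu a -> sqi mu c ->
        ip mu (fun y => a y - c y) w = ip mu a w - ip mu c w.
      move=> sa sc; rewrite ipC (_ : (fun y => _) = (fun y => a y + (-1) * c y)).
        by rewrite ipDr//; [rewrite ipZr// mulN1r ![ip mu w _]ipC|exact: sqiZ].
      by apply/funext => y; rewrite mulN1r.
    by rewrite !ipB//; ring.
  have w0 := ip_ge0 mu w.
  have h5 : (ip mu (v n) w - ip mu f w) ^+ 2 <= (ip mu w w + 1) * d.
    by apply: le_trans h1 _; rewrite ler_wpM2l// addr_ge0.
  have h6 : ip mu (fun y => v n y - p y) w ^+ 2 <= ip mu w w * d.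
    by apply: le_trans h2 _; rewrite mulrC ler_wpM2l.
  rewrite e1; move: h5 h6; set x := _ - ip mu f w; set z := ip mu _ w => h5 h6.
  move: x z (ip mu w w) h5 h6 {h1 h2 h3 e1 w0} => x z W h5 h6.
  by have := sqr_ge0 (z + x); nra.
have [N Nv] := vp e e0; exists (v N) => //; apply: le_trans (Nv N (leqnn _)).
rewrite le_eqVlt; apply/orP; left; apply/eqP; apply: Rint_ae.
- have m := sqi_meas (sqiB sf (sv N)); exact: measurable_funM.
- have m := sqi_meas (sqiB (sv N) sp); exact: measurable_funM.
- by apply: aeS fp => y /subr0_eq ->; ring.
Qed.
End density.

(** * A mollifying kernel of two variables *)

Section Rfubini.
Context d1 d2 (T1 : measurableType d1) (T2 : measurableType d2) (R : realType).
Variable m1 : {sigma_finite_measure set T1 -> \bar R}.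
Variable m2 : {sigma_finite_measure set T2 -> \bar R}.
Implicit Type H : T1 * T2 -> R.

Lemma Rfubini12 H : intg (m1 \x m2)%E H ->
  \int[(m1 \x m2)%E]_z H z = \int[m1]_x \int[m2]_y H (x, y).
Proof.
move=> iH; rewrite /Rintegral -(integral12_prod_meas1 iH); congr fine.
have iF := integrable_fubini_F iH.
apply: ae_eq_integral => //; first exact: measurable_int iF.
  have m := measurable_int _ iF.
  by apply/measurable_EFinP; exact: measurableT_comp m.
have := integrable_ae measurableT iF; apply: filterS => x /(_ I) Fx _.
by rewrite fineK.
Qed.

Lemma Rfubini21 H : intg (m1 \x m2)%E H ->
  \int[(m1 \x m2)%E]_z H z = \int[m2]_y \int[m1]_x H (x, y).
Proof.
move=> iH; rewrite /Rintegral -(integral21_prod_meas1 iH); congr fine.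
have iG : m2.-integrable setT (fubini_G m1 (EFin \o H)).
  have mG := measurable_fubini_G iH; have mH := measurable_int _ iH.
  apply/integrableP; split => //.
  have /(integrable21ltyP _ _ mH) := iH; apply: le_lt_trans.
  apply: ge0_le_integral => //.
  - by apply: measurableT_comp.
  - apply: (measurable_fun_fubini_tonelli_G (abse \o (EFin \o H))) => //=.
    exact: measurableT_comp mH.
  - move=> y _; apply: le_abse_integral => //.
    exact: measurableT_comp mH (@pair2_measurable _ _ T1 T2 y).
apply: ae_eq_integral => //; first exact: measurable_int iG.
  have m := measurable_int _ iG.
  by apply/measurable_EFinP; exact: measurableT_comp m.
have := integrable_ae measurableT iG; apply: filterS => x /(_ I) Fx _.
by rewrite fineK.
Qed.

Lemma intg_tensor (f : T1 -> R) (g : T2 -> R) : intg m1 f -> intg m2 g ->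
  intg (m1 \x m2)%E (fun z => f z.1 * g z.2).
Proof.
move=> i1 i2; have := intg_meas i1 => mf; have := intg_meas i2 => mg.
apply/integrable12ltyP.
  apply/measurable_EFinP; apply: measurable_funM.
    exact: measurableT_comp mf measurable_fst.
  exact: measurableT_comp mg measurable_snd.
under eq_integral => x _.
  under eq_integral do rewrite /= normrM EFinM.
  rewrite ge0_integralZl_EFin//; last by apply/measurable_EFinP; exact: measurableT_comp.
  over.
rewrite /=; set c := (\int[m2]_x _)%E.
have c0 : (0 <= c)%E by exact: integral_ge0.
have ci : (c < +oo)%E by have /integrableP[_] := i2.
rewrite -(@fineK _ c) ?ge0_fin_numE//.
under eq_integral do rewrite muleC.
rewrite ge0_integralZl_EFin ?fine_ge0//; last by apply/measurable_EFinP; exact: measurableT_comp.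
by rewrite lte_mul_pinfty ?lee_fin ?fine_ge0//; have /integrableP[_] := i1.
Qed.
End Rfubini.

Section leb2_sigma_finite.
Context {R : realType}.
Local Notation plane := (measurableTypeR R * measurableTypeR R)%type.

(** An alias of the Lebesgue measure of the plane, to which the structure of sigma-finite
    measure can be attached: products of this measure with itself are used below. *)
Definition leb2s : set plane -> \bar R := leb2 R.

HB.instance Definition _ := Measure.copy leb2s (leb2 R).

Lemma leb2s_sigma_finite : sigma_finite setT leb2s.
Proof.
exists (fun n => box n%:R) => [|n]; last first.
  by split; [exact: measurable_box|exact: mu_box].
apply/esym/seteqP; split => // y _; have [n yn] := natr_gt (`|y.1| + `|y.2|).
by exists n.+1 => //; split; apply: le_trans (ltW yn); rewrite ?lerDl ?lerDr.
Qed.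

HB.instance Definition _ := @Measure_isSigmaFinite.Build _ plane R leb2s leb2s_sigma_finite.
End leb2_sigma_finite.

Section mollifier.
Context {R : realType}.
Local Notation mu := (leb2 R).
Local Notation leb := (@lebesgue_measure R).
Local Notation plane := (measurableTypeR R * measurableTypeR R)%type.
Local Notation mu2 := (mu \x mu)%E.
Implicit Types (f g psi : R * R -> R).

(** The derivative of a step of width [e]: its integral is 1 by the fundamental theorem of
    calculus. *)
Definition mol (e t : R) := e^-1 * dstep (e^-1 * t).

Lemma mol_ge0 e t : 0 < e -> 0 <= mol e t.
Proof. by move=> e0; rewrite mulr_ge0 ?dstep_ge0// invr_ge0 ltW. Qed.

Lemma mol_out e t : 0 < e -> ~ (0 <= t <= e) -> mol e t = 0.
Proof.
move=> e0 /negP; rewrite negb_and -!ltNge => te; rewrite /mol dstep0 ?mulr0//.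
case/orP: te => te; [left|right].
  by rewrite ltW// pmulr_rlt0 ?invr_gt0.
by rewrite mulrC ler_pdivlMr// mul1r ltW.
Qed.

Lemma Sm1_mol e : Sm1 (mol e).
Proof.
apply: SmZ; apply: (@Sm_comp1 _ _ _ _ (fun t : R => e^-1 * t)).
  exact: Sm1_dstep.
by apply: SmZ; exact: Sm1_id.
Qed.

Lemma mol_bounded e : 0 < e -> exists2 C, 0 < C & forall t, mol e t <= C.
Proof.
move=> e0; have [C C0 HC] := @dstep_bounded R; exists (e^-1 * C).
  by rewrite mulr_gt0 ?invr_gt0.
by move=> t; rewrite /mol ler_wpM2l// invr_ge0 ltW.
Qed.

Lemma int_der1 (F f : R -> R) A B : A < B -> (forall x, is_derive x (1 : R) F (f x)) ->
  continuous f -> (forall x, ~ (A <= x <= B) -> f x = 0) ->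
  (\int[leb]_t (f t)%:E = (F B - F A)%:E)%E.
Proof.
move=> AB dF cf f0; rewrite -(ftc AB dF cf) [RHS]integral_mkcond.
apply: eq_integral => t _; rewrite patchE; case: ifPn => //.
by rewrite notin_setE/= in_itv/= => /f0 ->.
Qed.

Lemma is_derive_affine (a c t : R) : is_derive t (1 : R) (fun t => a + c * t) c.
Proof.
have D := is_deriveD (is_derive_cst a t (1 : R)) (is_deriveZ c (is_derive_id t (1 : R))).
apply: (is_derive_conv D) => // ; by rewrite /= add0r [_ *: _]mulr1.
Qed.

Lemma int_mol1 e b : 0 < e -> (\int[leb]_t (mol e (t - b))%:E = 1)%E.
Proof.
move=> e0; have d t : is_derive t (1 : R) (fun t => step (- (e^-1 * b) + e^-1 * t)) (mol e (t - b)).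
  have D := is_derive_comp1 (is_derive_affine (- (e^-1 * b)) e^-1 t) (is_derive_step _).
  apply: (is_derive_conv D) => //; rewrite /mol mulrC; congr (_ * dstep _); ring.
rewrite (@int_der1 _ _ (b - 1) (b + e) _ d).
- rewrite step1; last by rewrite mulrDr addKr mulVf ?gt_eqF.
  rewrite step0 ?subr0//.
  by rewrite mulrBr addKr mulr1 oppr_le0 invr_ge0 ltW.
- by lra.
- move=> t; apply: (@continuous_comp _ _ _ (fun t : R => t - b) (mol e)); last exact: Sm_cont (Sm1_mol e) _.
  by apply: cvgB; [exact: cvg_id|exact: cvg_cst].
- move=> t H; apply: mol_out => // /andP[h1 h2]; apply: H; apply/andP; split; lra.
Qed.

Lemma int_mol2 e a : 0 < e -> (\int[leb]_t (mol e (a - t))%:E = 1)%E.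
Proof.
move=> e0; have d t : is_derive t (1 : R) (fun t => - step (e^-1 * a + (- e^-1) * t)) (mol e (a - t)).
  have D := is_deriveN (is_derive_comp1 (is_derive_affine (e^-1 * a) (- e^-1) t) (is_derive_step _)).
  apply: (is_derive_conv D) => //; rewrite /mol mulrN opprK mulrC; congr (_ * dstep _); ring.
rewrite (@int_der1 _ _ (a - e) (a + 1) _ d).
- rewrite step0; last by rewrite mulNr mulrDr mulr1 opprD addrA subrr add0r oppr_le0 invr_ge0 ltW.
  rewrite step1 ?oppr0 ?add0r ?opprK//.
  by rewrite mulNr mulrBr mulVf ?gt_eqF//; lra.
- by lra.
- move=> t; apply: (@continuous_comp _ _ _ (fun t : R => a - t) (mol e)); last exact: Sm_cont (Sm1_mol e) _.
  by apply: cvgB; [exact: cvg_cst|exact: cvg_id].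
- move=> t H; apply: mol_out => // /andP[h1 h2]; apply: H; apply/andP; split; lra.
Qed.

(** A kernel concentrated within distance [e] of the diagonal, with integral 1 in each variable.
    It depends on the difference of its arguments only, so that its gradients in the two
    variables are opposite. *)
Definition J e (x y : R * R) := mol e (x.1 - y.1) * mol e (x.2 - y.2).

Lemma J_ge0 e x y : 0 < e -> 0 <= J e x y.
Proof. by move=> e0; rewrite mulr_ge0 ?mol_ge0. Qed.

Lemma J_out e x y : 0 < e -> ~ (`|x.1 - y.1| <= e /\ `|x.2 - y.2| <= e) -> J e x y = 0.
Proof.
move=> e0 /not_andP H; rewrite /J; case: H => H.
  rewrite [X in X * _]mol_out ?mul0r// => /andP[h1 h2]; apply: H.
  by rewrite ger0_norm.
rewrite [X in _ * X]mol_out ?mulr0// => /andP[h1 h2]; apply: H.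
by rewrite ger0_norm.
Qed.

Lemma meas_mol e : measurable_fun (setT : set (measurableTypeR R)) (mol e).
Proof. by apply: continuous_measurable_fun; exact: Sm_cont (Sm1_mol e). Qed.

Lemma meas_J e : measurable_fun (setT : set (plane * plane)) (fun z => J e z.1 z.2).
Proof.
have m11 := @measurable_fst _ _ (measurableTypeR R) (measurableTypeR R).
have m12 := @measurable_snd _ _ (measurableTypeR R) (measurableTypeR R).
have f1 := @measurable_fst _ _ plane plane; have f2 := @measurable_snd _ _ plane plane.
apply: measurable_funM.
  apply: (measurableT_comp (@meas_mol e)).
  by apply: measurable_funB; [exact: measurableT_comp m11 f1|exact: measurableT_comp m11 f2].
apply: (measurableT_comp (@meas_mol e)).
by apply: measurable_funB; [exact: measurableT_comp m12 f1|exact: measurableT_comp m12 f2].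
Qed.

Lemma int_J1 e y : 0 < e -> (\int[mu]_x (J e x y)%:E = 1)%E.
Proof.
move=> e0; have mJ : measurable_fun (setT : set plane) (fun x => (J e x y)%:E).
  apply/measurable_EFinP.
  exact: (measurableT_comp (meas_J e) (@pair2_measurable _ _ plane plane y)).
rewrite fubini_tonelli1//; last by move=> x; rewrite lee_fin J_ge0.
rewrite /fubini_F /= -[RHS](int_mol1 y.1 e0); apply: eq_integral => t _.
rewrite /J/=; under eq_integral do rewrite EFinM.
rewrite ge0_integralZl_EFin ?mol_ge0//.
- by rewrite int_mol1// mule1.
- by move=> x _; rewrite lee_fin mol_ge0.
- by apply/measurable_EFinP; apply: (measurableT_comp (meas_mol e)); exact: measurable_funB.
Qed.

Lemma int_J2 e x : 0 < e -> (\int[mu]_y (J e x y)%:E = 1)%E.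
Proof.
move=> e0; have mJ : measurable_fun (setT : set plane) (fun y => (J e x y)%:E).
  apply/measurable_EFinP.
  exact: (measurableT_comp (meas_J e) (@pair1_measurable _ _ plane plane x)).
rewrite fubini_tonelli1//; last by move=> y; rewrite lee_fin J_ge0.
rewrite /fubini_F /= -[RHS](int_mol2 x.1 e0); apply: eq_integral => t _.
rewrite /J/=; under eq_integral do rewrite EFinM.
rewrite ge0_integralZl_EFin ?mol_ge0//.
- by rewrite int_mol2// mule1.
- by move=> y _; rewrite lee_fin mol_ge0.
- by apply/measurable_EFinP; apply: (measurableT_comp (meas_mol e)); exact: measurable_funB.
Qed.
End mollifier.

(** * Averages against the kernel *)

Section kernel.
Context {R : realType}.
Local Notation mu := (leb2 R).
Local Notation plane := (measurableTypeR R * measurableTypeR R)%type.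
Local Notation mu2 := (@leb2s R \x @leb2s R)%E.
Implicit Types (f g h psi : R * R -> R).

Lemma meas_fst2 f : measurable_fun (setT : set plane) f ->
  measurable_fun (setT : set (plane * plane)) (fun z => f z.1).
Proof. by move=> mf; exact: measurableT_comp mf measurable_fst. Qed.

Lemma meas_snd2 f : measurable_fun (setT : set plane) f ->
  measurable_fun (setT : set (plane * plane)) (fun z => f z.2).
Proof. by move=> mf; exact: measurableT_comp mf measurable_snd. Qed.

(** Tonelli, and the normalisation of the kernel in the second variable. *)
Lemma J_left e f : 0 < e -> intg mu f ->
  intg mu2 (fun z => f z.1 * J e z.1 z.2) /\
  \int[mu2]_z (f z.1 * J e z.1 z.2) = \int[mu]_x f x.
Proof.
move=> e0 iF; have mf := intg_meas iF.
have inner (h : plane -> R) x : (\int[mu]_y (h x * J e x y)%:E = (h x)%:E)%E.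
  under eq_integral do rewrite EFinM.
  have iJ : intg mu (fun y => J e x y).
    apply/integrableP; split.
      apply/measurable_EFinP.
      exact: (measurableT_comp (meas_J e) (@pair1_measurable _ _ plane plane x)).
    under eq_integral do rewrite /= ger0_norm ?J_ge0//.
    by rewrite int_J2// ltry.
  by rewrite integralZl// int_J2// mule1.
have mfJ : measurable_fun (setT : set (plane * plane)) (fun z => f z.1 * J e z.1 z.2).
  by apply: measurable_funM; [exact: meas_fst2|exact: meas_J].
have I2 : intg mu2 (fun z => f z.1 * J e z.1 z.2).
  apply/integrable12ltyP; first exact/measurable_EFinP.
  have /integrableP[_] := iF; apply: le_lt_trans; rewrite le_eqVlt; apply/orP; left; apply/eqP.
  apply: eq_integral => x _ /=; rewrite -[RHS](inner (fun x => `|f x|)).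
  by apply: eq_integral => y _; rewrite normrM (ger0_norm (J_ge0 _ _ e0)).
split => //; rewrite Rfubini12//; apply: eq_Rintegral => x _.
by rewrite /Rintegral (inner f).
Qed.

Lemma J_right e f : 0 < e -> intg mu f ->
  intg mu2 (fun z => f z.2 * J e z.1 z.2) /\
  \int[mu2]_z (f z.2 * J e z.1 z.2) = \int[mu]_x f x.
Proof.
move=> e0 iF; have mf := intg_meas iF.
have inner (h : plane -> R) y : (\int[mu]_x (h y * J e x y)%:E = (h y)%:E)%E.
  under eq_integral do rewrite EFinM.
  have iJ : intg mu (fun x => J e x y).
    apply/integrableP; split.
      apply/measurable_EFinP.
      exact: (measurableT_comp (meas_J e) (@pair2_measurable _ _ plane plane y)).
    under eq_integral do rewrite /= ger0_norm ?J_ge0//.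
    by rewrite int_J1// ltry.
  by rewrite integralZl// int_J1// mule1.
have mfJ : measurable_fun (setT : set (plane * plane)) (fun z => f z.2 * J e z.1 z.2).
  by apply: measurable_funM; [exact: meas_snd2|exact: meas_J].
have I2 : intg mu2 (fun z => f z.2 * J e z.1 z.2).
  apply/integrable21ltyP; first exact/measurable_EFinP.
  have /integrableP[_] := iF; apply: le_lt_trans; rewrite le_eqVlt; apply/orP; left; apply/eqP.
  apply: eq_integral => y _ /=; rewrite -[RHS](inner (fun x => `|f x|)).
  by apply: eq_integral => x _; rewrite normrM (ger0_norm (J_ge0 _ _ e0)).
split => //; rewrite Rfubini21//; apply: eq_Rintegral => y _.
by rewrite /Rintegral (inner f).
Qed.

Definition K e f g := \int[mu2]_z (f z.1 * g z.2 * J e z.1 z.2).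

Lemma K_intg e f g : 0 < e -> sqi mu f -> sqi mu g ->
  intg mu2 (fun z => f z.1 * g z.2 * J e z.1 z.2).
Proof.
move=> e0 [mf f2] [mg g2]; have [i1 _] := J_left e0 f2; have [i2 _] := J_right e0 g2.
apply: (@intg_dom _ _ _ mu2 (fun z : plane * plane => f z.1 * g z.2 * J e z.1 z.2) (fun z : plane * plane => f z.1 ^+ 2 * J e z.1 z.2 + g z.2 ^+ 2 * J e z.1 z.2)).
- apply: measurable_funM; last exact: meas_J.
  by apply: measurable_funM; [exact: meas_fst2|exact: meas_snd2].
- exact: intgD.
- move=> z; rewrite -mulrDl normrM (ger0_norm (J_ge0 _ _ e0)) ler_wpM2r ?J_ge0//.
  have := sqr_ge0 (f z.1 + g z.2); have := sqr_ge0 (f z.1 - g z.2).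
  have := sqr_ge0 (f z.1); have := sqr_ge0 (g z.2).
  move: (f z.1) (g z.2) => a b *; rewrite ler_norml; apply/andP; split; nra.
Qed.

(** Bounding the product of two values by their squares reduces the estimate to the two
    normalisations of the kernel; [la] is the free weight of this inequality. *)
Lemma K_bound e f g (la : R) : 0 < e -> 0 < la -> sqi mu f -> sqi mu g ->
  `|K e f g| <= la * ip mu f f + la^-1 * ip mu g g.
Proof.
move=> e0 la0 sf sg; have iK := K_intg e0 sf sg.
have [mf f2] := sf; have [mg g2] := sg.
have [i1 v1] := J_left e0 f2; have [i2 v2] := J_right e0 g2.
have -> : ip mu f f = \int[mu]_x (f x ^+ 2) by apply: eq_Rintegral => x _; rewrite expr2.
have -> : ip mu g g = \int[mu]_x (g x ^+ 2) by apply: eq_Rintegral => x _; rewrite expr2.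
rewrite -v1 -v2 -!RintegralZl// -RintegralD//; [|exact: intgZ..].
apply: le_trans (le_normr_Rintegral _ iK) _ => //.
apply: le_Rintegral => //; first exact: integrable_norm.
  by apply: intgD; exact: intgZ.
move=> z _; move: (J e z.1 z.2) (J_ge0 z.1 z.2 e0) => j j0.
rewrite (mulrA la) (mulrA la^-1) -mulrDl normrM (ger0_norm j0) ler_wpM2r//.
have := sqr_ge0 (la * f z.1 + g z.2); have := sqr_ge0 (la * f z.1 - g z.2).
have := sqr_ge0 (f z.1); have := sqr_ge0 (g z.2).
move: (f z.1) (g z.2) => a b; rewrite -(ler_pM2l la0 `|_|) mulrDr (mulrA la la^-1) mulfV ?gt_eqF//.
move=> *; rewrite -[X in X * `|_|]gtr0_norm// -normrM ler_norml; apply/andP; split; nra.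
Qed.

Lemma KDl e f h g : 0 < e -> sqi mu f -> sqi mu h -> sqi mu g ->
  K e (fun x => f x + h x) g = K e f g + K e h g.
Proof.
move=> e0 sf sh sg; rewrite /K -RintegralD//; [|exact: K_intg..].
by apply: eq_Rintegral => z _; ring.
Qed.

Lemma rtest_lip O psi : rtest O psi ->
  exists2 L, 0 < L & forall x y, `|psi x - psi y| <= L * (`|x.1 - y.1| + `|x.2 - y.2|).
Proof.
move=> tp; have sp := rtest_smooth tp.
have [L0 L00 H0] := rtest_bounded (rtest_partial false tp).
have [L1 L10 H1] := rtest_bounded (rtest_partial true tp).
exists (L0 + L1); first exact: addr_gt0.
have lip j (b t u : R) : `|psi (slice j b t) - psi (slice j b u)| <=
    (L0 + L1) * `|t - u|.
  wlog tu : t u / u <= t.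
    move=> W; have [ut|tu] := leP u t; first exact: W.
    by rewrite distrC [`|t - u|]distrC W// ltW.
  have d v : is_derive v (1 : R) (fun w => psi (slice j b w)) (partial j psi (slice j b v)).
    by apply: is_derive_slice; exact: smooth_is_derive.
  have [|c _ ->] := MVT_segment tu (fun v _ => d v).
    apply: continuous_subspaceT => v; apply/differentiable_continuous/derivable1_diffP.
    by have [] := d v.
  rewrite normrM ler_wpM2r//; case: (j) => /=.
    by apply: le_trans (H1 _) _; rewrite lerDr ltW.
  by apply: le_trans (H0 _) _; rewrite lerDl ltW.
move=> [x1 x2] [y1 y2]; have a := lip true x1 x2 y2; have c := lip false y2 x1 y1.
have -> : psi (x1, x2) - psi (y1, y2) =
  (psi (x1, x2) - psi (x1, y2)) + (psi (x1, y2) - psi (y1, y2)) by ring.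
by apply: le_trans (ler_normD _ _) _; rewrite mulrDr addrC; exact: lerD.
Qed.
End kernel.

(** * Concentration of the kernel on the diagonal *)

Section compact_pairing.
Context {R : realType}.
Local Notation mu := (leb2 R).
Local Notation plane := (measurableTypeR R * measurableTypeR R)%type.
Local Notation mu2 := (@leb2s R \x @leb2s R)%E.
Implicit Types (f g h psi : R * R -> R).

Lemma intg_indic_box M : intg mu (\1_(box M) : R * R -> R).
Proof.
apply: (@intg_box _ M 1).
- by apply: measurable_indic; exact: measurable_box.
- by move=> y; rewrite indicE; case: (_ \in _); rewrite /= ?normr1// normr0.
- by move=> y yM; rewrite indicE memNset.
Qed.

Lemma box_far M e (x y : R * R) : `|x.1 - y.1| <= e -> `|x.2 - y.2| <= e ->
  box M x -> box (M + e) y.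
Proof.
have aux (a b : R) : `|a - b| <= e -> `|a| <= M -> `|b| <= M + e.
  move=> ab aM; rewrite (_ : b = a - (a - b)); last ring.
  by rewrite (le_trans (ler_normB _ _))// lerD.
by move=> h1 h2 [H1 H2]; split; [exact: aux h1 H1|exact: aux h2 H2].
Qed.

(** A test function is Lipschitz and the kernel lives within [e] of the diagonal. *)
Lemma K_cvg_test O psi g : rtest O psi -> sqi mu g ->
  exists2 C, 0 < C & forall e, 0 < e <= 1 -> `|K e psi g - ip mu psi g| <= C * e.
Proof.
move=> tp sg; have sp := rtest_sqi tp; have [mg g2] := sg.
have [L L0 HL] := rtest_lip tp; have [M M0 HM] := rtest_box tp.
pose h y := \1_(box (M + 1)) y + g y ^+ 2.
have ih : intg mu h by apply: intgD => //; exact: intg_indic_box.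
have h0 y : 0 <= h y by rewrite addr_ge0 ?sqr_ge0.
have H0 : 0 <= \int[mu]_y h y by apply: Rintegral_ge0.
have L20 : 0 < 2 * L by rewrite mulr_gt0.
exists (2 * L * (\int[mu]_y h y + 1)); first by rewrite mulr_gt0// ltr_wpDl.
move=> e /andP[e0 e1]; have Le0 : 0 <= 2 * L * e by rewrite mulr_ge0 ?ltW.
have ipg : intg mu (fun y => psi y * g y) by exact: sqi_mul.
have [i1 v1] := J_right e0 ipg; have iK := K_intg e0 sp sg.
have [i2 v2] := J_right e0 ih.
rewrite /K /ip -v1 -RintegralB//; apply: le_trans (le_normr_Rintegral _ _) _ => //.
  exact: intgB iK i1.
apply: (@le_trans _ _ (\int[mu2]_z (2 * L * e * (h z.2 * J e z.1 z.2)))).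
  apply: le_Rintegral => //; first by apply: integrable_norm => //; exact: intgB iK i1.
    exact: intgZ.
  move=> z _; have [close|far] := pselect (`|z.1.1 - z.2.1| <= e /\ `|z.1.2 - z.2.2| <= e); last first.
    by rewrite J_out// !mulr0 subr0 normr0.
  move: (J e z.1 z.2) (J_ge0 z.1 z.2 e0) => j j0.
  rewrite -mulrBl -mulrBl normrM (ger0_norm j0) mulrA ler_wpM2r//.
  have [c1 c2] := close.
  have [yM|yM] := pselect (box (M + 1) z.2); last first.
    rewrite (HM z.2) ?(HM z.1).
    - by rewrite subrr mul0r normr0 mulr_ge0.
    - move=> xM; apply: yM; have [a b] := box_far c1 c2 xM.
      by split; [apply: le_trans a _|apply: le_trans b _]; rewrite lerD2l.
    - by move=> [a b]; apply: yM; split; [apply: le_trans a _|apply: le_trans b _]; rewrite lerDl.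
  rewrite normrM; apply: ler_pM => //.
    apply: le_trans (HL _ _) _; rewrite -[2 * L]mulrC -mulrA ler_wpM2l ?(ltW L0)//.
    by rewrite mulr_natl mulr2n lerD.
  rewrite /h indicE mem_set//=.
  rewrite -[g z.2 ^+ 2]real_normK ?num_real//; move: `|g z.2| => t.
  by have := sqr_ge0 (t - 1); have := sqr_ge0 t; clear; nra.
by rewrite RintegralZl// v2 [leRHS]mulrAC ler_wpM2l// lerDl.
Qed.

(** The average converges for test functions on the left ([K_cvg_test]), and is uniformly bounded
    with respect to [f] ([K_bound]): conclude by density. *)
Lemma K_cvg f g d : sqi mu f -> sqi mu g -> 0 < d ->
  exists2 e0, 0 < e0 & forall e, 0 < e < e0 -> `|K e f g - ip mu f g| <= d.
Proof.
move=> sf sg d0; have g0 := ip_ge0 mu g.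
set G := ip mu g g in g0 *; have G1 : 0 < G + 1 by rewrite ltr_wpDl.
have GG : G / (G + 1) <= 1 by rewrite ler_pdivrMr// mul1r lerDl.
have Gn : G + 1 != 0 by rewrite gt_eqF.
have dn0 : d != 0 by rewrite gt_eqF.
pose la := 4 * (G + 1) / d.
have la0 : 0 < la by rewrite divr_gt0// mulr_gt0.
have dl0 : 0 < d / (4 * la) by rewrite divr_gt0// mulr_gt0.
have [psi tp fp] := rtest_dense test_exhausted_setT sf dl0.
have sp := rtest_sqi tp; have sfp := sqiB sf sp.
have [C C0 HC] := K_cvg_test tp sg.
have small : la * ip mu (fun y => f y - psi y) (fun y => f y - psi y) + la^-1 * G <= d / 2.
  have h1 : la * ip mu (fun y => f y - psi y) (fun y => f y - psi y) <= d / 4.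
    rewrite mulrC -ler_pdivlMr//; apply: le_trans fp _.
    by rewrite invfM mulrA.
  have h2 : la^-1 * G <= d / 4.
    rewrite (_ : _ * G = d / 4 * (G / (G + 1))); last by rewrite /la; field; rewrite Gn dn0.
    by rewrite ler_piMr// divr_ge0// ltW.
  by rewrite (_ : d / 2 = d / 4 + d / 4); [exact: lerD|field].
exists (Num.min 1 (d / 4 / C)); first by rewrite lt_min ltr01/= !divr_gt0.
move=> e /andP[e0]; rewrite lt_min => /andP[e1 eC].
have fE : f = (fun x => (f x - psi x) + psi x) by apply/funext => x; rewrite subrK.
have KE : K e f g = K e (fun x => f x - psi x) g + K e psi g by rewrite {1}fE KDl.
have IE : ip mu f g = ip mu (fun x => f x - psi x) g + ip mu psi g.
  by rewrite {1}fE ipC ipDr// [ip mu g (fun _ => _)]ipC [ip mu g psi]ipC.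
have b1 := K_bound e0 la0 sfp sg; have b2 : `|K e psi g - ip mu psi g| <= d / 4.
  apply: le_trans (HC e _) _; first by rewrite e0 ltW.
  by rewrite mulrC -ler_pdivlMr// ltW.
have b3 : `|ip mu (fun x => f x - psi x) g| <= d / 4.
  rewrite -(@ler_pXn2r _ 2) ?nnegrE//; last by rewrite divr_ge0 ?ltW.
  rewrite real_normK ?num_real//; apply: le_trans (ip_CS sfp sg) _.
  apply: (@le_trans _ _ (d / (4 * la) * G)); first by rewrite ler_wpM2r.
  rewrite (_ : _ * G = (d / 4) ^+ 2 * (G / (G + 1))); last by rewrite /la; field; rewrite Gn dn0.
  by rewrite ler_piMr// sqr_ge0.
rewrite KE IE opprD addrACA; apply: le_trans (ler_normD _ _) _.
have -> : d = (d / 2 + d / 4) + d / 4 by field.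
by apply: lerD => //; apply: le_trans (ler_normB _ _) _; apply: lerD => //; exact: le_trans small.
Qed.
End compact_pairing.

(** * Pairing a weak equation with a weakly differentiable function *)

Section doubling_identity.
Context {R : realType}.
Local Notation mu := (leb2 R).
Local Notation plane := (measurableTypeR R * measurableTypeR R)%type.
Local Notation mu2 := (@leb2s R \x @leb2s R)%E.
Implicit Types (f g h psi v p q : R * R -> R).

(** The partial derivative of the kernel in its first variable, [k] being the derivative of [mol e]. *)
Definition DJ (k : R -> R) e j (x y : R * R) : R :=
  if j then mol e (x.1 - y.1) * k (x.2 - y.2) else k (x.1 - y.1) * mol e (x.2 - y.2).

Lemma is_derive_prB i j (c : R) (x : R * R) :
  is_derive x (dir j) (fun x => pr i x - c) ((i == j)%:R).
Proof.
have D := is_deriveB (is_derive_pr i j x) (is_derive_cst c x (dir j)).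
by apply: (is_derive_conv D) => //; rewrite subr0.
Qed.

Lemma is_derive_Bpr i j (c : R) (x : R * R) :
  is_derive x (dir j) (fun x => c - pr i x) (- (i == j)%:R).
Proof.
have D := is_deriveB (is_derive_cst c x (dir j)) (is_derive_pr i j x).
by apply: (is_derive_conv D) => //; rewrite sub0r.
Qed.

Lemma DJ_left k e j x y : (forall t, is_derive t (1 : R) (mol e) (k t)) ->
  is_derive x (dir j) (fun x => J e x y) (DJ k e j x y).
Proof.
move=> dk; have D1 := is_derive_comp1 (is_derive_prB false j y.1 x) (dk _).
have D2 := is_derive_comp1 (is_derive_prB true j y.2 x) (dk _).
apply: (is_derive_conv (is_deriveM D1 D2)) => //.
by rewrite /DJ /= -![_ *: _]/(_ * _); case: j {D1 D2} => /=;
  rewrite ?mulr1 ?mulr0 ?add0r ?addr0// mulrC.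
Qed.

Lemma DJ_right k e j x y : (forall t, is_derive t (1 : R) (mol e) (k t)) ->
  is_derive y (dir j) (fun y => J e x y) (- DJ k e j x y).
Proof.
move=> dk; have D1 := is_derive_comp1 (is_derive_Bpr false j x.1 y) (dk _).
have D2 := is_derive_comp1 (is_derive_Bpr true j x.2 y) (dk _).
apply: (is_derive_conv (is_deriveM D1 D2)) => //.
by rewrite /DJ /= -![_ *: _]/(_ * _); case: j {D1 D2} => /=; rewrite ?mulr1n ?mulr0n; ring.
Qed.

Lemma rtest_J_left (e : R) (y : R * R) : 0 < e -> rtest setT (fun x => J e x y).
Proof.
move=> e0; apply: (rtestI _ (@compact_box R (`|y.1| + `|y.2| + e))) => //.
  apply: smoothM; apply: smooth_comp1; try exact: Sm1_mol.
    exact: (smoothB (smooth_pr false) (smooth_cst _)).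
  exact: (smoothB (smooth_pr true) (smooth_cst _)).
move=> x xM; apply: J_out => // -[h1 h2]; apply: xM; split.
  rewrite (_ : x.1 = (x.1 - y.1) + y.1); last ring.
  apply: le_trans (ler_normD _ _) _; rewrite addrC; apply: lerD => //; by rewrite lerDl.
rewrite (_ : x.2 = (x.2 - y.2) + y.2); last ring.
apply: le_trans (ler_normD _ _) _; rewrite addrC; apply: lerD => //; by rewrite lerDr.
Qed.

Lemma rtest_J_right (e : R) (x : R * R) : 0 < e -> rtest setT (fun y => J e x y).
Proof.
move=> e0; apply: (rtestI _ (@compact_box R (`|x.1| + `|x.2| + e))) => //.
  apply: smoothM; apply: smooth_comp1; try exact: Sm1_mol.
    exact: (smoothB (smooth_cst _) (smooth_pr false)).
  exact: (smoothB (smooth_cst _) (smooth_pr true)).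
move=> y yM; apply: J_out => // -[h1 h2]; apply: yM; split.
  rewrite (_ : y.1 = x.1 - (x.1 - y.1)); last ring.
  apply: le_trans (ler_normB _ _) _; apply: lerD => //; by rewrite lerDl.
rewrite (_ : y.2 = x.2 - (x.2 - y.2)); last ring.
apply: le_trans (ler_normB _ _) _; apply: lerD => //; by rewrite lerDr.
Qed.

Lemma mol_der (e : R) : 0 < e -> exists k, [/\ forall t, is_derive t (1 : R) (mol e) (k t),
  continuous k & exists2 C, 0 < C & forall j x y,
  `|DJ k e j x y| <= C /\ (~ (`|x.1 - y.1| <= e /\ `|x.2 - y.2| <= e) -> DJ k e j x y = 0)].
Proof.
move=> e0; have [k [/Sm_cont ck dk]] := Sm_der tt (Sm1_mol e).
exists k; split => //.
have k0 t : ~ (0 <= t <= e) -> k t = 0.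
  move=> H; have [_ <-] := dk t; have -> : 0 = 'D_1 (cst 0 : R -> R) t by rewrite derive_cst.
  apply: near_eq_derive; have oA : open (~` [set u : R | 0 <= u <= e]).
    rewrite (_ : [set u | _] = `[0, e]%classic); last by apply/seteqP; split => u /=; rewrite in_itv.
    by apply: closed_openC; exact: itv_closed.
  have : nbhs t (~` [set u : R | 0 <= u <= e]) by exact: open_nbhs_nbhs.
  by apply: filterS => u /= /(mol_out e0) ->.
have [C1 C10 H1] : exists2 C, 0 < C & forall t, `|k t| <= C.
  have [C C0 HC] := @cont_bounded R (fun y => k y.1) (box e) (@compact_box R e)
    (fun y => continuous_comp (@cvg_fst _ _ _ _ _) (ck y.1)).
  exists C => // t; have [te|te] := pselect (0 <= t <= e); last by rewrite k0// normr0 ltW.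
  have te' : `|t| <= e by case/andP: te => ? ?; rewrite ger0_norm.
  by apply: (HC (t, 0)); split => //=; rewrite normr0 ltW.
have [C2 C20 H2] := mol_bounded e0.
exists (C2 * C1); first exact: mulr_gt0.
move=> j x y; split.
  have mC t : `|mol e t| <= C2 by rewrite ger0_norm ?mol_ge0.
  by rewrite /DJ; case: j; [|rewrite [C2 * _]mulrC]; rewrite normrM; apply: ler_pM.
move=> /not_andP H; have mk0 t : ~ (`|t| <= e) -> k t = 0 /\ mol e t = 0.
  move=> te; have te' : ~ (0 <= t <= e) by move=> /andP[a b]; apply: te; rewrite ger0_norm.
  by split; [exact: k0|exact: mol_out].
by rewrite /DJ; case: H => /mk0[-> ->]; case: j; rewrite ?mul0r ?mulr0.
Qed.

Lemma DJ_meas k e j : continuous k ->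
  measurable_fun (setT : set (plane * plane)) (fun z => DJ k e j z.1 z.2).
Proof.
move=> ck; have mk := continuous_measurable_fun ck.
have m11 := @measurable_fst _ _ (measurableTypeR R) (measurableTypeR R).
have m12 := @measurable_snd _ _ (measurableTypeR R) (measurableTypeR R).
have f1 := @measurable_fst _ _ plane plane; have f2 := @measurable_snd _ _ plane plane.
have d1 : measurable_fun (setT : set (plane * plane)) (fun z => z.1.1 - z.2.1 : R).
  by apply: measurable_funB; [exact: measurableT_comp m11 f1|exact: measurableT_comp m11 f2].
have d2 : measurable_fun (setT : set (plane * plane)) (fun z => z.1.2 - z.2.2 : R).
  by apply: measurable_funB; [exact: measurableT_comp m12 f1|exact: measurableT_comp m12 f2].
by rewrite /DJ; case: j; apply: measurable_funM;
  solve [exact: measurableT_comp mk _ | exact: measurableT_comp (@meas_mol R e) _].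
Qed.

(** The distributional equation [- div P + q = 0] may be tested with [v] as with a test
    function.  Multiply the equation by [v y], after testing it with [J e _ y], and integrate in [y]:
    the derivatives of the kernel in [x] are the opposites of those in [y], so that the weak
    gradient [G] of [v] appears, and all terms become averages against the kernel, whose limits
    are known ([K_cvg]).  Compact support of [v] keeps [q], which is square integrable on boxes only,
    inside a fixed box. *)
Lemma compact_pairing M (q v : R * R -> R) (P G : bool -> R * R -> R) :
  (forall j, sqi mu (P j)) -> (forall m, sqi mu (fun x => \1_(box m) x * q x)) ->
  (forall psi, rtest setT psi ->
     \int[mu]_x (P false x * partial false psi x + P true x * partial true psi x + q x * psi x) = 0) ->
  sqi mu v -> (forall j, sqi mu (G j)) -> (forall y, ~ box M y -> v y = 0) ->
  (forall j psi, rtest setT psi ->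
     \int[mu]_x (v x * partial j psi x) = - \int[mu]_x (G j x * psi x)) ->
  ip mu (P false) (G false) + ip mu (P true) (G true) + ip mu (fun x => \1_(box (M + 1)) x * q x) v = 0.
Proof.
move=> sP sq eqn sv sG vM wd; set q' := fun x => _ * q x.
have sq' : sqi mu q' by exact: sq.
have [mv v2] := sv.
(* the regularised identity *)
have T0 e : 0 < e <= 1 -> K e (P false) (G false) + K e (P true) (G true) + K e q' v = 0.
  move=> /andP[e0 e1]; have [k [dk ck [C C0 HC]]] := mol_der e0.
  have tl y := rtest_J_left y e0; have tr x := rtest_J_right x e0.
  have pl j x y : partial j (fun x => J e x y) x = DJ k e j x y.
    by apply: partialE; exact: DJ_left.
  have pr' j x y : partial j (fun y => J e x y) y = - DJ k e j x y.
    by apply: partialE; exact: DJ_right.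
  have sDl j y : sqi mu (fun x => DJ k e j x y).
    rewrite (_ : (fun x => _) = partial j (fun x => J e x y)).
      exact: rtest_sqi (rtest_partial j (tl y)).
    by apply/funext => x; rewrite pl.
  have sDr j x : sqi mu (fun y => DJ k e j x y).
    rewrite (_ : (fun y => _) = fun y => - partial j (fun y => J e x y) y).
      exact/sqiN/(rtest_sqi (rtest_partial j (tr x))).
    by apply/funext => y; rewrite pr' opprK.
  (* the derivative of the kernel is bounded and concentrated on the diagonal, and [v] lives in [box M] *)
have iA j : intg mu2 (fun z => P j z.1 * v z.2 * DJ k e j z.1 z.2).
    have [mp p2] := sP j.
    have i1 := intgD (intg_indic_box (M + 1)) p2; have i2 := intgD (intg_indic_box M) v2.
    have i3 := intgZ C (intg_tensor (m1 := @leb2s R) (m2 := @leb2s R) i1 i2).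
    apply: (intg_dom _ i3).
      apply: measurable_funM; last exact: DJ_meas.
      by apply: measurable_funM; [exact: meas_fst2|exact: meas_snd2].
    have ab (c t : R) : c = 1 -> `|t| <= c + t ^+ 2.
      by move=> ->; rewrite -[t ^+ 2]real_normK ?num_real//; move: `|t| => u; have := sqr_ge0 (u - 1); have := sqr_ge0 u; nra.
    move=> z /=; have rhs0 : 0 <= C * ((\1_(box (M + 1)) z.1 + P j z.1 ^+ 2) *
        (\1_(box M) z.2 + v z.2 ^+ 2)).
      by rewrite mulr_ge0 ?(ltW C0)// mulr_ge0// addr_ge0// sqr_ge0.
    have [zM|zM] := pselect (box M z.2); last first.
      by rewrite (_ : P j z.1 * v z.2 * _ = 0) ?normr0//; rewrite vM// mulr0 mul0r.
    have [[c1 c2]|far] := pselect (`|z.1.1 - z.2.1| <= e /\ `|z.1.2 - z.2.2| <= e); last first.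
      by rewrite (_ : P j z.1 * v z.2 * _ = 0) ?normr0//; rewrite (HC j z.1 z.2).2// mulr0.
    have xM : box (M + 1) z.1.
      have [a b] := @box_far _ M e z.2 z.1 ltac:(by rewrite distrC) ltac:(by rewrite distrC) zM.
      by split; [apply: le_trans a _|apply: le_trans b _]; rewrite lerD2l.
    rewrite normrM mulrC; apply: ler_pM => //; first exact: (HC j z.1 z.2).1.
    by rewrite normrM; apply: ler_pM => //; apply: ab; rewrite indicE mem_set.
  have KA j : K e (P j) (G j) = \int[mu2]_z (P j z.1 * v z.2 * DJ k e j z.1 z.2).
    rewrite /K (Rfubini12 (K_intg e0 (sP j) (sG j))).
    rewrite (Rfubini12 (iA j)); apply: eq_Rintegral => x _ /=.
    under eq_Rintegral do rewrite -mulrA.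
    rewrite RintegralZl//; last exact: sqi_mul (sG j) (rtest_sqi (tr x)).
    under [RHS]eq_Rintegral do rewrite -mulrA.
    rewrite RintegralZl//; last exact: sqi_mul sv (sDr j x).
    congr (_ * _); apply: oppr_inj; rewrite -(wd j _ (tr x)).
    rewrite -mulN1r -RintegralZl//; last exact: sqi_mul sv (sDr j x).
    by apply: eq_Rintegral => y _; rewrite pr'; ring.
  rewrite !KA /K -(RintegralD measurableT (iA false) (iA true)).
  rewrite -(RintegralD measurableT (intgD (iA false) (iA true)) (K_intg e0 sq' sv)).
  rewrite (Rfubini21 (intgD (intgD (iA false) (iA true)) (K_intg e0 sq' sv))).
  rewrite -[RHS](_ : \int[mu]_x 0 = 0); last first.
    by rewrite /Rintegral integral0.
  apply: eq_Rintegral => y _ /=.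
  have [yM|yM] := pselect (box M y); last first.
    rewrite vM//; under eq_Rintegral do rewrite !mulr0 !mul0r !addr0.
    by rewrite /Rintegral integral0.
  rewrite (_ : Rintegral _ _ _ = v y * \int[mu]_x (P false x * partial false (fun x => J e x y) x +
     P true x * partial true (fun x => J e x y) x + q x * J e x y)).
    by rewrite eqn ?mulr0.
  have E x : q x * J e x y = q' x * J e x y.
    rewrite /q' indicE; have [xM|xM] := pselect (box (M + 1) x); first by rewrite mem_set// mul1r.
    rewrite J_out ?mulr0// => -[c1 c2]; apply: xM.
    have [a b] := @box_far _ M e y x ltac:(by rewrite distrC) ltac:(by rewrite distrC) yM.
    by split; [apply: le_trans a _|apply: le_trans b _]; rewrite lerD2l.
  rewrite -RintegralZl//; last first.
    rewrite (_ : EFin \o _ = EFin \o (fun x => P false x * DJ k e false x y + P true x * DJ k e true x y + q' x * J e x y)).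
      apply: intgD; first by apply: intgD; exact: sqi_mul.
      exact: sqi_mul sq' (rtest_sqi (tl y)).
    by apply/funext => x /=; rewrite !pl E.
  by apply: eq_Rintegral => x _; rewrite !pl E /DJ /=; ring.
apply/eqP; rewrite -normr_eq0 eq_le normr_ge0 andbT; apply/ler_addgt0Pl => d d0; rewrite addr0.
have d3 : 0 < d / 3 by rewrite divr_gt0.
have [e1 e10 H1] := K_cvg (sP false) (sG false) d3.
have [e2 e20 H2] := K_cvg (sP true) (sG true) d3.
have [e3 e30 H3] := K_cvg sq' sv d3.
pose e := Num.min (Num.min e1 e2) (Num.min e3 1) / 2.
have m0 : 0 < Num.min (Num.min e1 e2) (Num.min e3 1) by rewrite !lt_min e10 e20 e30 ltr01.
have e0 : 0 < e by rewrite divr_gt0.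
have em : e < Num.min (Num.min e1 e2) (Num.min e3 1) by rewrite /e ltr_pdivrMr// ltr_pMr// ltr1n.
move: em; rewrite !lt_min => /andP[/andP[ee1 ee2] /andP[ee3 ee4]].
have := H1 e; rewrite e0 ee1 => /(_ isT) h1; have := H2 e; rewrite e0 ee2 => /(_ isT) h2.
have := H3 e; rewrite e0 ee3 => /(_ isT) h3.
have := T0 e; rewrite e0 (ltW ee4) => /(_ isT) hT.
move: h1 h2 h3 hT; move: (K e (P false) (G false)) (K e (P true) (G true)) (K e q' v) => k1 k2 k3.
move: (ip mu (P false) (G false)) (ip mu (P true) (G true)) (ip mu q' v) => a1 a2 a3 h1 h2 h3 hT.
have -> : a1 + a2 + a3 = (k1 + k2 + k3) - (k1 - a1) - (k2 - a2) - (k3 - a3) by ring.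
rewrite hT sub0r; apply: le_trans (ler_normB _ _) _.
rewrite (_ : d = d / 3 + d / 3 + d / 3); last by field.
by apply: lerD => //; apply: le_trans (ler_normB _ _) _; rewrite normrN; exact: lerD.
Qed.
End doubling_identity.

(** * Real components of complex-valued functions *)

Section complexL2.
Context {R : realType}.
Local Notation mu := (leb2 R).
Local Notation plane := (measurableTypeR R * measurableTypeR R)%type.
Local Notation E := (R * R -> R[i]).
Implicit Types (f g u v w phi : E) (psi : R * R -> R) (O : set (R * R)) (c j : bool).

Definition reim c f : R * R -> R := fun x => if c then complex.Im (f x) else complex.Re (f x).

Definition ax (a : R) u v : E := fun y => u y + a%:C%C * v y.

Definition iu u : E := fun y => 'i%C * u y.

Definition gj j (g : R * R -> R[i] * R[i]) : E := fun x => if j then (g x).2 else (g x).1.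

Lemma reim_ax c a u v : reim c (ax a u v) = fun y => reim c u y + a * reim c v y.
Proof.
apply/funext => y; rewrite /reim /ax; case: (u y) (v y) => [p q] [r s].
by case: c; rewrite /= mul0r ?addr0 ?subr0.
Qed.

Lemma reim_iu c u : reim c (iu u) = fun y => if c then reim false u y else - reim true u y.
Proof.
apply/funext => y; rewrite /reim /iu; case: (u y) => [p q].
by case: c; rewrite /= !mul0r mul1r ?addr0 ?sub0r ?add0r.
Qed.

Lemma reimB c u v : reim c (fun y => u y - v y) = fun y => reim c u y - reim c v y.
Proof. by apply/funext => y; rewrite /reim; case: (u y) (v y) => [p q] [r s]; case: c. Qed.

Lemma L2P f : L2 f <-> forall c, sqi mu (reim c f).
Proof.
split=> [[/sqi_LfunP h1 /sqi_LfunP h2] []//|H].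
by split; apply/sqi_LfunP; [exact: (H false)|exact: (H true)].
Qed.

(** The real part of the hermitian product.  The imaginary part is recovered as [cip f (iu g)],
    see [inner2E], so that all the analysis is done over the reals. *)
Definition cip f g := ip mu (reim false f) (reim false g) + ip mu (reim true f) (reim true g).

Lemma cipC f g : cip f g = cip g f.
Proof. by rewrite /cip; congr (_ + _); exact: ipC. Qed.

Lemma cip_ge0 f : 0 <= cip f f.
Proof. by rewrite addr_ge0 ?ip_ge0. Qed.

Lemma cip_axr a f u v : L2 f -> L2 u -> L2 v -> cip f (ax a u v) = cip f u + a * cip f v.
Proof.
move=> /L2P sf /L2P su /L2P sv; rewrite /cip !reim_ax !ipDr ?ipZr//; try exact: sqiZ.
by ring.
Qed.

Lemma L2_ax a u v : L2 u -> L2 v -> L2 (ax a u v).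
Proof.
by move=> /L2P su /L2P sv; apply/L2P => c; rewrite reim_ax; apply: sqiD => //; exact: sqiZ.
Qed.

Lemma L2_iu u : L2 u -> L2 (iu u).
Proof.
by move=> /L2P su; apply/L2P => c; rewrite reim_iu; case: c; [exact: su|exact: sqiN].
Qed.

Lemma L2B u v : L2 u -> L2 v -> L2 (fun y => u y - v y).
Proof. by move=> /L2P su /L2P sv; apply/L2P => c; rewrite reimB; exact: sqiB. Qed.

Lemma cip_ax a u v : L2 u -> L2 v ->
  cip (ax a u v) (ax a u v) = cip u u + 2 * a * cip u v + a ^+ 2 * cip v v.
Proof.
move=> su sv; have suv := L2_ax a su sv.
by rewrite cip_axr// ![cip (ax _ _ _) _]cipC !cip_axr// [cip v u]cipC; ring.
Qed.

Lemma cip_iu u : cip (iu u) (iu u) = cip u u.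
Proof.
rewrite /cip !reim_iu addrC; congr (_ + _).
by apply: eq_Rintegral => x _; rewrite mulrNN.
Qed.

Lemma norm2_ge0 f : 0 <= norm2 f.
Proof. by rewrite /norm2 fine_ge0 ?Lnorm_ge0. Qed.

Lemma norm2E f : L2 f -> norm2 f ^+ 2 = cip f f.
Proof.
move=> /L2P sf; rewrite /norm2 unlock.
have i1 c : intg mu (fun x => reim c f x * reim c f x) by exact: sqi_mul.
have -> : (\int[mu]_x (`|(EFin \o (fun x0 => Normc.normc (f x0))) x| `^ 2) = (cip f f)%:E)%E.
  rewrite /cip -RintegralD//; [|exact: i1..].
  rewrite [RHS]fineK; last by apply: integrable_fin_num => //; exact: intgD.
  apply: eq_integral => x _; rewrite /= powR_mulrn// -normrX ger0_norm ?sqr_ge0//; congr EFin.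
  rewrite /reim; case: (f x) => [p q] /=; rewrite sqr_sqrtr ?addr_ge0 ?sqr_ge0//.
rewrite poweR_EFin /= -[in RHS](@sqr_sqrtr _ (cip f f)) ?cip_ge0//.
by rewrite powR12_sqrt// cip_ge0.
Qed.

Lemma inner2E f g : L2 f -> L2 g -> inner2 f g = (cip f g +i* cip f (iu g))%C.
Proof.
move=> /L2P sf /L2P sg; have sig c := (L2P (iu g)).1 (L2_iu ((L2P g).2 sg)) c.
rewrite /inner2 /cintegral /cip -!RintegralD//; try exact: sqi_mul.
congr (_ +i* _)%C; apply: eq_Rintegral => x _; rewrite ?reim_iu /reim;
  by case: (f x) (g x) => [p q] [r s] /=; ring.
Qed.

(** The support of a complex function is covered by the supports of its components. *)
Lemma testP O phi : test_function O phi <-> forall c, rtest O (reim c phi).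
Proof.
split=> [[s1 s2 cphi sO] c|H].
  have sub : [set x | reim c phi x != 0] `<=` [set x | phi x != 0].
    move=> x /=; apply: contra => /eqP p0; rewrite /reim p0; case: c; by rewrite /=.
  have subc := closure_subset sub.
  split; [by case: c {sub subc}|apply: subclosed_compact cphi subc; exact: closed_closure|].
  exact: subset_trans sO.
have [K [cK KO _ K0]] := rtest_out (H false); have [K' [cK' KO' _ K0']] := rtest_out (H true).
have clK : closure [set x | phi x != 0] `<=` K `|` K'.
  have /closure_id -> : closed (K `|` K').
    by apply: compact_closed; [exact: norm_hausdorff|exact: compactU].
  apply: closure_subset => x /= /eqP px; apply: contrapT => /not_orP[/K0 k0 /K0' k0'].
  by apply: px; move: k0 k0'; rewrite /reim; case: (phi x) => a b /= -> ->.
split.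
- exact: rtest_smooth (H false).
- exact: rtest_smooth (H true).
- by apply: subclosed_compact _ (compactU cK cK') clK; exact: closed_closure.
- by apply: subset_trans clK _ => x [/KO|/KO'].
Qed.

Lemma locint2P O f : locally_integrable2 O f <-> forall c, locint O (reim c f).
Proof.
split=> [H [] K cK KO|H K cK KO]; first by case: (H K cK KO).
  by case: (H K cK KO).
by split; [exact: (H false)|exact: (H true)].
Qed.

(** Weak gradients are tested with complex functions, but the components decouple: real tests
    give the components, and conversely a complex test is a combination of two real ones. *)
Lemma iwgP O v (g : R * R -> R[i] * R[i]) : is_weak_grad O v g <-> [/\ forall c, locint O (reim c v),
  forall j c, locint O (reim c (gj j g)) &
  forall j c psi, rtest O psi ->
    \int[mu]_x (reim c v x * partial j psi x) = - \int[mu]_x (reim c (gj j g) x * psi x)].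
Proof.
have real_test psi : rtest O psi -> test_function O (fun x => (psi x)%:C%C).
  by move=> tpsi; apply/testP => -[]; [exact: rtest0|exact: tpsi].
split=> [[lv l1 l2 H]|[lv lg H]].
  split; [exact: (locint2P _ _).1|by move=> j; apply: (locint2P O (gj j g)).1; case: j|].
  move=> j c psi tpsi; have [H1 H2] := H _ (real_test _ tpsi).
  have p0 jj x : partial jj (fun y => complex.Im ((psi y)%:C)%C) x = 0 by exact: partial_cst.
  have e (h : E) jj d : reim d (fun x => h x * cpartial jj (fun y => (psi y)%:C%C) x) =
      fun x => reim d h x * partial jj psi x.
    apply/funext => x; rewrite /reim /cpartial p0; case: (h x) => p q /=.
    by case: d => /=; rewrite mulr0 ?add0r ?subr0.
  have e' (h : E) d : reim d (fun x => h x * (psi x)%:C%C) = fun x => reim d h x * psi x.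
    apply/funext => x; rewrite /reim; case: (h x) => p q /=.
    by case: d => /=; rewrite mulr0 ?add0r ?subr0.
  have ci (h : E) : cintegral h = (\int[mu]_x reim false h x +i* \int[mu]_x reim true h x)%C by [].
  have conc (a b a' b' : R) : (a +i* b)%C = - (a' +i* b')%C -> a = - a' /\ b = - b'.
    by move=> [].
  by case: j; [move: H2|move: H1]; rewrite !ci !e !e' => /conc[]; case: c.
split; [exact: (locint2P _ _).2|exact: (locint2P O (gj false g)).2 (lg false)|exact: (locint2P O (gj true g)).2 (lg true)|].
move=> phi /testP tphi.
have key j : cintegral (fun x => v x * cpartial j phi x) = - cintegral (fun x => gj j g x * phi x).
  have iv c d := locint_mul (lv c) (rtest_partial j (tphi d)).
  have ig c d := locint_mul (lg j c) (tphi d).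
  rewrite /cintegral.
  have -> : - ((\int[mu]_x complex.Re (gj j g x * phi x)) +i* (\int[mu]_x complex.Im (gj j g x * phi x)))%C
    = (- (\int[mu]_x complex.Re (gj j g x * phi x)) +i* - (\int[mu]_x complex.Im (gj j g x * phi x)))%C by [].
  congr (_ +i* _)%C.
    rewrite (_ : Rintegral _ _ _ = \int[mu]_x (reim false v x * partial j (reim false phi) x - reim true v x * partial j (reim true phi) x)).
      rewrite RintegralB ?H//; [|exact: iv..].
      rewrite (_ : \int[mu]_x complex.Re _ = \int[mu]_x (reim false (gj j g) x * reim false phi x - reim true (gj j g) x * reim true phi x)).
        by rewrite RintegralB; [rewrite opprB opprK addrC| |exact: ig..].
      by apply: eq_Rintegral => x _; rewrite /reim; case: (gj j g x) (phi x) => [p q] [r s].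
    by apply: eq_Rintegral => x _; rewrite /cpartial /reim; case: (v x) => [p q].
  rewrite (_ : Rintegral _ _ _ = \int[mu]_x (reim false v x * partial j (reim true phi) x + reim true v x * partial j (reim false phi) x)).
    rewrite RintegralD ?H//; [|exact: iv..].
    rewrite (_ : \int[mu]_x complex.Im _ = \int[mu]_x (reim false (gj j g) x * reim true phi x + reim true (gj j g) x * reim false phi x)).
      by rewrite RintegralD; [rewrite opprD| |exact: ig..].
    by apply: eq_Rintegral => x _; rewrite /reim; case: (gj j g x) (phi x) => [p q] [r s].
  by apply: eq_Rintegral => x _; rewrite /cpartial /reim; case: (v x) => [p q].
by split; [exact: (key false)|exact: (key true)].
Qed.
End complexL2.

(** * The magnetic form on its maximal domain *)

Section magnetic.
Context {R : realType}.
Local Notation mu := (leb2 R).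
Local Notation plane := (measurableTypeR R * measurableTypeR R)%type.
Local Notation E := (R * R -> R[i]).
Implicit Types (u v w phi : E) (psi : R * R -> R) (c j : bool).

Lemma sbE u v : (fun y => u y - v y) = ax (-1) u v.
Proof. by apply/funext => y; rewrite /ax rmorphN1 mulN1r. Qed.

Definition aeq f g := forall c, {ae mu, forall x, reim c f x = reim c g x}.
Definition cmeas f := forall c, measurable_fun (setT : set plane) (reim c f).

Lemma L2_cmeas f : L2 f -> cmeas f.
Proof. by move=> /L2P sf c; exact: sqi_meas. Qed.

Lemma aeq_sym f g : aeq f g -> aeq g f.
Proof. by move=> fg c; apply: aeS (fg c) => x ->. Qed.

Lemma L2_aeq f g : L2 f -> cmeas g -> aeq f g -> L2 g.
Proof. by move=> /L2P sf mg fg; apply/L2P => c; exact: sqi_ae (sf c) (mg c) (fg c). Qed.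

Lemma cip_aeq f g h : cmeas f -> cmeas g -> cmeas h -> aeq f g -> cip h f = cip h g.
Proof. by move=> mf mg mh fg; rewrite /cip; congr (_ + _); apply: ip_ae. Qed.

Lemma cip_aeq2 f g : cmeas f -> cmeas g -> aeq f g -> cip f f = cip g g.
Proof. by move=> mf mg fg; rewrite (cip_aeq mf mg mf fg) cipC (cip_aeq mf mg mg fg). Qed.

Lemma cip_CS (f g : E) : L2 f -> L2 g -> cip f g ^+ 2 <= cip f f * cip g g.
Proof.
move=> sf sg.
have H a : 0 <= cip f f + 2 * a * cip f g + a ^+ 2 * cip g g.
  by rewrite -cip_ax// cip_ge0.
move: (cip f f) (cip g g) (cip f g) H (cip_ge0 f) (cip_ge0 g) => F G c H F0 G0.
have [G0'|Gn0] := eqVneq G 0.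
  rewrite G0' mulr0; have [->|c0] := eqVneq c 0; first by rewrite expr0n.
  have := H (- (F + 1) / (2 * c)); rewrite G0' mulr0 addr0.
  rewrite [X in _ + X](_ : _ = - (F + 1)); [by lra|by field].
have {}G0 : 0 < G by rewrite lt_def Gn0.
have := H (- c / G); rewrite (_ : _ + _ = (F * G - c ^+ 2) / G).
  by rewrite pmulr_lge0 ?invr_gt0// subr_ge0.
by field; rewrite gt_eqF.
Qed.

Definition Acomp (A : R * R -> R * R) j y : R := if j then (A y).2 else (A y).1.

(** The component [c] of [- i a v], for a real function [a]. *)
Definition rot c (a : R * R -> R) v y : R := if c then - (a y * reim false v y) else a y * reim true v y.

(** What is used of a magnetic potential [A] on a domain [O].  The potentials [A_s] satisfy
    it on the plane, and the Aharonov-Bohm potential, singular at the origin, on the punctured plane. *)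
Definition admissible (O : set (R * R)) (A : R * R -> R * R) := [/\ test_exhausted O,
  forall j, measurable_fun (setT : set plane) (Acomp A j) &
  forall K, compact K -> K `<=` O -> exists M, forall j y, K y -> `|Acomp A j y| <= M].

Variables (O : set (R * R)) (A : R * R -> R * R).

Definition mg j v : E := if j then mag_grad2 O A v else mag_grad1 O A v.

(** The largest space on which the form of potential [A] is finite. *)
Definition md v := [/\ L2 v, L2 (weighted v), exists g, is_weak_grad O v g &
  forall j, L2 (mg j v)].

(** The real part of the sesquilinear form attached to [mag_form]. *)
Definition bf u v := cip (mg false u) (mg false v) + cip (mg true u) (mg true v) +
  16^-1 * cip (weighted u) (weighted v).

Lemma bfC u v : bf u v = bf v u.
Proof. by rewrite /bf ![cip _ (mg _ v)]cipC [cip _ (weighted v)]cipC. Qed.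

Lemma bf_ge0 v : 0 <= bf v v.
Proof.
apply: addr_ge0; first by apply: addr_ge0; exact: cip_ge0.
by apply: mulr_ge0; [rewrite invr_ge0|exact: cip_ge0].
Qed.

Lemma mag_formE v : md v -> mag_form O A v = bf v v.
Proof.
move=> [_ Lw _ Lm]; rewrite /mag_form -/(mg false v) -/(mg true v).
by rewrite !norm2E.
Qed.

Lemma iwg_wg v : (exists g, is_weak_grad O v g) -> is_weak_grad O v (weak_grad O v).
Proof. by move=> [g Hg]; rewrite /weak_grad; case: xgetP => [h ->|/(_ g)]. Qed.

Lemma reim_mg c j v y : reim c (mg j v) y = reim c (gj j (weak_grad O v)) y + rot c (Acomp A j) v y.
Proof.
rewrite /mg /mag_grad1 /mag_grad2 /gj /rot /Acomp /reim; case: j; case: c => /=;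
 case: (v y) => p q; case: (weak_grad O v y) => [[a b] [a' b']] /=; ring.
Qed.

Hypothesis HA : admissible O A.

(** Two weak gradients differ by a function orthogonal to all test functions. *)
Lemma aeq_wg v g h : is_weak_grad O v g -> is_weak_grad O v h -> forall j, aeq (gj j g) (gj j h).
Proof.
have [gO _ _] := HA; move=> /iwgP[_ lg Hg] /iwgP[_ lh Hh] j c.
have l : locint O (fun y => reim c (gj j g) y - reim c (gj j h) y).
  move=> K cK KO; have := integrableB (compact_measurable2 cK) (lg j c K cK KO) (lh j c K cK KO).
  by apply: eq_integrable => //; exact: compact_measurable2.
have := ae0_of_tests gO l; move=> H; have {}H : {ae mu, forall y, reim c (gj j g) y - reim c (gj j h) y = 0}.
  apply: H => psi tpsi; under eq_Rintegral do rewrite mulrBl.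
  rewrite RintegralB//; [|exact: locint_mul (lg j c) tpsi|exact: locint_mul (lh j c) tpsi].
  by apply/eqP; rewrite subr_eq0 -eqr_opp -Hg// -Hh.
by apply: aeS H => y /subr0_eq.
Qed.

Lemma wg_cmeas v g j : is_weak_grad O v g -> cmeas (gj j g).
Proof. by have [gO _ _] := HA; move=> /iwgP[_ lg _] c; exact: test_exhausted_meas gO (lg j c). Qed.

Lemma rot_meas c j v : cmeas v -> measurable_fun (setT : set plane) (rot c (Acomp A j) v).
Proof.
have [_ mA _] := HA; move=> mv; rewrite /rot; case: c.
  by apply: measurableT_comp => //; apply: measurable_funM; [exact: mA|exact: mv].
by apply: measurable_funM; [exact: mA|exact: mv].
Qed.

Lemma mg_cmeas v j : cmeas v -> (exists g, is_weak_grad O v g) -> cmeas (mg j v).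
Proof.
move=> mv /iwg_wg Hw c; rewrite (_ : reim c _ = fun y => reim c (gj j (weak_grad O v)) y + rot c (Acomp A j) v y).
  by apply: measurable_funD; [exact: wg_cmeas Hw c|exact: rot_meas].
by apply/funext => y; exact: reim_mg.
Qed.

(** Any weak gradient, in particular the classical gradient of a test function, computes the
    magnetic gradient almost everywhere. *)
Lemma ae_mg v g j c : is_weak_grad O v g ->
  {ae mu, forall y, reim c (mg j v) y = reim c (gj j g) y + rot c (Acomp A j) v y}.
Proof.
move=> Hg; have Hw := iwg_wg (ex_intro _ g Hg).
by apply: aeS (@aeq_wg v _ _ Hw Hg j c) => y <-; exact: reim_mg.
Qed.

Lemma locintD (f g : R * R -> R) : locint O f -> locint O g -> locint O (fun x => f x + g x).
Proof.
move=> lf lg K cK KO; have := integrableD (compact_measurable2 cK) (lf K cK KO) (lg K cK KO).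
by apply: eq_integrable => //; exact: compact_measurable2.
Qed.

Lemma locintZ (a : R) (f : R * R -> R) : locint O f -> locint O (fun x => a * f x).
Proof.
move=> lf K cK KO; have := integrableZl (compact_measurable2 cK) a (lf K cK KO).
by apply: eq_integrable => //; exact: compact_measurable2.
Qed.

Definition axg (a : R) (g h : R * R -> R[i] * R[i]) x :=
  (ax a (gj false g) (gj false h) x, ax a (gj true g) (gj true h) x).

Lemma gj_axg a g h j : gj j (axg a g h) = ax a (gj j g) (gj j h).
Proof. by apply/funext => x; case: j. Qed.

Lemma iwg_ax a u v g h : is_weak_grad O u g -> is_weak_grad O v h ->
  is_weak_grad O (ax a u v) (axg a g h).
Proof.
move=> /iwgP[lu lg Hg] /iwgP[lv lh Hh]; apply/iwgP; split.
- by move=> c; rewrite reim_ax; apply: locintD => //; exact: locintZ.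
- by move=> j c; rewrite gj_axg reim_ax; apply: locintD => //; exact: locintZ.
- move=> j c psi tp; rewrite gj_axg !reim_ax.
  have tj := rtest_partial j tp.
  have i1 := locint_mul (lu c) tj; have i2 := locint_mul (lv c) tj.
  have i3 := locint_mul (lg j c) tp; have i4 := locint_mul (lh j c) tp.
  under eq_Rintegral do rewrite mulrDl -mulrA.
  under [in RHS]eq_Rintegral do rewrite mulrDl -mulrA.
  rewrite !RintegralD//; try exact: intgZ.
  by rewrite !RintegralZl// Hg// Hh//; ring.
Qed.

Lemma weighted_ax a u v : weighted (ax a u v) = ax a (weighted u) (weighted v).
Proof. by apply/funext => y; rewrite /weighted /ax; ring. Qed.

Lemma weighted_iu u : weighted (iu u) = iu (weighted u).
Proof. by apply/funext => y; rewrite /weighted /iu; ring. Qed.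

(** Only almost everywhere: the weak gradient is selected by choice, and the selections for [u],
    [v] and their combination are unrelated. *)
Lemma mg_ax a u v j : md u -> md v -> aeq (mg j (ax a u v)) (ax a (mg j u) (mg j v)).
Proof.
move=> [_ _ /iwg_wg Hu _] [_ _ /iwg_wg Hv _] c.
apply: aeS (ae_mg j c (iwg_ax a Hu Hv)) => y ->.
by rewrite gj_axg /rot !reim_ax !reim_mg /rot; case: c; ring.
Qed.

Lemma md_ax a u v : md u -> md v -> md (ax a u v).
Proof.
move=> du dv; have [Lu wu Eu mu'] := du; have [Lv wv Ev mv] := dv.
have Ea : exists g, is_weak_grad O (ax a u v) g.
  by have [g Hg] := Eu; have [h Hh] := Ev; exists (axg a g h); exact: iwg_ax.
have La := L2_ax a Lu Lv; split => //; first by rewrite weighted_ax; exact: L2_ax.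
move=> j; apply: L2_aeq (aeq_sym (mg_ax a j du dv)).
  exact: L2_ax.
by apply: mg_cmeas => //; exact: L2_cmeas.
Qed.

Lemma bf_axr a f u v : md f -> md u -> md v -> bf f (ax a u v) = bf f u + a * bf f v.
Proof.
move=> df du dv; have dax := md_ax a du dv.
have [Lf wf _ mf] := df; have [Lu wu _ mu'] := du; have [Lv wv _ mv] := dv; have [_ wa _ ma] := dax.
have H j : cip (mg j f) (mg j (ax a u v)) = cip (mg j f) (mg j u) + a * cip (mg j f) (mg j v).
  rewrite -cip_axr//; apply: cip_aeq; last exact: mg_ax.
  - exact: L2_cmeas.
  - by apply: L2_cmeas; exact: L2_ax.
  - exact: L2_cmeas.
by rewrite /bf !H weighted_ax cip_axr//; ring.
Qed.

Lemma bf_ax a u v : md u -> md v ->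
  bf (ax a u v) (ax a u v) = bf u u + 2 * a * bf u v + a ^+ 2 * bf v v.
Proof.
move=> du dv; have dax := md_ax a du dv.
by rewrite bf_axr// ![bf (ax _ _ _) _]bfC !bf_axr// [bf v u]bfC; ring.
Qed.

Lemma bf_CS u v : md u -> md v -> bf u v ^+ 2 <= bf u u * bf v v.
Proof.
move=> du dv.
have H a : 0 <= bf u u + 2 * a * bf u v + a ^+ 2 * bf v v.
  by rewrite -bf_ax// bf_ge0.
move: (bf u u) (bf v v) (bf u v) H (bf_ge0 u) (bf_ge0 v) => F G c H F0 G0.
have [G0'|Gn0] := eqVneq G 0.
  rewrite G0' mulr0; have [->|c0] := eqVneq c 0; first by rewrite expr0n.
  have := H (- (F + 1) / (2 * c)); rewrite G0' mulr0 addr0.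
  rewrite [X in _ + X](_ : _ = - (F + 1)); [by lra|by field].
have {}G0 : 0 < G by rewrite lt_def Gn0.
have := H (- c / G); rewrite (_ : _ + _ = (F * G - c ^+ 2) / G).
  by rewrite pmulr_lge0 ?invr_gt0// subr_ge0.
by field; rewrite gt_eqF.
Qed.

Definition iug (g : R * R -> R[i] * R[i]) x := (iu (gj false g) x, iu (gj true g) x).

Lemma gj_iug g j : gj j (iug g) = iu (gj j g).
Proof. by apply/funext => x; case: j. Qed.

Lemma locintN (f : R * R -> R) : locint O f -> locint O (fun x => - f x).
Proof.
by move=> /(locintZ (-1)); congr locint; apply/funext => x; rewrite mulN1r.
Qed.

Lemma iwg_iu u g : is_weak_grad O u g -> is_weak_grad O (iu u) (iug g).
Proof.
move=> /iwgP[lu lg Hg]; apply/iwgP; split.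
- by move=> c; rewrite reim_iu; case: c => //; exact: locintN.
- by move=> j c; rewrite gj_iug reim_iu; case: c => //; exact: locintN.
- move=> j c psi tp; rewrite gj_iug !reim_iu; case: c; first exact: Hg.
  have i1 := locint_mul (lu true) (rtest_partial j tp).
  have i2 := locint_mul (lg j true) tp.
  under eq_Rintegral do rewrite mulNr -mulN1r.
  under [in RHS]eq_Rintegral do rewrite mulNr -mulN1r.
  by rewrite !RintegralZl// Hg//; ring.
Qed.

Lemma mg_iu u j : md u -> aeq (mg j (iu u)) (iu (mg j u)).
Proof.
move=> [_ _ /iwg_wg Hu _] c.
apply: aeS (ae_mg j c (iwg_iu Hu)) => y ->.
by rewrite gj_iug !reim_iu /rot !reim_mg !reim_iu /rot; case: c; ring.
Qed.

Lemma md_iu u : md u -> md (iu u).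
Proof.
move=> du; have [Lu wu Eu mu'] := du.
have Ea : exists g, is_weak_grad O (iu u) g.
  by have [g Hg] := Eu; exists (iug g); exact: iwg_iu.
have La := L2_iu Lu; split => //; first by rewrite weighted_iu; exact: L2_iu.
move=> j; apply: L2_aeq (aeq_sym (mg_iu j du)).
  exact: L2_iu.
by apply: mg_cmeas => //; exact: L2_cmeas.
Qed.

Lemma bf_iu u : md u -> bf (iu u) (iu u) = bf u u.
Proof.
move=> du; have di := md_iu du; have [_ wi _ mi] := di; have [_ wu _ mu'] := du.
have H j : cip (mg j (iu u)) (mg j (iu u)) = cip (mg j u) (mg j u).
  rewrite -[RHS]cip_iu; apply: cip_aeq2; last exact: mg_iu.
    exact: L2_cmeas.
  by apply: L2_cmeas; exact: L2_iu.
by rewrite /bf !H weighted_iu cip_iu.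
Qed.
End magnetic.

(** * Weak solutions *)

Section cvg2.
Context d (T : measurableType d) (R : realType) (mu : {measure set T -> \bar R}).

Definition cvg2 (f : nat -> T -> R) (g : T -> R) := forall e, 0 < e ->
  exists N, forall n, (N <= n)%N -> ip mu (fun x => f n x - g x) (fun x => f n x - g x) <= e.

Lemma ipBl (f g h : T -> R) : sqi mu f -> sqi mu g -> sqi mu h ->
  ip mu (fun x => f x - g x) h = ip mu f h - ip mu g h.
Proof.
move=> sf sg sh; rewrite ipC (_ : (fun x => _) = fun x => f x + (-1) * g x).
  by rewrite ipDr//; [rewrite ipZr// mulN1r [ip mu h f]ipC [ip mu h g]ipC|exact: sqiZ].
by apply/funext => x; rewrite mulN1r.
Qed.

Lemma cvg2_ip f g h : (forall n, sqi mu (f n)) -> sqi mu g -> cvg2 f g -> sqi mu h ->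
  ip mu (f n) h @[n --> \oo] --> ip mu g h.
Proof.
move=> sf sg fg sh; apply/cvgrPdist_le => e e0.
have H1 : 0 < ip mu h h + 1 by rewrite ltr_wpDl ?ip_ge0.
have [N HN] := fg _ (divr_gt0 (exprn_gt0 2 e0) H1).
exists N => // n /= Nn; rewrite distrC -ipBl//.
rewrite -(@ler_pXn2r _ 2) ?nnegrE ?(ltW e0)// real_normK ?num_real//.
apply: le_trans (ip_CS (sqiB (sf n) sg) sh) _.
apply: (@le_trans _ _ (e ^+ 2 / (ip mu h h + 1) * ip mu h h)).
  by rewrite ler_wpM2r ?ip_ge0// HN.
by rewrite mulrAC -mulrA ler_piMr ?sqr_ge0// ler_pdivrMr// mul1r lerDl.
Qed.
End cvg2.

Section weak_solution.
Context {R : realType}.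
Local Notation mu := (leb2 R).
Local Notation plane := (measurableTypeR R * measurableTypeR R)%type.
Local Notation E := (R * R -> R[i]).
Implicit Types (u v w phi : E) (psi : R * R -> R) (c j : bool).
Variables (O : set (R * R)) (A : R * R -> R * R).
Hypothesis HA : admissible O A.
Local Notation md := (md O A).
Local Notation mg := (mg O A).
Local Notation bf := (bf O A).

Definition grad phi y : R[i] * R[i] := (cpartial false phi y, cpartial true phi y).

Lemma reim_grad c j phi : reim c (gj j (grad phi)) = partial j (reim c phi).
Proof. by apply/funext => y; rewrite /reim /gj /grad /cpartial; case: j; case: c. Qed.

Lemma iwg_test O' phi : test_function O' phi -> is_weak_grad O' phi (grad phi).
Proof.
move=> /testP tphi; apply/iwgP; split.
- by move=> c; apply: sqi_locint; exact: rtest_sqi (tphi c).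
- by move=> j c; rewrite reim_grad; apply: sqi_locint; exact: rtest_sqi (rtest_partial j (tphi c)).
- move=> j c psi tp; rewrite reim_grad; apply/eqP; rewrite -subr_eq0 opprK; apply/eqP.
  have sc := rtest_smooth (tphi c); have sp := rtest_smooth tp.
  rewrite -RintegralD//; first last.
  - exact: locint_mul (sqi_locint (rtest_sqi (rtest_partial j (tphi c)))) tp.
  - exact: locint_mul (sqi_locint (rtest_sqi (tphi c))) (rtest_partial j tp).
  rewrite -(int_partial0 j (rtestMl sc tp)); apply: eq_Rintegral => x _.
  by rewrite partialM// [psi x * _]mulrC.
Qed.

Lemma mg_test phi j c : test_function O phi ->
  {ae mu, forall y, reim c (mg j phi) y = partial j (reim c phi) y + rot c (Acomp A j) phi y}.
Proof.
move=> tp; have := ae_mg HA j c (iwg_test tp).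
by apply: aeS => y ->; rewrite reim_grad.
Qed.

Lemma reim_weighted c v : reim c (weighted v) = fun y => eucl y * reim c v y.
Proof.
apply/funext => y; rewrite /weighted /reim; case: (v y) => p q.
by case: c; rewrite /= mul0r ?addr0 ?subr0.
Qed.

Lemma cont_eucl : continuous (@eucl R).
Proof.
move=> y; apply: (@continuous_comp _ _ _ (@sqn R) (@Num.sqrt R)).
  exact: smooth_cont (@smooth_sqn R) y.
exact: sqrt_continuous.
Qed.

Lemma meas_eucl : measurable_fun (setT : set plane) (@eucl R).
Proof. exact: cont_meas2 cont_eucl. Qed.

Lemma sqi_bmul_test (O' : set (R * R)) (a : R * R -> R) psi : measurable_fun (setT : set plane) a ->
  (forall K, compact K -> K `<=` O' -> exists M, forall y, K y -> `|a y| <= M) ->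
  rtest O' psi -> sqi mu (fun y => a y * psi y).
Proof.
move=> ma aM tp; have [K [cK KO _ K0]] := rtest_out tp; have [M HM] := aM K cK KO.
apply: (@sqi_dom _ _ _ mu (fun y => a y * psi y) psi `|M|); first by apply: measurable_funM => //; exact: rtest_meas tp.
  exact: rtest_sqi tp.
move=> y; rewrite normrM; have [Ky|/K0 ->] := pselect (K y); last by rewrite normr0 !mulr0.
by rewrite ler_wpM2r// (le_trans (HM y Ky))// ler_norm.
Qed.

Lemma eucl_locbdd (K : set (R * R)) : compact K -> exists M, forall y, K y -> `|eucl y| <= M.
Proof. by move=> cK; have [M _ HM] := cont_bounded cK cont_eucl; exists M. Qed.

Lemma A_locbdd j (K : set (R * R)) : compact K -> K `<=` O -> exists M, forall y, K y -> `|Acomp A j y| <= M.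
Proof.
move=> cK KO; have [_ _ /(_ K cK KO)[M HM]] := HA.
by exists M => y Ky; exact: HM.
Qed.

Lemma A_meas j : measurable_fun (setT : set plane) (Acomp A j).
Proof. by case: HA. Qed.

Lemma test_L2 phi : test_function O phi -> L2 phi.
Proof. by move=> /testP tp; apply/L2P => c; exact: rtest_sqi (tp c). Qed.

Lemma test_rot phi j c : test_function O phi -> sqi mu (rot c (Acomp A j) phi).
Proof.
move=> /testP tp; have H d := sqi_bmul_test (A_meas j) (@A_locbdd j) (tp d).
by rewrite /rot; case: c; [apply: sqiN|]; exact: H.
Qed.

Lemma test_md phi : test_function O phi -> md phi.
Proof.
move=> tp; have := (testP O phi).1 tp => tpc; split.
- exact: test_L2.
- apply/L2P => c; rewrite reim_weighted; apply: (@sqi_bmul_test O) (tpc c); first exact: meas_eucl.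
  by move=> K cK _; exact: eucl_locbdd.
- by exists (grad phi); exact: iwg_test.
- move=> j; apply/L2P => c.
  have s : sqi mu (fun y => partial j (reim c phi) y + rot c (Acomp A j) phi y).
    by apply: sqiD; [exact: rtest_sqi (rtest_partial j (tpc c))|exact: test_rot].
  apply: sqi_ae s _ _.
    apply: mg_cmeas => //; first exact: L2_cmeas (test_L2 tp).
    by exists (grad phi); exact: iwg_test.
  by apply: aeS (mg_test j c tp) => y ->.
Qed.

Lemma locint_bmul (a f : R * R -> R) : measurable_fun (setT : set plane) a ->
  (forall K, compact K -> K `<=` O -> exists M, forall y, K y -> `|a y| <= M) ->
  locint O f -> locint O (fun y => a y * f y).
Proof.
move=> ma aM lf K cK KO; have mK := compact_measurable2 cK.
suff : mu.-integrable K ((EFin \o a) \* (EFin \o f))%E by apply: eq_integrable.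
apply: integrableMr => //; last exact: lf.
  exact: measurable_funS ma.
have [M HM] := aM K cK KO; exists M; split; first exact: num_real.
by move=> x Mx y Ky /=; rewrite (le_trans (HM y Ky))// ltW.
Qed.

Lemma ip_ae2 (f g : R * R -> R) : measurable_fun (setT : set plane) f ->
  measurable_fun (setT : set plane) g ->
  {ae mu, forall x, f x = g x} -> ip mu f f = ip mu g g.
Proof. by move=> mf mg' fg; rewrite (ip_ae mf mg' mf fg) ipC (ip_ae mf mg' mg' fg). Qed.

(** The functions, their magnetic gradients and their products by the weight converge in L^2;
    the weak identities that relate them pass to the limit, since the potential is bounded on the
    support of each test function. *)
Lemma md_complete (v : nat -> E) : (forall n, md (v n)) ->
  (forall e, 0 < e -> exists N, forall n m, (N <= n)%N -> (N <= m)%N ->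
     bf (ax (-1) (v n) (v m)) (ax (-1) (v n) (v m)) <= e /\
     cip (ax (-1) (v n) (v m)) (ax (-1) (v n) (v m)) <= e) ->
  exists u, md u /\ forall e, 0 < e -> exists N, forall n, (N <= n)%N ->
     bf (ax (-1) (v n) u) (ax (-1) (v n) u) <= e /\
     cip (ax (-1) (v n) u) (ax (-1) (v n) u) <= e.
Proof.
move=> dv Cv; have [gO _ _] := HA.
(* every component of a family of functions controlled by the form converges *)
have lim (h : nat -> R * R -> R) (a : R) : 0 < a -> (forall n, sqi mu (h n)) ->
    (forall n m, ip mu (fun x => h n x - h m x) (fun x => h n x - h m x) <=
       a * (bf (ax (-1) (v n) (v m)) (ax (-1) (v n) (v m)) +
       cip (ax (-1) (v n) (v m)) (ax (-1) (v n) (v m)))) ->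
    exists g, sqi mu g /\ cvg2 mu h g.
  move=> a0 sh Hh; apply: sqi_complete => // e e0.
  have ea : 0 < e / a / 2 by rewrite !divr_gt0.
  have [N HN] := Cv _ ea; exists N => n m Nn Nm; have [h1 h2] := HN n m Nn Nm.
  apply: le_trans (Hh n m) _; rewrite mulrC -ler_pdivlMr//.
  by apply: le_trans (lerD h1 h2) _; rewrite -splitr.
have cipc f c : ip mu (reim c f) (reim c f) <= cip f f.
  by rewrite /cip; case: c; rewrite ?lerDl ?lerDr ip_ge0.
have bfm f j : cip (mg j f) (mg j f) <= bf f f.
  have w0 : 0 <= 16^-1 * cip (weighted f) (weighted f).
    by apply: mulr_ge0; [rewrite invr_ge0|exact: cip_ge0].
  rewrite /bf; case: j; apply: le_trans (_ : _ <= cip (mg false f) (mg false f) + cip (mg true f) (mg true f)) _.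
  - by rewrite lerDr cip_ge0.
  - by rewrite lerDl.
  - by rewrite lerDl cip_ge0.
  - by rewrite lerDl.
have bfw f : cip (weighted f) (weighted f) <= 16 * bf f f.
  have w0 : 0 <= cip (mg false f) (mg false f) + cip (mg true f) (mg true f).
    by apply: addr_ge0; exact: cip_ge0.
  by rewrite /bf mulrDr mulrA mulfV// mul1r lerDr mulr_ge0.
have ccB' f g c : reim c (ax (-1) f g) = fun x => reim c f x - reim c g x.
  by rewrite reim_ax; apply/funext => x; rewrite mulN1r.
pose DD n m := ax (-1) (v n) (v m).
have Dmd n m : md (DD n m) by exact: md_ax.
have sv n c : sqi mu (reim c (v n)) by have [/L2P + _ _ _] := dv n; exact.
have sw n c : sqi mu (reim c (weighted (v n))) by have [_ /L2P + _ _] := dv n; exact.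
have sm n j c : sqi mu (reim c (mg j (v n))) by have [_ _ _ /(_ j)/L2P] := dv n; exact.
have /choice[p Hp] : forall c, exists g, sqi mu g /\ cvg2 mu (fun n => reim c (v n)) g.
  move=> c; apply: (lim _ 1) => // n m; rewrite mul1r -ccB'.
  by apply: le_trans (cipc _ c) _; rewrite lerDr bf_ge0.
have /choice[w Hw] : forall c, exists g, sqi mu g /\ cvg2 mu (fun n => reim c (weighted (v n))) g.
  move=> c; apply: (lim _ 16) => // n m; rewrite -ccB' -weighted_ax.
  apply: le_trans (cipc _ c) _; apply: le_trans (bfw _) _.
  by rewrite ler_wpM2l// lerDl cip_ge0.
have /choice[q Hq] : forall jc : bool * bool, exists g, sqi mu g /\ cvg2 mu (fun n => reim jc.2 (mg jc.1 (v n))) g.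
  move=> [j c] /=; apply: (lim _ 1) => // n m; rewrite mul1r -ccB'.
  have -> : ip mu (reim c (ax (-1) (mg j (v n)) (mg j (v m)))) (reim c (ax (-1) (mg j (v n)) (mg j (v m))))
      = ip mu (reim c (mg j (DD n m))) (reim c (mg j (DD n m))).
    have L1 : L2 (mg j (DD n m)) by have [_ _ _] := Dmd n m.
    have L1' : L2 (ax (-1) (mg j (v n)) (mg j (v m))).
      by apply: L2_ax; [have [_ _ _] := dv n|have [_ _ _] := dv m].
    have m1 := L2_cmeas L1 c; have m2 := L2_cmeas L1' c.
    apply: Rint_ae; [exact: measurable_funM|exact: measurable_funM|].
    by apply: aeS (mg_ax HA (-1) j (dv n) (dv m) c) => y ->.
  by apply: le_trans (cipc _ c) _; apply: le_trans (bfm _ j) _; rewrite lerDl cip_ge0.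
pose u : E := fun y => (p false y +i* p true y)%C.
have ccu c : reim c u = p c by case: c.
(* the weak gradient of the limit is read off the limit of the magnetic gradients *)
pose g0 j : E := fun y => ((q (j, false) y - rot false (Acomp A j) u y) +i* (q (j, true) y - rot true (Acomp A j) u y))%C.
pose g y := (g0 false y, g0 true y).
have ccg c j : reim c (gj j g) = fun y => q (j, c) y - rot c (Acomp A j) u y by case: c; case: j.
have su c : sqi mu (reim c u) by rewrite ccu; case: (Hp c).
have Lu : L2 u by exact/L2P.
have lrot j c : locint O (rot c (Acomp A j) u).
  have H d := locint_bmul (A_meas j) (@A_locbdd j) (sqi_locint (su d) (O := O)).
  by rewrite /rot; case: c; [apply: locintN|]; exact: H.
have Hg : is_weak_grad O u g.
  apply/iwgP; split=> [c|j c|j c psi tp]; first exact: sqi_locint.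
    rewrite ccg; apply: locintD; first by apply: sqi_locint; case: (Hq (j, c)).
    exact: locintN.
  have sp := rtest_sqi tp; have spj := rtest_sqi (rtest_partial j tp).
  have sAp := sqi_bmul_test (A_meas j) (@A_locbdd j) tp.
  have L := cvg2_ip (fun n => sv n c) (Hp c).1 (Hp c).2 spj.
  have L1 := cvg2_ip (fun n => sm n j c) (Hq (j, c)).1 (Hq (j, c)).2 sp.
  have L2' := cvg2_ip (fun n => sv n (~~ c)) (Hp (~~ c)).1 (Hp (~~ c)).2 sAp.
  (* the magnetic term is moved to the test function, where the potential is bounded *)
pose sg : R := if c then -1 else 1.
  have rotE w' : (fun y => rot c (Acomp A j) w' y * psi y) = fun y => sg * (reim (~~ c) w' y * (Acomp A j y * psi y)).
    by apply/funext => y; rewrite /rot /sg; case: (c) => /=; ring.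
  have En n : ip mu (reim c (v n)) (partial j psi) =
      - (ip mu (reim c (mg j (v n))) psi - sg * ip mu (reim (~~ c) (v n)) (fun y => Acomp A j y * psi y)).
    have [_ _ /iwg_wg Hn _] := dv n; have [_ _ Hw'] := (iwgP _ _ _).1 Hn.
    rewrite {1}/ip Hw'//; congr (- _).
    rewrite -RintegralZl//; last exact: sqi_mul (sv n _) sAp.
    rewrite -RintegralB//; [|exact: sqi_mul (sm n j c) sp|exact: intgZ (sqi_mul (sv n _) sAp)].
    apply: eq_Rintegral => y _; rewrite reim_mg mulrDl.
    by have /(congr1 (fun f => f y)) /= -> := rotE (v n); rewrite addrK.
  rewrite ccu ccg.
  have : ip mu (reim c (v n)) (partial j psi) @[n --> \oo] -->
     - (ip mu (q (j, c)) psi - sg * ip mu (p (~~ c)) (fun y => Acomp A j y * psi y)).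
    under eq_fun do rewrite En; apply: cvgN; apply: cvgB; first exact: L1.
    by apply: cvgM; [exact: cvg_cst|exact: L2'].
  move=> /(cvg_unique (@Rhausdorff R) L); rewrite {1}/ip => ->; congr (- _).
  rewrite -RintegralZl//; last exact: sqi_mul (Hp _).1 sAp.
  rewrite -RintegralB//; [|exact: sqi_mul (Hq (j, c)).1 sp|exact: intgZ (sqi_mul (Hp _).1 sAp)].
  apply: eq_Rintegral => y _; rewrite mulrBl.
  by have /(congr1 (fun f => f y)) /= -> := rotE u; rewrite ccu.
have mgu j c : {ae mu, forall y, reim c (mg j u) y = q (j, c) y}.
  by apply: aeS (ae_mg HA j c Hg) => y ->; rewrite ccg subrK.
have Lm j : L2 (mg j u).
  apply/L2P => c; apply: sqi_ae (Hq (j, c)).1 _ _.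
    by apply: mg_cmeas => //; [exact: L2_cmeas|exists g].
  by apply: aeS (mgu j c) => y ->.
have wu c : {ae mu, forall y, reim c (weighted u) y = w c y}.
  have lw : locint O (fun y => eucl y * p c y - w c y).
    apply: locintD; last by apply: locintN; apply: sqi_locint; case: (Hw c).
    apply: locint_bmul; [exact: meas_eucl|by move=> K cK _; exact: eucl_locbdd|].
    by apply: sqi_locint; case: (Hp c).
  have H : {ae mu, forall y, eucl y * p c y - w c y = 0}.
    apply: (ae0_of_tests gO lw) => psi tp; have sp := rtest_sqi tp.
    have sEp : sqi mu (fun y => eucl y * psi y).
      by apply: (@sqi_bmul_test O) tp; [exact: meas_eucl|move=> K cK _; exact: eucl_locbdd].
    have L := cvg2_ip (fun n => sv n c) (Hp c).1 (Hp c).2 sEp.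
    have L1 := cvg2_ip (fun n => sw n c) (Hw c).1 (Hw c).2 sp.
    have En n : ip mu (reim c (v n)) (fun y => eucl y * psi y) = ip mu (reim c (weighted (v n))) psi.
      by apply: eq_Rintegral => y _; rewrite reim_weighted; ring.
    have : ip mu (p c) (fun y => eucl y * psi y) = ip mu (w c) psi.
      apply: (cvg_unique (@Rhausdorff R) L); apply: cvg_trans L1; apply: near_eq_cvg.
      by apply: nearW => n; exact: esym (En n).
    move=> Ew; have -> : \int[mu]_y ((eucl y * p c y - w c y) * psi y) =
        \int[mu]_y (p c y * (eucl y * psi y) - w c y * psi y).
      by apply: eq_Rintegral => y _; ring.
    rewrite RintegralB//; [|exact: sqi_mul (Hp c).1 sEp|exact: sqi_mul (Hw c).1 sp].
    by rewrite -/(ip mu (p c) _) -/(ip mu (w c) _) Ew subrr.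
  by apply: aeS H => y /subr0_eq <-; rewrite reim_weighted ccu.
have Lw : L2 (weighted u).
  apply/L2P => c; apply: sqi_ae (Hw c).1 _ _.
    rewrite reim_weighted; apply: measurable_funM; first exact: meas_eucl.
    exact: sqi_meas.
  by apply: aeS (wu c) => y ->.
have du : md u by split => //; exists g.
exists u; split => // e e0.
have e8 : 0 < e / 8 by rewrite divr_gt0.
have /choice[N1 HN1] : forall c, exists N, forall n, (N <= n)%N ->
    ip mu (fun x => reim c (v n) x - p c x) (fun x => reim c (v n) x - p c x) <= e / 8.
  by move=> c; exact: (Hp c).2 _ e8.
have /choice[N2 HN2] : forall c, exists N, forall n, (N <= n)%N ->
    ip mu (fun x => reim c (weighted (v n)) x - w c x) (fun x => reim c (weighted (v n)) x - w c x) <= e / 8.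
  by move=> c; exact: (Hw c).2 _ e8.
have /choice[N3 HN3] : forall jc : bool * bool, exists N, forall n, (N <= n)%N ->
    ip mu (fun x => reim jc.2 (mg jc.1 (v n)) x - q jc x) (fun x => reim jc.2 (mg jc.1 (v n)) x - q jc x) <= e / 8.
  by move=> c; exact: (Hq c).2 _ e8.
exists (N1 false + N1 true + (N2 false + N2 true) + (N3 (false, false) + N3 (false, true) + N3 (true, false) + N3 (true, true)))%N => n Nn.
have K1 c : ip mu (reim c (ax (-1) (v n) u)) (reim c (ax (-1) (v n) u)) <= e / 8.
  by rewrite ccB' ccu; apply: HN1; apply: leq_trans Nn; case: c; lia.
have K2 c : ip mu (reim c (weighted (ax (-1) (v n) u))) (reim c (weighted (ax (-1) (v n) u))) <= e / 8.
  have Ln : L2 (weighted (ax (-1) (v n) u)) by have [] := md_ax HA (-1) (dv n) du.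
  rewrite (@ip_ae2 _ (fun x => reim c (weighted (v n)) x - w c x)).
  - by apply: HN2; apply: leq_trans Nn; case: c; lia.
  - exact: L2_cmeas.
  - by apply: measurable_funB; apply: sqi_meas; [exact: sw|exact: (Hw c).1].
  - by apply: aeS (wu c) => y wy; rewrite weighted_ax ccB' wy.
have K3 j c : ip mu (reim c (mg j (ax (-1) (v n) u))) (reim c (mg j (ax (-1) (v n) u))) <= e / 8.
  have Ln : L2 (mg j (ax (-1) (v n) u)) by have [_ _ _] := md_ax HA (-1) (dv n) du.
  rewrite (@ip_ae2 _ (fun x => reim c (mg j (v n)) x - q (j, c) x)).
  - by apply: (HN3 (j, c)); apply: leq_trans Nn; case: c; case: j {Ln}; lia.
  - exact: L2_cmeas.
  - by apply: measurable_funB; apply: sqi_meas; [exact: sm|exact: (Hq (j, c)).1].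
  - by apply: aeS2 (mg_ax HA (-1) j (dv n) du c) (mgu j c) => y -> uy; rewrite ccB' uy.
move: (K1 false) (K1 true) (K2 false) (K2 true) (K3 false false) (K3 false true) (K3 true false) (K3 true true).
rewrite /bf /cip; clear -e0.
move: (ip mu _ _) (ip mu _ _) (ip mu _ _) (ip mu _ _) (ip mu _ _) (ip mu _ _) (ip mu _ _) (ip mu _ _) => x1 x2 x3 x4 x5 x6 x7 x8 *.
by split; lra.
Qed.

Lemma test_ax a u v : test_function O u -> test_function O v -> test_function O (ax a u v).
Proof.
move=> /testP tu /testP tv; apply/testP => c; rewrite reim_ax.
by apply: rtestD; [exact: tu|apply: rtestZ; exact: tv].
Qed.

(** The closure of the test functions for the form norm, inside [md]. *)
Definition approx u := md u /\ forall e, 0 < e -> exists2 phi, test_function O phi &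
  bf (ax (-1) u phi) (ax (-1) u phi) <= e /\ cip (ax (-1) u phi) (ax (-1) u phi) <= e.

Lemma bfBC u v : md u -> md v -> bf (ax (-1) u v) (ax (-1) u v) = bf (ax (-1) v u) (ax (-1) v u).
Proof. by move=> du dv; rewrite !bf_ax// [bf v u]bfC; ring. Qed.

Lemma cipBC u v : L2 u -> L2 v -> cip (ax (-1) u v) (ax (-1) u v) = cip (ax (-1) v u) (ax (-1) v u).
Proof. by move=> du dv; rewrite !cip_ax// [cip v u]cipC; ring. Qed.

Hypothesis coercive : forall phi, test_function O phi -> cip phi phi <= 2 * bf phi phi.

(** The constant 8 is not sharp: it leaves room for two applications of the
    inequality [|a + b|^2 <= 2 |a|^2 + 2 |b|^2]. *)
Lemma coercive_approx u : approx u -> cip u u <= 8 * bf u u.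
Proof.
move=> [du au]; have Lu : L2 u by case: du.
apply/ler_addgt0Pl => e e0; have [phi tp [h1 h2]] := au _ (divr_gt0 e0 (ltr0Sn _ 9)).
have dphi := test_md tp; have Lp := test_L2 tp; have h3 := coercive tp.
have h4 := cip_ge0 (ax (-2) u phi).
have h5 := bf_ge0 O A (ax (-(1/2)) u phi).
move: h1 h2 h3 h4 h5; rewrite !(bf_ax HA)// !cip_ax//; clear -e0.
by move: (bf u u) (bf u phi) (bf phi phi) (cip u u) (cip u phi) (cip phi phi) => *; lra.
Qed.

(** A minimising sequence of test functions is Cauchy for the form, hence for the norm by
    coercivity, and converges in [md]; the equation extends from test functions to their closure
    by continuity. *)
Lemma weak_solution F : L2 F -> exists u, approx u /\ forall w, approx w -> bf u w = cip F w.
Proof.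
move=> LF.
pose sc (a : R) (w : E) : E := fun y => a%:C%C * w y.
have sc1 w : sc 1 w = w by apply/funext => y; rewrite /sc mul1r.
have D0 : [set phi | test_function O phi] !=set0.
  by exists (fun=> 0); apply/testP => -[]; exact: rtest0.
have DZ (c : R) u w : test_function O u -> test_function O w -> test_function O (u + sc c w).
  exact: test_ax.
have DB u w : test_function O u -> test_function O w -> test_function O (u - w).
  by move=> tu tw; rewrite -[u - w]/(fun y => u y - w y) sbE; exact: test_ax.
have q0 u : test_function O u -> 0 <= bf u u by move=> _; exact: bf_ge0.
have qZ (c : R) u w : test_function O u -> test_function O w ->
    bf (u + sc c w) (u + sc c w) = bf u u + 2 * c * bf u w + c ^+ 2 * bf w w.
  by move=> tu tw; apply: (bf_ax HA c); exact: test_md.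
have lZ (c : R) u w : test_function O u -> test_function O w -> cip F (u + sc c w) = cip F u + c * cip F w.
  by move=> tu tw; apply: cip_axr => //; exact: test_L2.
have lC u : test_function O u -> cip F u ^+ 2 <= (2 * cip F F) * bf u u.
  move=> tu; apply: le_trans (cip_CS LF (test_L2 tu)) _.
  rewrite [2 * _]mulrC -mulrA; apply: ler_wpM2l; first exact: cip_ge0.
  exact: coercive.
have [v [tv Cv Lv]] := minimising_sequence sc1 D0 DB DZ q0 qZ lZ lC.
have vB n m N : (N <= n)%N -> (N <= m)%N -> bf (ax (-1) (v n) (v m)) (ax (-1) (v n) (v m)) <= 4 / N.+1%:R.
  by move=> Nn Nm; have := Cv m n N Nm Nn; rewrite -[v n - v m]/(fun y => v n y - v m y) sbE.
have [|u [du uP]] := md_complete (fun n => test_md (tv n)).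
  move=> e e0; have [N HN] := inv_nat_lt (divr_gt0 e0 (ltr0Sn _ 7)).
  exists N => n m Nn Nm; have h := vB n m N Nn Nm.
  have h' := coercive (test_ax (-1) (tv n) (tv m)).
  move: h h' HN; clear -e0; move: (bf _ _) (cip _ _) (N.+1%:R^-1) => x y z *; split; lra.
have au : approx u.
  split=> // e e0; have [N HN] := uP e e0; exists (v N); first exact: tv.
  have dN := test_md (tv N); have [Lu _ _ _] := du.
  by rewrite (bfBC du dN) (cipBC Lu (test_L2 (tv N))); exact: HN.
have Eu w : test_function O w -> bf u w = cip F w.
  move=> tw; have dw := test_md tw; apply/eqP; rewrite -subr_eq0; apply/eqP.
  have [M M0 HM] : exists2 M, 0 < M & forall n, (bf (v n) w - cip F w) ^+ 2 <= M * n.+1%:R^-1 /\ bf w w <= M.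
    exists (bf w w + 1); first by rewrite ltr_wpDl// bf_ge0.
    by move=> n; split; [exact: Lv|rewrite lerDl].
  apply: (@sqr_small0 _ _ 1) => e e0; rewrite mul1r.
  have [N HN] := inv_nat_lt (divr_gt0 (divr_gt0 e0 M0) (ltr0Sn _ 3)).
  have [N' HN'] := uP _ (divr_gt0 (divr_gt0 e0 M0) (ltr0Sn _ 3)).
  have [h1 _] := HN' (N + N')%N (leq_addl _ _).
  have [h2 h3] := HM (N + N')%N.
  have h4 : ((N + N')%N.+1%:R : R)^-1 <= N.+1%:R^-1 by rewrite lef_pV2 ?posrE ?ltr0Sn// ler_nat ltnS leq_addr.
  have h5 := bf_CS HA (md_ax HA (-1) (test_md (tv (N + N')%N)) du) dw.
  move: h5; rewrite [bf (ax _ _ _) w]bfC (bf_axr HA)//; last exact: test_md (tv _).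
  rewrite [bf w u]bfC [bf w (v _)]bfC => h5.
  have M1 : (bf (v (N + N')%N) w - cip F w) ^+ 2 <= e / 4.
    apply: le_trans h2 _; rewrite mulrC -ler_pdivlMr//; apply: le_trans h4 _.
    by rewrite [e / 4 / M]mulrAC ltW.
  have M2 : (bf (v (N + N')%N) w + -1 * bf u w) ^+ 2 <= e / 4.
    apply: le_trans h5 _; apply: le_trans (ler_pM (bf_ge0 _ _ _) (bf_ge0 _ _ _) h1 h3) _.
    by rewrite mulrAC divfK ?gt_eqF.
  have M3 := sqr_ge0 ((bf (v (N + N')%N) w - cip F w) + (bf (v (N + N')%N) w + -1 * bf u w)).
  move: M1 M2 M3; clear -e0.
  by move: (bf (v _) w) (bf u w) (cip F w) => x y z *; lra.
exists u; split => // w [dw aw]; apply/eqP; rewrite -subr_eq0; apply/eqP.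
have [du' _] := au; apply: (@sqr_small0 _ _ 1) => e e0; rewrite mul1r.
pose M := bf u u + cip F F + 1.
have M0 : 0 < M by rewrite /M ltr_wpDl// addr_ge0 ?bf_ge0 ?cip_ge0.
have [phi tp [h1 h2]] := aw _ (divr_gt0 (divr_gt0 e0 M0) (ltr0Sn _ 3)).
have dphi := test_md tp; have Lw : L2 w by case: dw.
have h3 := bf_CS HA du (md_ax HA (-1) dw dphi).
have h4 := cip_CS LF (L2_ax (-1) Lw (test_L2 tp)).
move: h3 h4; rewrite (bf_axr HA)// cip_axr//; last exact: test_L2.
rewrite (Eu _ tp) => h3 h4.
have h5 : bf u u * bf (ax (-1) w phi) (ax (-1) w phi) <= e / 4.
  apply: le_trans (_ : M * (e / M / 4) <= _); last by rewrite mulrA mulrCA mulfV ?gt_eqF ?mulr1.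
  by apply: ler_pM => //; [exact: bf_ge0|exact: bf_ge0|rewrite /M -addrA lerDl addr_ge0 ?cip_ge0].
have h6 : cip F F * cip (ax (-1) w phi) (ax (-1) w phi) <= e / 4.
  apply: le_trans (_ : M * (e / M / 4) <= _); last by rewrite mulrA mulrCA mulfV ?gt_eqF ?mulr1.
  by apply: ler_pM => //; [exact: cip_ge0|exact: cip_ge0|rewrite /M [bf u u + _]addrC -addrA lerDl addr_ge0 ?bf_ge0].
have h7 := sqr_ge0 ((bf u w + -1 * cip F phi) + (cip F w + -1 * cip F phi)).
move: (le_trans h3 h5) (le_trans h4 h6) h7; clear -e0.
by move: (bf u w) (cip F phi) (cip F w) => x y z *; lra.
Qed.
End weak_solution.

(** * The magnetic potentials *)

Section segment_integrals.
Context {R : realType}.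
Local Notation leb := (@lebesgue_measure R).
Implicit Types g : R -> R.

Lemma itv_intg g r : continuous g -> leb.-integrable `[0, r] (EFin \o g).
Proof.
move=> cg; apply: continuous_compact_integrable; first exact: segment_compact.
exact: continuous_subspaceT.
Qed.

Lemma leb_itv (r : R) : 0 <= r -> fine (leb `[0, r]) = r.
Proof.
move=> r0; rewrite lebesgue_measure_itv/= lte_fin; case: ltP => [_|r0'].
  by rewrite oppr0 adde0.
by apply: le_anti; rewrite r0' r0.
Qed.

Lemma itv_bound g r C : continuous g -> 0 <= r -> (forall t, 0 <= t <= r -> `|g t| <= C) ->
  `|\int[leb]_(t in `[0, r]) g t| <= C * r.
Proof.
move=> cg r0 gC; apply: le_trans (le_normr_Rintegral _ (itv_intg _ cg)) _ => //.
have -> : C * r = \int[leb]_(t in `[0, r]) (fun=> C) t.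
  by rewrite Rintegral_cst// leb_itv.
apply: le_Rintegral => //; last exact: itv_intg (@cst_continuous _ _ _).
exact: integrable_norm (itv_intg r cg).
Qed.

Lemma itv_scale g r : continuous g -> 0 < r ->
  \int[leb]_(t in `[0, r]) g t = \int[leb]_(t in `[0, 1]) (r * g (r * t)).
Proof.
move=> cg r0; pose G : R -> R := fun t => r * t.
have dG (x : R) : is_derive x (1 : R) G r.
  apply: (is_derive_conv (@is_deriveZ _ _ _ id r x 1 1 (is_derive_id _ _))) => //.
  by rewrite /GRing.scale /= mulr1.
have G' : derive1 G = cst r by apply/funext => x; rewrite derive1E; have [_ ->] := dG x.
have cG : continuous G.
  by move=> x; apply/differentiable_continuous/derivable1_diffP; have [] := dG x.
rewrite /Rintegral; congr fine.
have -> : `[0, r]%classic = `[G 0, G 1]%classic by rewrite /G mulr0 mulr1.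
rewrite integration_by_substitution_increasing//.
- by apply: eq_integral => x _; rewrite G' /= mulrC.
- by move=> x y _ _ xy; rewrite /G ltr_pM2l.
- by rewrite G' => x _; exact: cst_continuous.
- by rewrite G'; exact: is_cvg_cst.
- by rewrite G'; exact: is_cvg_cst.
- split; [by move=> x _; have [] := dG x|exact: cvg_at_right_filter (cG 0)|exact: cvg_at_left_filter (cG 1)].
- exact: continuous_subspaceT.
Qed.

Lemma itv_trunc g r s : r <= s -> (forall t, r < t -> g t = 0) ->
  \int[leb]_(t in `[0, s]) g t = \int[leb]_(t in `[0, r]) g t.
Proof.
move=> rs g0; rewrite Rintegral_mkcond [RHS]Rintegral_mkcond; apply: eq_Rintegral => t _.
rewrite !patchE !mem_setE !in_itv/=; case: (boolP (0 <= t)) => t0 /=; last by [].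
have [tr|tr] := leP t r; first by rewrite (le_trans tr rs).
by rewrite g0// if_same.
Qed.
End segment_integrals.

Section potentials.
Context {R : realType} (B : R * R -> R).
Hypotheses (cB : continuous B) (sB : compact_support B).
Local Notation leb := (@lebesgue_measure R).
Local Notation mu := (leb2 R).
Local Notation plane := (measurableTypeR R * measurableTypeR R)%type.

Lemma eucl_sqr (y : R * R) : eucl y ^+ 2 = sqn y.
Proof. by rewrite sqr_sqrtr// sqn_ge0. Qed.

Lemma eucl_ge0 (y : R * R) : 0 <= eucl y. Proof. exact: sqrtr_ge0. Qed.

Lemma pr_le_eucl k (y : R * R) : `|pr k y| <= eucl y.
Proof.
rewrite -(@ler_pXn2r _ 2) ?nnegrE ?eucl_ge0// eucl_sqr real_normK ?num_real//.
by rewrite /pr /sqn; case: k; rewrite ?lerDl ?lerDr sqr_ge0.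
Qed.

Lemma eucl0 (y : R * R) : eucl y = 0 -> y = (0, 0).
Proof.
move=> y0; have := pr_le_eucl true y; have := pr_le_eucl false y.
by rewrite y0 !normr_le0 /pr; case: y {y0} => a b /= /eqP -> /eqP ->.
Qed.

Lemma eucl_scale r (y : R * R) : 0 <= r -> eucl (r * y.1, r * y.2) = r * eucl y.
Proof.
move=> r0; rewrite /eucl /= !exprMn -mulrDr sqrtrM ?sqr_ge0//.
by rewrite sqrtr_sqr ger0_norm.
Qed.

(** Compact support is turned into a radius [R0] beyond which the field vanishes. *)
Lemma field_bounds : exists M R0, [/\ 0 < M, 0 < R0, forall y, `|B y| <= M &
  forall y, R0 < eucl y -> B y = 0].
Proof.
have [M0 M00 KM] := box_compact sB; have [M Mp HM] := cont_bounded sB cB.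
have out y : ~ closure [set x | B x != 0] y -> B y = 0.
  by move=> ny; apply/eqP; apply: contrapT => /negP By; apply: ny; exact: subset_closure.
exists M, (2 * M0); split => // [|y|y yM]; first by rewrite mulr_gt0.
  have [/HM//|/out ->] := pselect (closure [set x | B x != 0] y).
  by rewrite normr0 ltW.
apply: out => /KM[h1 h2]; move: yM; apply/negP; rewrite -leNgt.
rewrite -(@ler_pXn2r _ 2) ?nnegrE ?eucl_ge0//; last by rewrite mulr_ge0// ltW.
rewrite eucl_sqr /sqn -(real_normK (num_real y.1)) -(real_normK (num_real y.2)).
by move: (normr_ge0 y.1) (normr_ge0 y.2) h1 h2; nra.
Qed.

Definition cvp (x : R * R) : R := \int[leb]_(t in `[0, 1]) (B (t * x.1, t * x.2) * t).

Lemma ray_cont (x : R * R) : continuous (fun t : R => B (t * x.1, t * x.2) * t).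
Proof.
move=> t; apply: cvgM; last exact: cvg_id.
apply: (@continuous_comp _ _ _ (fun t : R => (t * x.1, t * x.2)) B); last exact: cB.
have h (p : R) : (fun u : R => u * p) @ t --> t * p by apply: cvgM; [exact: cvg_id|exact: cvg_cst].
exact: cvg_pair (h x.1) (h x.2).
Qed.

Lemma vpot_sE s (y : R * R) (x := (expR (s / 2) * y.1, expR (s / 2) * y.2)) j :
  Acomp (vpot_s B s) j y = expR (s / 2) * ((if j then pr false x else - pr true x) * cvp x).
Proof. by case: j. Qed.

(** In the integrand [t * B (t x)], the factor [t |x|] is at most [R0] wherever the field is not
    zero.  This bounds the transversal potential on the whole plane. *)
Lemma cvp_bound M R0 : 0 < R0 -> (forall y, `|B y| <= M) ->
  (forall y, R0 < eucl y -> B y = 0) -> forall x, eucl x * `|cvp x| <= M * R0.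
Proof.
move=> R00 BM B0 x.
rewrite -[eucl x]ger0_norm ?eucl_ge0// -normrM /cvp -RintegralZl//; last first.
  exact: itv_intg (@ray_cont x).
rewrite -[M * R0]mulr1; apply: itv_bound => // [t|t /andP[t0 t1]].
  by apply: cvgM; [exact: cvg_cst|exact: ray_cont].
rewrite mulrCA normrM (ger0_norm (mulr_ge0 _ _)) ?eucl_ge0//.
have M0 := le_trans (normr_ge0 _) (BM (0, 0)).
have [ge|/B0 ->] := leP (eucl (t * x.1, t * x.2)) R0; last by rewrite normr0 mul0r mulr_ge0// ltW.
apply: ler_pM => //; first by rewrite mulr_ge0// eucl_ge0.
by rewrite mulrC -eucl_scale.
Qed.

(** Tonelli, applied to the field plus its bound, which is nonnegative. *)
Lemma cvp_meas : measurable_fun (setT : set plane) cvp.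
Proof.
have [M [R0 [Mp R00 BM B0]]] := field_bounds.
pose h (z : plane * measurableTypeR R) : R := (B (z.2 * z.1.1, z.2 * z.1.2) * z.2 + M) * \1_(`[0, 1]%classic : set R) z.2.
have mh : measurable_fun setT h.
  apply: measurable_funM; last first.
    by apply: measurableT_comp measurable_snd; exact: measurable_indic.
  apply: measurable_funD => //; apply: measurable_funM; last exact: measurable_snd.
  apply: (@measurableT_comp _ _ _ _ _ _ (B : plane -> R)); first exact: cont_meas2.
  apply/measurable_fun_pairP; split => /=; apply: measurable_funM; try exact: measurable_snd.
    by apply: measurableT_comp measurable_fst; exact: measurable_fst.
  by apply: measurableT_comp measurable_fst; exact: measurable_snd.
have h0 z : 0 <= h z.
  rewrite /h indicE mem_setE in_itv/=; case: (boolP (0 <= z.2 <= 1)) => [/andP[t0 t1]|]; last by rewrite mulr0.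
  rewrite mulr1 -lerBlDr sub0r; apply: le_trans (_ : - `|B (z.2 * z.1.1, z.2 * z.1.2) * z.2| <= _); last by rewrite lerNl -normrN ler_norm.
  by rewrite lerN2 normrM (ger0_norm t0) -[M]mulr1 ler_pM.
have mE : measurable_fun setT (EFin \o h) by exact/measurable_EFinP.
have mF := @measurable_fun_fubini_tonelli_F _ _ plane (measurableTypeR R) R leb (EFin \o h)
   mE (fun z => h0 z).
have -> : cvp = fun x => fine (\int[leb]_t (EFin \o h) (x, t))%E - M.
  apply/funext => x; apply/eqP; rewrite eq_sym subr_eq; apply/eqP.
  rewrite -[M in RHS]mulr1 -[X in _ + M * X](leb_itv (@ler01 R)).
  rewrite -Rintegral_cst// -RintegralD//; [|exact: itv_intg (@ray_cont x)|exact: itv_intg (@cst_continuous _ _ _)].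
  rewrite [RHS]Rintegral_mkcond; apply: eq_Rintegral => t _.
  by rewrite patchE /h /= indicE; case: (t \in _); rewrite ?mulr1 ?mulr0.
apply: measurable_funB => //; exact: measurableT_comp mF.
Qed.

Lemma vpot_s_bound s : exists C, forall j y, `|Acomp (vpot_s B s) j y| <= C.
Proof.
have [M [R0 [Mp R00 BM B0]]] := field_bounds.
exists (expR (s / 2) * (M * R0)) => j y; rewrite vpot_sE normrM (ger0_norm (expR_ge0 _)).
rewrite ler_wpM2l ?expR_ge0//; set x := (_, _).
apply: le_trans (cvp_bound R00 BM B0 x); rewrite normrM ler_wpM2r//.
by case: j; rewrite ?normrN pr_le_eucl.
Qed.

Lemma vpot_s_admissible s : admissible setT (vpot_s B s).
Proof.
split; first exact: test_exhausted_setT.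
- move=> j; rewrite (_ : Acomp _ _ = fun y => expR (s / 2) *
   ((if j then pr false (expR (s / 2) * y.1, expR (s / 2) * y.2) else - pr true (expR (s / 2) * y.1, expR (s / 2) * y.2))
     * cvp (expR (s / 2) * y.1, expR (s / 2) * y.2))); last first.
    by apply/funext => y; exact: vpot_sE.
  apply: measurable_funM => //.
  have m1 : measurable_fun (setT : set plane) (fun y : plane => expR (s / 2) * y.1).
    by apply: measurable_funM => //; exact: measurable_fst.
  have m2 : measurable_fun (setT : set plane) (fun y : plane => expR (s / 2) * y.2).
    by apply: measurable_funM => //; exact: measurable_snd.
  apply: measurable_funM; first by case: j => //; exact: measurableT_comp m2.
  apply: (@measurableT_comp _ _ _ _ _ _ (cvp : plane -> R)); first exact: cvp_meas.
  exact/measurable_fun_pairP.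
- by move=> K _ _; have [C HC] := vpot_s_bound s; exists C => j y _; exact: HC.
Qed.

(** The angle of a point of the upper half-plane is an arc cosine; the other
    half-plane is reached by reflection. *)
Lemma polar_angleP (y : R * R) : y != (0, 0) ->
  y = (eucl y * cos (polar_angle y), eucl y * sin (polar_angle y)).
Proof.
move=> y0; rewrite /polar_angle; case: xgetP => [t _ [_ <-]//|H]; exfalso.
have e0 : 0 < eucl y.
  by rewrite lt_def eucl_ge0 andbT; apply: contraNneq y0 => /eucl0 ->.
pose x := y.1 / eucl y.
have x1 : -1 <= x <= 1.
  by rewrite -ler_norml /x normrM normfV (ger0_norm (ltW e0)) ler_pdivrMr// mul1r (pr_le_eucl false).
have sx : eucl y * Num.sqrt (1 - x ^+ 2) = `|y.2|.
  rewrite -[eucl y]ger0_norm ?eucl_ge0// -sqrtr_sqr -sqrtrM ?sqr_ge0//.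
  rewrite -[RHS]sqrtr_sqr; congr Num.sqrt; rewrite /x eucl_sqr.
  by rewrite exprMn exprVn eucl_sqr /sqn; field; rewrite -[_ + _]/(sqn y) -eucl_sqr sqrf_eq0 gt_eqF.
have a0 := acos_ge0 x1; have api := acos_lepi x1; have p0 := @pi_gt0 R.
have ca : cos (acos x) = x by apply: acosK; rewrite in_itv.
have [y2|y2] := leP 0 y.2.
  apply: (H (acos x)); split; first by rewrite a0/=; lra.
  rewrite ca sin_acos// sx ger0_norm// /x mulrCA mulfV ?gt_eqF// mulr1.
  by case: (y).
apply: (H (2 * pi - acos x)); split.
  have xn1 : x < 1.
    rewrite lt_neqAle; case/andP: x1 => _ ->; rewrite andbT; apply/eqP => xE.
    by move: sx; rewrite xE expr1n subrr sqrtr0 mulr0 => /esym/eqP; rewrite normr_eq0 lt_eqF.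
  have : 0 < acos x by apply: acos_gt0; rewrite xn1 andbT; case/andP: x1.
  by move=> h; apply/andP; split; lra.
rewrite mulr_natl addrC cosD2pi sinD2pi cosN sinN ca sin_acos// mulrN sx ltr0_norm// opprK.
by rewrite /x mulrCA mulfV ?gt_eqF// mulr1; case: (y).
Qed.

(** The radial integral is constant beyond [R0], so that the limit is attained. *)
Lemma alphaE M R0 : 0 < R0 -> (forall y, `|B y| <= M) ->
  (forall y, R0 < eucl y -> B y = 0) -> forall t,
  [/\ forall r, R0 <= r -> alpha_oo B t = alpha B r t & `|alpha_oo B t| <= M * R0 * R0].
Proof.
move=> R00 BM B0 t; pose x : R * R := (cos t, sin t).
have ex : eucl x = 1 by rewrite /eucl cos2Dsin2 sqrtr1.
have aE r : R0 <= r -> alpha B r t = alpha B R0 t.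
  move=> R0r; apply: itv_trunc => // u ru.
  have u0 : 0 <= u by rewrite (le_trans (ltW R00))// ltW.
  by rewrite B0 ?mul0r// (@eucl_scale u x)// ex mulr1.
have limE : alpha_oo B t = alpha B R0 t.
  rewrite /alpha_oo; apply: cvg_lim; first exact: Rhausdorff.
  apply: cvg_near_cst; near=> r; apply: aE; near: r; apply: nbhs_pinfty_ge; exact: num_real.
split=> [r /aE ->//|]; rewrite limE; apply: itv_bound; first exact: (@ray_cont x).
  exact: ltW.
move=> u /andP[u0 u1]; rewrite normrM (ger0_norm u0).
by apply: ler_pM => //; exact: BM.
Unshelve. all: by end_near. Qed.

(** The change of variable [t |-> r t], which identifies the potential in the transversal gauge
    with the radial flux integral [alpha]. *)
Lemma alpha_cvp r t : 0 < r -> alpha B r t = r ^+ 2 * cvp (r * cos t, r * sin t).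
Proof.
move=> r0; rewrite /alpha (itv_scale (@ray_cont (cos t, sin t)) r0) /cvp -RintegralZl//; last first.
  exact: itv_intg (@ray_cont (r * cos t, r * sin t)).
apply: eq_Rintegral => u _ /=; rewrite [r * u]mulrC -![u * r * _]mulrA.
by move: (B _) => b; ring.
Qed.

Lemma vpot_oo0 : vpot_oo B (0, 0) = (0, 0).
Proof. by rewrite /vpot_oo /eucl /= expr0n addr0 sqrtr0 invr0 !mulr0. Qed.

Lemma vpot_s0 s : vpot_s B s (0, 0) = (0, 0).
Proof. by rewrite /vpot_s /vpot /= !mulr0 oppr0 !mul0r !mulr0. Qed.

(** Outside of the disc of radius [R0 exp (- s / 2)] the rescaled potential only sees the total
    radial integrals of the field. *)
Lemma vpot_ooE M R0 : 0 < R0 -> (forall y, `|B y| <= M) ->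
  (forall y, R0 < eucl y -> B y = 0) ->
  forall s y, R0 <= expR (s / 2) * eucl y -> vpot_oo B y = vpot_s B s y.
Proof.
move=> R00 BM B0 s y ys.
have y0 : y != (0, 0).
  apply/eqP => y0; move: ys; rewrite y0 /eucl /= expr0n addr0 sqrtr0 mulr0.
  by rewrite leNgt R00.
have e0 : 0 < eucl y.
  by rewrite lt_def eucl_ge0 andbT; apply: contraNneq y0 => /eucl0 ->.
have l0 := expR_gt0 (s / 2).
have [aE _] := alphaE R00 BM B0 (polar_angle y).
have yE := polar_angleP y0.
rewrite /vpot_oo (aE _ ys) alpha_cvp ?mulr_gt0// -!mulrA.
have -> : (expR (s / 2) * (eucl y * cos (polar_angle y)), expR (s / 2) * (eucl y * sin (polar_angle y)))
   = (expR (s / 2) * y.1, expR (s / 2) * y.2).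
  by rewrite [X in (_ * X.1, _)]yE [X in (_, _ * X.2)]yE.
rewrite /vpot_s /vpot -/(cvp (expR (s / 2) * y.1, expR (s / 2) * y.2)).
move: (cvp _) => c /=; rewrite [y.1 in RHS](congr1 fst yE) [y.2 in RHS](congr1 snd yE) /=.
move: (expR (s / 2)) (cos _) (sin _) => l p q.
by congr pair; field; rewrite gt_eqF.
Qed.

Lemma expR_large (e R0 : R) : 0 < e -> \forall s \near +oo, R0 <= expR (s / 2) * e.
Proof.
move=> e0; near=> s; rewrite -ler_pdivrMr//; apply: le_trans (expR_ge1Dx _).
by rewrite -lerBlDl ler_pdivlMr//; near: s; apply: nbhs_pinfty_ge; exact: num_real.
Unshelve. all: by end_near. Qed.

Lemma compact_away (K : set (R * R)) : compact K -> K `<=` @punctured R ->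
  exists2 e : R, 0 < e & forall y, K y -> e <= eucl y.
Proof.
move=> cK K0; have cl : closed K by apply: compact_closed => //; exact: norm_hausdorff.
have nK : (~` K) (0, 0) by move=> /K0; rewrite /punctured/= eqxx.
have /nbhs_ballP[e /= e0 be] : nbhs ((0, 0) : R * R) (~` K).
  by apply: open_nbhs_nbhs; split => //; rewrite openC.
exists e => // y Ky; rewrite leNgt; apply/negP => ye; apply: (be y) => //.
by split; rewrite /ball /= sub0r normrN; apply: le_lt_trans ye; [exact: (pr_le_eucl false)|exact: (pr_le_eucl true)].
Qed.

(** Measurability comes for free from [vpot_ooE]: the Aharonov-Bohm potential is the
    pointwise limit of the potentials [A_n], all of them vanishing at the origin. *)
Lemma vpot_oo_admissible : admissible (@punctured R) (vpot_oo B).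
Proof.
have [M [R0 [Mp R00 BM B0]]] := field_bounds.
split; first exact: test_exhausted_punctured.
- move=> j; apply: (@measurable_fun_cvg _ _ _ _ (fun n => Acomp (vpot_s B n%:R) j)).
    by move=> n; have [_ + _] := vpot_s_admissible n%:R; exact.
  move=> y _; have [->|y0] := eqVneq y (0, 0).
    apply: cvg_near_cst; apply: nearW => n.
    by rewrite /Acomp vpot_s0 vpot_oo0.
  have e0 : 0 < eucl y.
    by rewrite lt_def eucl_ge0 andbT; apply: contraNneq y0 => /eucl0 ->.
  apply: cvg_near_cst; have H1 : \forall n \near \oo, R0 <= expR (n%:R / 2) * eucl y.
    exact: (@cvgr_idn R) (expR_large R0 e0).
  apply: filterS H1 => n.
  by rewrite /Acomp => /(vpot_ooE R00 BM B0) ->.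
- move=> K cK K0.
  have [e e0 eK] := compact_away cK K0.
  exists (M * R0 * R0 / e) => j y Ky; have ey := eK y Ky.
  have h1 : `|alpha_oo B (polar_angle y) / eucl y| <= M * R0 * R0 / e.
    have [_ h] := alphaE R00 BM B0 (polar_angle y).
    rewrite normrM normfV (ger0_norm (eucl_ge0 _)); apply: ler_pM => //.
      by rewrite invr_ge0 eucl_ge0.
    by rewrite lef_pV2 ?posrE// (lt_le_trans e0).
  apply: le_trans h1; rewrite /Acomp /vpot_oo; case: j => /=;
    rewrite normrM ler_piMl// ?normrN ler_norml ?cos_geN1 ?cos_le1 ?sin_geN1 ?sin_le1//.
Qed.
End potentials.

(** * Hardy inequality for magnetic gradients *)

Section hardy.
Context {R : realType}.
Local Notation mu := (leb2 R).
Local Notation plane := (measurableTypeR R * measurableTypeR R)%type.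
Local Notation E := (R * R -> R[i]).
Implicit Types (u v w phi : E) (psi f h : R * R -> R) (c j : bool).

Definition sqmod phi (y : R * R) : R := reim false phi y * reim false phi y + reim true phi y * reim true phi y.

Lemma sqmod_ge0 phi y : 0 <= sqmod phi y. Proof. by rewrite /sqmod -!expr2 addr_ge0 ?sqr_ge0. Qed.

Lemma smooth_ln h : smooth h -> (forall y, 0 < h y) -> smooth (fun y => ln (h y)).
Proof. by move=> /smoothP sh h0; apply/smoothP; exact: Sm_ln. Qed.

Lemma smooth_inv h : smooth h -> (forall y, h y != 0) -> smooth (fun y => (h y)^-1).
Proof. by move=> /smoothP sh h0; apply/smoothP; exact: Sm_inv. Qed.

Lemma partial_ln h j y : smooth h -> 0 < h y -> partial j (fun y => ln (h y)) y = partial j h y / h y.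
Proof.
move=> sh h0; apply: partialE; rewrite mulrC.
by apply: is_derive_comp1; [exact: smooth_is_derive|exact: is_derive1_ln].
Qed.

Lemma partial_inv h j y : smooth h -> (forall y, h y != 0) ->
  partial j (fun y => (h y)^-1) y = - partial j h y / h y ^+ 2.
Proof.
move=> sh h0; have si := smooth_inv sh h0.
have := partialM j y sh si.
have -> : (fun x => h x * (h x)^-1) = fun=> 1 by apply/funext => x; rewrite mulfV.
rewrite partial_cst => /esym/eqP; rewrite addr_eq0 => /eqP H.
apply: (mulfI (h0 y)); rewrite H; field; exact: h0.
Qed.

Local Opaque smooth partial reim rtest.

Section test.
Variables (O : set (R * R)) (A : R * R -> R * R).
Hypothesis HA : admissible O A.
Local Notation mg := (mg O A).
Local Notation bf := (bf O A).

Definition kinetic u := cip (mg false u) (mg false u) + cip (mg true u) (mg true u).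

Lemma bf_kinetic u : bf u u = kinetic u + 16^-1 * cip (weighted u) (weighted u). Proof. by []. Qed.

Definition kinetic_density u y : R := sqmod (mg false u) y + sqmod (mg true u) y.

Lemma cip_sqmod u : L2 u -> intg mu (sqmod u) /\ \int[mu]_y sqmod u y = cip u u.
Proof.
move=> /L2P su; have h c := sqi_mul (su c) (su c).
split; first exact: (intgD (h false) (h true)).
by rewrite /cip -RintegralD//; [exact: h|exact: h].
Qed.

Lemma kinetic_densityE u : (forall j, L2 (mg j u)) -> intg mu (kinetic_density u) /\ \int[mu]_y kinetic_density u y = kinetic u.
Proof.
move=> Lu; have h j := cip_sqmod (Lu j); split; first exact: intgD (h _).1 (h _).1.
by rewrite RintegralD//; [rewrite !(h _).2|exact: (h _).1|exact: (h _).1].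
Qed.

Lemma intg_smooth_sqmod f phi : smooth f -> test_function O phi ->
  intg mu (fun y => f y * sqmod phi y).
Proof.
move=> sf /testP tp; apply: (@rtest_intg _ O); apply: (rtestMl sf).
exact: (rtestD (rtestMl (rtest_smooth (tp false)) (tp false)) (rtestMl (rtest_smooth (tp true)) (tp true))).
Qed.

(** Expand the square of [D phi + f y phi], where [D] is the magnetic gradient and [y] the position.
    The cross term is [f] times the radial derivative of [|phi|^2], with no contribution of the
    potential, because [Re (conj phi * (- i A phi)) = 0]; integrating it by parts yields the
    divergence of [f y]. *)
Lemma hardy f phi : smooth f -> test_function O phi ->
  \int[mu]_y ((2 * f y + (y.1 * partial false f y + y.2 * partial true f y) - f y ^+ 2 * sqn y) * sqmod phi y)
   <= kinetic phi.
Proof.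
move=> sf tp; have [_ _ _ Lm] := test_md HA tp.
have /testP tc := tp; have sc c := rtest_smooth (tc c).
pose N := sqmod phi; pose W y := 2 * f y + (y.1 * partial false f y + y.2 * partial true f y) - f y ^+ 2 * sqn y.
have tN : rtest O N := rtestD (rtestMl (sc false) (tc false)) (rtestMl (sc true) (tc true)).
pose h j y := (f y * pr j y) * N y.
have sfj j : smooth (fun y => f y * pr j y) by exact: smoothM sf (smooth_pr j).
have th j : rtest O (h j) := rtestMl (sfj j) tN.
have sN := rtest_smooth tN.
have pN j y : partial j N y = 2 * (reim false phi y * partial j (reim false phi) y + reim true phi y * partial j (reim true phi) y).
  have s2 c := smoothM (sc c) (sc c).
  by rewrite /N /sqmod (partialD _ _ (s2 false) (s2 true)) !(partialM _ _ (sc _) (sc _)); ring.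
have ph j y : partial j (h j) y = (f y + pr j y * partial j f y) * N y + f y * pr j y * partial j N y.
  rewrite /h (partialM _ _ (sfj j) sN) (partialM _ _ sf (smooth_pr j)).
  by rewrite (partialE (is_derive_pr j j y)) eqxx mulr1n; ring.
have sW : smooth W.
  apply: smoothB; last exact: smoothM (smoothM sf sf) (@smooth_sqn R).
  apply: smoothD; first exact: smoothM (smooth_cst _) sf.
  exact: smoothD (smoothM (smooth_pr false) (smooth_partial false sf)) (smoothM (smooth_pr true) (smooth_partial true sf)).
have iW : intg mu (fun y => W y * N y) by exact: intg_smooth_sqmod.
have ih j : intg mu (partial j (h j)) by apply: (@rtest_intg _ O); exact: rtest_partial.
have [im Em] := kinetic_densityE Lm.
pose Q y := \sum_j ((reim false (mg j phi) y + f y * pr j y * reim false phi y) ^+ 2 +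
  (reim true (mg j phi) y + f y * pr j y * reim true phi y) ^+ 2).
have Qae : {ae mu, forall y, partial false (h false) y + partial true (h true) y + kinetic_density phi y - W y * N y = Q y}.
  have a j : {ae mu, forall y, forall c, reim c (mg j phi) y = partial j (reim c phi) y + rot c (Acomp A j) phi y}.
    by apply: aeS2 (mg_test HA j false tp) (mg_test HA j true tp) => y h1 h2 [].
  apply: aeS2 (a false) (a true) => y e0 e1.
  rewrite /Q big_bool /kinetic_density /sqmod /= !e0 !e1 !ph !pN /W /N /sqmod /rot /sqn /pr /=.
  ring.
have iL : intg mu (fun y => partial false (h false) y + partial true (h true) y + kinetic_density phi y - W y * N y).
  by apply: intgB => //; apply: intgD => //; exact: intgD.
have mQ : measurable_fun (setT : set plane) Q.
  rewrite /Q; under eq_fun do rewrite big_bool /=.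
  have msq j c : measurable_fun (setT : set plane) (fun y => (reim c (mg j phi) y + f y * pr j y * reim c phi y) ^+ 2).
    apply: measurable_funX; apply: measurable_funD; first exact: (L2_cmeas (Lm j) c).
    exact: rtest_meas (rtestMl (sfj j) (tc c)).
  exact: (measurable_funD (measurable_funD (msq true false) (msq true true)) (measurable_funD (msq false false) (msq false true))).
have := Rint_ae (intg_meas iL) mQ Qae.
rewrite RintegralB//; last by apply: intgD => //; exact: intgD.
have e1 : \int[mu]_y (partial false (h false) y + partial true (h true) y) = 0.
  have z1 := int_partial0 false (th false); have z2 := int_partial0 true (th true).
  by rewrite RintegralD//; [rewrite z1 z2 addr0|exact: ih|exact: ih].
rewrite RintegralD//; last exact: (intgD (ih false) (ih true)).
rewrite e1 Em add0r => eQ.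
have : 0 <= \int[mu]_y Q y.
  by apply: Rintegral_ge0 => y _; apply: sumr_ge0 => j _; rewrite addr_ge0 ?sqr_ge0.
by rewrite -eQ subr_ge0.
Qed.

(** The choice [f = 1/4] balances the divergence term [2 f] with the harmonic
    potential [|y|^2 / 16 = f^2 |y|^2]: this is the bound of the spectrum of the harmonic oscillator
    by its ground state, with the constant 1/2. *)
Lemma coercive phi : test_function O phi -> cip phi phi <= 2 * bf phi phi.
Proof.
move=> tp; have := hardy (@smooth_cst _ (4^-1)) tp.
have [Lp Lw _ _] := test_md HA tp.
have [iN EN] := cip_sqmod Lp; have [iw Ew] := cip_sqmod Lw.
rewrite (_ : Rintegral _ _ _ = \int[mu]_y (2^-1 * sqmod phi y - 16^-1 * sqmod (weighted phi) y)); last first.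
  apply: eq_Rintegral => y _; rewrite !partial_cst /sqmod !reim_weighted -eucl_sqr.
  by field.
rewrite RintegralB//; [|exact: intgZ|exact: intgZ].
rewrite !RintegralZl// EN Ew bf_kinetic.
by move: (cip _ _) (cip _ _) (kinetic _) => x y z; lra.
Qed.
End test.
End hardy.

(** * The logarithmic weight and cutoff *)

Section cutoff.
Context {R : realType}.
Local Notation mu := (leb2 R).
Local Notation plane := (measurableTypeR R * measurableTypeR R)%type.
Local Notation E := (R * R -> R[i]).
Implicit Types (u v w phi : E) (psi f h : R * R -> R) (c j : bool).

Lemma Rint_ae_ge0 f : measurable_fun (setT : set plane) f ->
  {ae mu, forall y, 0 <= f y} -> 0 <= \int[mu]_y f y.
Proof.
move=> mf f0; rewrite (@Rint_ae _ _ _ mu f (fun y => `|f y|)) //.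
- by apply: Rintegral_ge0 => y _.
- exact: measurableT_comp mf.
- by apply: aeS f0 => y y0; rewrite ger0_norm.
Qed.

(** Chosen so that the iterated logarithm [ln (lg y)] equals [z] where [sqn y] is [kappa z]; it is the
    square of the radius below which the cutoff vanishes, and tends to 0 as [z] grows. *)
Definition kappa (z : R) : R := (2 * (expR (expR z - 1) - 1))^-1.

Lemma kappa_gt0 z : 0 < z -> 0 < kappa z.
Proof.
move=> z0; rewrite /kappa invr_gt0 mulr_gt0// subr_gt0 -[X in X < _]expR0 ltr_expR.
by rewrite subr_gt0 -[X in X < _]expR0 ltr_expR.
Qed.

Local Opaque smooth partial reim rtest.

Variable z : R.
Hypothesis z0 : 0 < z.
Let k0 := kappa_gt0 z0.

(** The squared distance to the origin, shifted by [kappa z] in order to keep all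
    functions below smooth at the origin. *)
Definition tau (y : R * R) : R := sqn y + kappa z.
(** [1 + ln ((1 + tau) / tau)], which is of the order of [ln (1 / tau)] for small [tau], and tends to 1 at infinity. *)
Definition lg (y : R * R) : R := 1 + (ln (1 + tau y) - ln (tau y)).
(** The speed of the radial field used in [hardy]; up to the regularisation it is
    [1 / (r^2 log (1 / r^2))] near the origin, the critical choice in dimension two, where the power weight
    [1 / r^2] is not available. *)
Definition spd (y : R * R) : R := (tau y * lg y)^-1.
(** The weight of the logarithmic Hardy inequality.  It dominates the squared gradient of the
    cutoff ([cut_grad]). *)
Definition lwt (y : R * R) : R := sqn y * (spd y ^+ 2 * (1 + tau y)^-1).
(** Zero where [ln lg >= z], one where [ln lg <= z / 2]. *)
Definition cut (y : R * R) : R := step (2 + (- (2 / z)) * ln (lg y)).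

Lemma tau_gt0 y : 0 < tau y. Proof. by rewrite ltr_wpDl ?sqn_ge0. Qed.

Lemma tau1_gt0 y : 0 < 1 + tau y. Proof. by rewrite addr_gt0 ?tau_gt0. Qed.

Lemma lg_ge1 y : 1 <= lg y.
Proof. by rewrite lerDl subr_ge0 ler_ln ?posrE ?tau_gt0 ?tau1_gt0// lerDr. Qed.

Lemma lg_gt0 y : 0 < lg y. Proof. exact: lt_le_trans (lg_ge1 y). Qed.

Lemma smooth_tau : smooth tau.
Proof. exact: smoothD (@smooth_sqn R) (smooth_cst _). Qed.

Lemma smooth_tau1 : smooth (fun y => 1 + tau y).
Proof. exact: smoothD (smooth_cst _) smooth_tau. Qed.

Lemma smooth_lg : smooth lg.
Proof.
apply: smoothD (smooth_cst _) _; apply: smoothB.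
  exact: smooth_ln smooth_tau1 tau1_gt0.
exact: smooth_ln smooth_tau tau_gt0.
Qed.

Lemma taulg_neq0 y : tau y * lg y != 0.
Proof. by rewrite mulf_neq0 ?gt_eqF ?tau_gt0 ?lg_gt0. Qed.

Lemma smooth_spd : smooth spd.
Proof. exact: smooth_inv (smoothM smooth_tau smooth_lg) taulg_neq0. Qed.

Lemma smooth_lwt : smooth lwt.
Proof.
apply: smoothM; first exact: smooth_sqn.
apply: smoothM; first exact: smoothM smooth_spd smooth_spd.
by apply: smooth_inv smooth_tau1 _ => y; rewrite gt_eqF ?tau1_gt0.
Qed.

Lemma smooth_lnlg : smooth (fun y => ln (lg y)).
Proof. exact: smooth_ln smooth_lg lg_gt0. Qed.

Lemma smooth_cut : smooth cut.
Proof.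
apply: (smooth_comp1 Sm1_step); apply: smoothD; first exact: smooth_cst.
exact: smoothM (smooth_cst _) smooth_lnlg.
Qed.

Lemma partial_tau j y : partial j tau y = 2 * pr j y.
Proof.
rewrite /tau (partialD _ _ (@smooth_sqn R) (smooth_cst _)) partial_cst addr0.
exact: partialE (is_derive_sqn j y).
Qed.

Lemma partial_tau1 j y : partial j (fun y => 1 + tau y) y = 2 * pr j y.
Proof. by rewrite (partialD _ _ (smooth_cst _) smooth_tau) partial_cst add0r partial_tau. Qed.

Lemma partial_lg j y : partial j lg y = - (2 * pr j y) / (tau y * (1 + tau y)).
Proof.
have s1 := smooth_ln smooth_tau1 tau1_gt0; have s2 := smooth_ln smooth_tau tau_gt0.
rewrite /lg (partialD _ _ (smooth_cst _) (smoothB s1 s2)) partial_cst add0r.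
rewrite (partialE (is_deriveB (smooth_is_derive j y s1) (smooth_is_derive j y s2))).
rewrite (partial_ln _ smooth_tau1 (tau1_gt0 y)) (partial_ln _ smooth_tau (tau_gt0 y)).
by rewrite partial_tau partial_tau1; field; rewrite !gt_eqF ?tau_gt0 ?tau1_gt0.
Qed.

Lemma partial_spd j y : partial j spd y =
  - (2 * pr j y * (lg y - (1 + tau y)^-1)) * spd y ^+ 2.
Proof.
rewrite /spd (partial_inv _ _ (smoothM smooth_tau smooth_lg) taulg_neq0).
rewrite (partialM _ _ smooth_tau smooth_lg) partial_tau partial_lg.
by field; rewrite !gt_eqF ?tau_gt0 ?tau1_gt0 ?lg_gt0.
Qed.

Lemma partial_cut j y : partial j cut y =
  dstep (2 + (- (2 / z)) * ln (lg y)) * (4 / z * (pr j y * (spd y * (1 + tau y)^-1))).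
Proof.
have sa : smooth (fun y => 2 + (- (2 / z)) * ln (lg y)).
  exact: smoothD (smooth_cst _) (smoothM (smooth_cst _) smooth_lnlg).
rewrite /cut (partialE (is_derive_comp1 (smooth_is_derive j y sa) (is_derive_step _))).
congr (_ * _); rewrite (partialD _ _ (smooth_cst _) (smoothM (smooth_cst _) smooth_lnlg)).
rewrite partial_cst (partialM _ _ (smooth_cst _) smooth_lnlg) partial_cst mulr0 addr0 add0r.
rewrite (partial_ln _ smooth_lg (lg_gt0 y)) partial_lg /spd.
by field; rewrite !gt_eqF ?tau_gt0 ?tau1_gt0 ?lg_gt0.
Qed.

Lemma lwt_ge0 y : 0 <= lwt y.
Proof. by rewrite mulr_ge0 ?sqn_ge0// mulr_ge0 ?sqr_ge0// invr_ge0 ltW ?tau1_gt0. Qed.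

Lemma cut_grad C y : (forall x, dstep x <= C) ->
  partial false cut y ^+ 2 + partial true cut y ^+ 2 <= 16 * C ^+ 2 / z ^+ 2 * lwt y.
Proof.
move=> dC; rewrite !partial_cut; move: (dC (2 + (- (2 / z)) * ln (lg y))) (dstep_ge0 (2 + (- (2 / z)) * ln (lg y))).
move: (dstep _) => D DC D0.
have i0 : 0 < (1 + tau y)^-1 by rewrite invr_gt0 tau1_gt0.
have i1 : (1 + tau y)^-1 <= 1 by rewrite invf_le1 ?tau1_gt0// lerDl ltW ?tau_gt0.
have D2 : D ^+ 2 <= C ^+ 2 by rewrite ler_pXn2r ?nnegrE// (le_trans D0).
rewrite (_ : _ + _ = (16 / z ^+ 2) * (D ^+ 2 * (lwt y * (1 + tau y)^-1))); last first.
  by rewrite /lwt /sqn /pr; field; rewrite !gt_eqF ?tau1_gt0.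
rewrite [16 * C ^+ 2 / _]mulrAC -[X in _ <= X]mulrA; apply: ler_wpM2l; first by rewrite divr_ge0 ?sqr_ge0.
apply: ler_pM => //; [exact: sqr_ge0|by rewrite mulr_ge0 ?lwt_ge0// ltW|].
by rewrite ler_piMr ?lwt_ge0.
Qed.

(** The weight produced by [hardy] is [lwt (1 - tau)] plus a nonnegative multiple of [kappa z], and
    [lwt * tau <= 1]. *)
Lemma lwt_le y : lwt y <= (2 * spd y + (y.1 * partial false spd y + y.2 * partial true spd y) - spd y ^+ 2 * sqn y) + 1.
Proof.
have l0 := lg_gt0 y; have l1 := lg_ge1 y; have t0 := tau_gt0 y; have t1 := tau1_gt0 y.
have tE : tau y = sqn y + kappa z by [].
have w1 : lwt y * tau y <= 1.
  rewrite (_ : _ * _ = (sqn y / tau y) * ((lg y)^-1 ^+ 2 * (1 + tau y)^-1)); last first.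
    by rewrite /lwt /spd; field; rewrite !gt_eqF.
  have i0 := sqn_ge0 y.
  have b1 : sqn y / tau y <= 1 by rewrite ler_pdivrMr// mul1r tE lerDl ltW.
  have b2 : (lg y)^-1 ^+ 2 <= 1 by rewrite exprn_ile1 ?invr_ge0 ?(ltW l0)// invf_le1.
  have b3 : (1 + tau y)^-1 <= 1 by rewrite invf_le1// lerDl ltW.
  rewrite mulr_ile1//; [by rewrite divr_ge0// ltW|by rewrite mulr_ge0 ?sqr_ge0// invr_ge0 ltW|].
  by rewrite mulr_ile1 ?sqr_ge0// invr_ge0 ltW.
suff -> : 2 * spd y + (y.1 * partial false spd y + y.2 * partial true spd y) - spd y ^+ 2 * sqn y =
    lwt y - lwt y * tau y + 2 * kappa z * lg y * spd y ^+ 2.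
  have : 0 <= 2 * kappa z * lg y * spd y ^+ 2.
    apply: mulr_ge0; last exact: sqr_ge0.
    by apply: mulr_ge0; [apply: mulr_ge0 => //; exact: ltW|exact: ltW].
  by move: (lwt y * tau y) (2 * kappa z * lg y * spd y ^+ 2) (lwt y) w1 => *; lra.
rewrite !partial_spd /lwt.
have -> : 2 * spd y = 2 * (sqn y + kappa z) * lg y * spd y ^+ 2.
  by rewrite -tE /spd; field; rewrite !gt_eqF.
have -> : kappa z = tau y - sqn y by rewrite tE addrAC subrr add0r.
by rewrite /pr /sqn /=; move: (spd y) (lg y) => S L; field; rewrite !gt_eqF ?tau1_gt0.
Qed.

Lemma cut_ge0 y : 0 <= cut y. Proof. exact: step_ge0. Qed.
Lemma cut_le1 y : cut y <= 1. Proof. exact: step_le1. Qed.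

Lemma cut0 y : sqn y <= kappa z -> cut y = 0.
Proof.
move=> yk; apply: step0.
have e1 : expR z <= lg y.
  rewrite /lg -lerBlDl -[expR z - 1]expRK -ln_div ?posrE ?tau_gt0 ?tau1_gt0//.
  rewrite ler_ln ?posrE ?expR_gt0 ?divr_gt0 ?tau_gt0 ?tau1_gt0//.
  rewrite ler_pdivlMr ?tau_gt0//; have := tau_gt0 y.
  have : tau y <= 2 * kappa z by rewrite /tau mulr_natl mulr2n lerD2r.
  have : 2 * kappa z * (expR (expR z - 1) - 1) = 1.
    rewrite /kappa; field; rewrite subr_eq0 -[X in _ != X]expR0.
    by rewrite gt_eqF// ltr_expR subr_gt0 -[X in X < _]expR0 ltr_expR.
  have : 0 < expR (expR z - 1) - 1.
    by rewrite subr_gt0 -[X in X < _]expR0 ltr_expR subr_gt0 -[X in X < _]expR0 ltr_expR.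
  move: (expR _) (tau y) (kappa z) => e t k *; nra.
have : z <= ln (lg y) by rewrite -[z]expRK ler_ln ?posrE ?expR_gt0 ?lg_gt0.
rewrite -(ler_pM2l (divr_gt0 (ltr0Sn _ 1) z0)) divfK ?gt_eqF// mulNr.
by rewrite subr_le0.
Qed.

Lemma cut1 y : y != (0, 0) -> ln (1 + ln (1 + (sqn y)^-1)) <= z / 2 -> cut y = 1.
Proof.
move=> y0 h; apply: step1.
have s0 : 0 < sqn y.
  by rewrite -eucl_sqr exprn_gt0// lt_def eucl_ge0 andbT; apply: contraNneq y0 => /eucl0 ->.
have i0 : 0 < 1 + (sqn y)^-1 by rewrite addr_gt0 ?invr_gt0.
have l1 : lg y <= 1 + ln (1 + (sqn y)^-1).
  rewrite /lg lerD2l -ln_div ?posrE ?tau_gt0 ?tau1_gt0// ler_ln ?posrE ?divr_gt0 ?tau_gt0 ?tau1_gt0//.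
  rewrite mulrDl mul1r mulfV ?gt_eqF ?tau_gt0// addrC lerD2l lef_pV2 ?posrE ?tau_gt0//.
  by rewrite /tau lerDl ltW.
have l2 : ln (lg y) <= z / 2.
  by apply: le_trans h; rewrite ler_ln ?posrE ?lg_gt0// (lt_le_trans (lg_gt0 y)).
have : 2 / z * ln (lg y) <= 2 / z * (z / 2) by rewrite ler_wpM2l// divr_ge0// ltW.
rewrite [2 / z * (z / 2)](_ : _ = 1); last by field; rewrite gt_eqF.
by rewrite mulNr; lra.
Qed.

End cutoff.

(** * The cost of the cutoff *)

Section real_multiple.
Context {R : realType}.
Local Notation mu := (leb2 R).
Local Notation plane := (measurableTypeR R * measurableTypeR R)%type.
Local Notation E := (R * R -> R[i]).
Implicit Types (u v w phi : E) (psi f h : R * R -> R) (c j : bool).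

Definition rm f phi : E := fun y => (f y)%:C%C * phi y.

Lemma reim_rm c f phi : reim c (rm f phi) = fun y => f y * reim c phi y.
Proof.
apply/funext => y; rewrite /rm /reim; case: (phi y) => p q.
by case: c; rewrite /= mul0r ?addr0 ?subr0.
Qed.

Lemma rm_test O f phi : smooth f -> test_function O phi -> test_function O (rm f phi).
Proof. by move=> sf /testP tp; apply/testP => c; rewrite reim_rm; exact: rtestMl sf (tp c). Qed.

(** The magnetic gradient is local. *)
Lemma mg_agree O A O' A' phi (HA : admissible O A) (HA' : admissible O' A') : test_function O phi -> test_function O' phi ->
  (forall y, phi y != 0 -> A y = A' y) -> forall j, aeq (mg O A j phi) (mg O' A' j phi).
Proof.
move=> tp tp' AA j c; apply: aeS2 (mg_test HA j c tp) (mg_test HA' j c tp') => y -> ->.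
congr (_ + _); have [p0|/AA AE] := eqVneq (phi y) 0.
  by rewrite /rot /reim p0; case: (c); rewrite /= !mulr0.
by rewrite /rot /Acomp AE.
Qed.

Lemma bf_agree O A O' A' phi (HA : admissible O A) (HA' : admissible O' A') : test_function O phi -> test_function O' phi ->
  (forall y, phi y != 0 -> A y = A' y) -> bf O A phi phi = bf O' A' phi phi.
Proof.
move=> tp tp' AA; have [_ _ _ L] := test_md HA tp; have [_ _ _ L'] := test_md HA' tp'.
have H j : cip (mg O A j phi) (mg O A j phi) = cip (mg O' A' j phi) (mg O' A' j phi).
  exact: (cip_aeq2 (L2_cmeas (L j)) (L2_cmeas (L' j)) (mg_agree HA HA' tp tp' AA j)).
by rewrite /bf !H.
Qed.

Local Opaque smooth partial reim rtest.

Variable z : R.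
Hypothesis z0 : 0 < z.

Lemma cut_test_punctured O phi : test_function O phi -> test_function (@punctured R) (rm (cut z) phi).
Proof.
move=> /testP tp; apply/testP => c; rewrite reim_rm.
have [K [cK _ _ K0]] := rtest_out (tp c).
have [M M0 HM] := cont_bounded cK (smooth_cont (@smooth_sqn R)).
apply: (rtestI _ (@compact_annulus _ (kappa z) M)).
- exact: smoothM (smooth_cut z0) (rtest_smooth (tp c)).
- move=> y /= /andP[yk _]; rewrite /punctured /=; apply/eqP => y0.
  by move: yk; rewrite y0 /sqn /= expr0n addr0 leNgt kappa_gt0.
move=> y /negP; rewrite negb_and -!ltNge => /orP[yk|yM]; first by rewrite cut0 ?mul0r// ltW.
rewrite K0 ?mulr0// => /HM; rewrite ger0_norm ?sqn_ge0// leNgt; exact/negP/negPn.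
Qed.

Variables (O : set (R * R)) (A : R * R -> R * R).
Hypothesis HA : admissible O A.
Local Notation mg := (mg O A).
Local Notation bf := (bf O A).

(** The error 1 in [lwt_le] is absorbed by coercivity, whence the constant [3 = 1 + 2]. *)
Lemma log_hardy phi : test_function O phi ->
  intg mu (fun y => lwt z y * sqmod phi y) /\ \int[mu]_y (lwt z y * sqmod phi y) <= 3 * bf phi phi.
Proof.
move=> tp; have sl := smooth_lwt z0; have ss := smooth_spd z0.
split; first exact: intg_smooth_sqmod sl tp.
have h1 := hardy HA ss tp; have h2 := coercive HA tp.
have [Lp Lw _ _] := test_md HA tp; have [iN EN] := cip_sqmod Lp.
pose W y := 2 * spd z y + (y.1 * partial false (spd z) y + y.2 * partial true (spd z) y) - spd z y ^+ 2 * sqn y.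
have sW : smooth W.
  apply: smoothB; last exact: smoothM (smoothM ss ss) (@smooth_sqn R).
  apply: smoothD; first exact: smoothM (smooth_cst _) ss.
  exact: smoothD (smoothM (smooth_pr false) (smooth_partial false ss)) (smoothM (smooth_pr true) (smooth_partial true ss)).
have iW := intg_smooth_sqmod sW tp.
have h3 : \int[mu]_y (lwt z y * sqmod phi y) <= \int[mu]_y (W y * sqmod phi y + sqmod phi y).
  apply: le_Rintegral => //; [exact: intg_smooth_sqmod sl tp|exact: intgD|].
  move=> y _; rewrite -[X in _ <= _ + X]mul1r -mulrDl; apply: ler_wpM2r; first exact: sqmod_ge0.
  exact: lwt_le.
apply: le_trans h3 _; rewrite RintegralD// EN.
have h4 : kinetic O A phi <= bf phi phi.
  by rewrite bf_kinetic lerDl; apply: mulr_ge0; [rewrite invr_ge0|exact: cip_ge0].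
have {}h1 : \int[mu]_y (W y * sqmod phi y) <= kinetic O A phi by exact: h1.
by move: h1 h2 h4; clear; move: (Rintegral _ _ _) (kinetic _ _ _) (bf _ _) (cip _ _) => *; lra.
Qed.

Lemma mg_rm f phi j c : smooth f -> test_function O phi ->
  {ae mu, forall y, reim c (mg j (rm f phi)) y = f y * reim c (mg j phi) y + partial j f y * reim c phi y}.
Proof.
move=> sf tp; apply: aeS2 (mg_test HA j c (rm_test sf tp)) (mg_test HA j c tp) => y -> ->.
have /testP tc := tp; rewrite reim_rm (partialM _ _ sf (rtest_smooth (tc c))).
by rewrite /rot !reim_rm; case: c; ring.
Qed.

Lemma weighted_rm f phi : weighted (rm f phi) = rm f (weighted phi).
Proof. by apply/funext => y; rewrite /weighted /rm; ring. Qed.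

Lemma cip_rm_le f phi : L2 phi -> L2 (rm f phi) -> (forall y, 0 <= f y <= 1) ->
  cip (rm f phi) (rm f phi) <= cip phi phi.
Proof.
move=> Lp Lf f01; have [i1 <-] := cip_sqmod Lp; have [i2 <-] := cip_sqmod Lf.
apply: le_Rintegral => // y _; rewrite /sqmod !reim_rm.
have /andP[f0 f1] := f01 y; have f2 : f y * f y <= 1 by rewrite mulr_ile1.
by rewrite mulrACA [X in _ + X]mulrACA -mulrDr ler_piMl// -!expr2 addr_ge0// sqr_ge0.
Qed.

(** By Leibniz, [D (eta phi) = eta D phi + phi grad eta].  The square is split with the weight
    [1 / z], and [|phi grad eta|^2] is controlled by the weight [lwt], up to the factor [16 C^2 / z^2],
    that is by [48 C^2 / z^2] times the form. *)
Lemma cut_bf C phi : (forall x, dstep x <= C) -> test_function O phi ->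
  bf (rm (cut z) phi) (rm (cut z) phi) <= (1 + z^-1 + 48 * C ^+ 2 * (1 + z) / z ^+ 2) * bf phi phi.
Proof.
move=> dC tp; have [i1 h1] := log_hardy tp; have sc := smooth_cut z0.
have tr := rm_test sc tp; have [Lp Lw _ Lm] := test_md HA tp; have [Lr Lrw _ Lrm] := test_md HA tr.
have [i2 E2] := kinetic_densityE Lm; have [i3 E3] := kinetic_densityE Lrm.
have d0 : 0 < z^-1 by rewrite invr_gt0.
pose a := 1 + z^-1; pose b := (1 + z) * (16 * C ^+ 2 / z ^+ 2).
have iab := intgD (intgZ a i2) (intgZ b i1); have iH := intgB iab i3.
have H : 0 <= \int[mu]_y (a * kinetic_density O A phi y + b * (lwt z y * sqmod phi y) - kinetic_density O A (rm (cut z) phi) y).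
  apply: Rint_ae_ge0; first exact: intg_meas iH.
  have e j : {ae mu, forall y, forall c, reim c (mg j (rm (cut z) phi)) y = cut z y * reim c (mg j phi) y + partial j (cut z) y * reim c phi y}.
    by apply: aeS2 (mg_rm j false sc tp) (mg_rm j true sc tp) => y h h' [].
  apply: aeS2 (e false) (e true) => y e0 e1; rewrite /kinetic_density /sqmod !e0 !e1.
  have hg := cut_grad z0 y dC; have /andP[c0 c1] : 0 <= cut z y <= 1 by rewrite cut_ge0 cut_le1.
  have hC : 0 <= 16 * C ^+ 2 / z ^+ 2 by apply: divr_ge0; [apply: mulr_ge0 => //; exact: sqr_ge0|exact: sqr_ge0].
  have key (m g p : R) : (cut z y * m + g * p) * (cut z y * m + g * p) <= a * (m * m) + (1 + z) * (g ^+ 2 * (p * p)).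
    have k1 : (cut z y) ^+ 2 * m ^+ 2 <= m ^+ 2 by apply: ler_piMl; [exact: sqr_ge0|exact: exprn_ile1].
    have k2 := sqr_ge0 (cut z y * m - z * (g * p)).
    have k3 : 0 <= z^-1 * (cut z y * m - z * (g * p)) ^+ 2 by rewrite mulr_ge0// ltW.
    have k4 : z^-1 * (cut z y * m - z * (g * p)) ^+ 2 = z^-1 * (cut z y ^+ 2 * m ^+ 2) - 2 * (cut z y * m) * (g * p) + z * (g ^+ 2 * (p * p)).
      by field; rewrite gt_eqF.
    have k5 : z^-1 * (cut z y ^+ 2 * m ^+ 2) <= z^-1 * m ^+ 2 by rewrite ler_wpM2l// ltW.
    rewrite k4 in k3.
    rewrite (_ : (cut z y * m + g * p) * (cut z y * m + g * p) = cut z y ^+ 2 * m ^+ 2 + 2 * (cut z y * m) * (g * p) + g ^+ 2 * (p * p)); last by ring.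
    rewrite (_ : a * (m * m) + _ = m ^+ 2 + z^-1 * m ^+ 2 + (g ^+ 2 * (p * p) + z * (g ^+ 2 * (p * p)))); last by rewrite /a; ring.
    move: k1 k3 k5; clear; move: (cut z y ^+ 2 * m ^+ 2) (m ^+ 2) => x1 x2.
    by move: (z^-1 * x1) (z^-1 * x2) (2 * _ * _) (g ^+ 2 * _) => x3 x4 x5 x6; move: (z * x6) => x7 *; lra.
  have alg (g0 g1 p q m1 m2 m3 m4 l : R) : g0 ^+ 2 + g1 ^+ 2 <= 16 * C ^+ 2 / z ^+ 2 * l ->
    (cut z y * m1 + g0 * p) * (cut z y * m1 + g0 * p) + (cut z y * m2 + g0 * q) * (cut z y * m2 + g0 * q) +
    ((cut z y * m3 + g1 * p) * (cut z y * m3 + g1 * p) + (cut z y * m4 + g1 * q) * (cut z y * m4 + g1 * q)) <=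
    a * (m1 * m1 + m2 * m2 + (m3 * m3 + m4 * m4)) + b * (l * (p * p + q * q)).
    move=> gl; have n0 : 0 <= p * p + q * q by rewrite -!expr2 addr_ge0 ?sqr_ge0.
    have h2 : (1 + z) * ((g0 ^+ 2 + g1 ^+ 2) * (p * p + q * q)) <= b * (l * (p * p + q * q)).
      rewrite /b -mulrA; apply: ler_wpM2l; first by rewrite addr_ge0// ltW.
      by rewrite mulrA ler_wpM2r.
    apply: le_trans (lerD (lerD (key m1 g0 p) (key m2 g0 q)) (lerD (key m3 g1 p) (key m4 g1 q))) _.
    apply: le_trans (lerD (lexx (a * (m1 * m1 + m2 * m2 + (m3 * m3 + m4 * m4)))) h2).
    by clear; rewrite le_eqVlt; apply/orP; left; apply/eqP; ring.
  rewrite subr_ge0; exact: alg hg.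
have EI : \int[mu]_y (a * kinetic_density O A phi y + b * (lwt z y * sqmod phi y) - kinetic_density O A (rm (cut z) phi) y) =
  a * kinetic O A phi + b * \int[mu]_y (lwt z y * sqmod phi y) - kinetic O A (rm (cut z) phi).
  rewrite RintegralB// RintegralD//; [|exact: intgZ i2|exact: intgZ i1].
  by rewrite !RintegralZl// E2 E3.
rewrite EI in H.
have hw : cip (weighted (rm (cut z) phi)) (weighted (rm (cut z) phi)) <= cip (weighted phi) (weighted phi).
  rewrite weighted_rm; apply: cip_rm_le => //; first by rewrite -weighted_rm.
  by move=> y; rewrite cut_ge0 cut_le1.
have b0 : 0 <= b by apply: mulr_ge0; [rewrite addr_ge0// ltW|apply: divr_ge0; [apply: mulr_ge0 => //; exact: sqr_ge0|exact: sqr_ge0]].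
have hb : b * \int[mu]_y (lwt z y * sqmod phi y) <= b * (3 * bf phi phi) by exact: ler_wpM2l.
have a1 : cip (weighted phi) (weighted phi) <= a * cip (weighted phi) (weighted phi).
  by rewrite ler_peMl ?cip_ge0// /a lerDl ltW.
rewrite (_ : 1 + z^-1 + 48 * C ^+ 2 * (1 + z) / z ^+ 2 = a + 3 * b); last by rewrite /a /b; ring.
have -> : (a + 3 * b) * bf phi phi =
    a * kinetic O A phi + 16^-1 * (a * cip (weighted phi) (weighted phi)) + b * (3 * bf phi phi).
  by rewrite mulrDl {1}bf_kinetic; move: (bf phi phi) (kinetic _ _ _) (cip _ _) => *; ring.
have fin (d' ad BI w' w aw B3 : R) : 0 <= ad + BI - d' -> w' <= w -> BI <= B3 -> w <= aw ->
  d' + 16^-1 * w' <= ad + 16^-1 * aw + B3 by clear; lra.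
by rewrite [X in X <= _]bf_kinetic; exact: fin H hw hb a1.
Qed.
End real_multiple.

(** * Graphs of the operators *)

Section graphs.
Context {R : realType}.
Local Notation mu := (leb2 R).
Local Notation plane := (measurableTypeR R * measurableTypeR R)%type.
Local Notation E := (R * R -> R[i]).
Implicit Types (u v w phi F : E) (psi f h : R * R -> R) (c j : bool).

Section generic.
Variables (O : set (R * R)) (A : R * R -> R * R).
Hypothesis HA : admissible O A.
Local Notation md := (md O A).
Local Notation mg := (mg O A).
Local Notation bf := (bf O A).

Lemma polE u v : md u -> md v ->
  polarization (mag_form O A) u v = (bf u v +i* bf u (iu v))%C.
Proof.
move=> du dv; have di := md_iu HA dv; rewrite /polarization.
have e1 : (fun x => u x + v x) = ax 1 u v by apply/funext => y; rewrite /ax mul1r.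
have e2 : (fun x => u x - v x) = ax (-1) u v by exact: sbE.
have e3 : (fun x => u x + 'i%C * v x) = ax 1 u (iu v) by apply/funext => y; rewrite /ax mul1r.
have e4 : (fun x => u x - 'i%C * v x) = ax (-1) u (iu v) by exact: (sbE u (iu v)).
rewrite e1 e2 e3 e4 !mag_formE; try exact: (md_ax HA).
rewrite !(bf_ax HA)//; move: (bf u u) (bf v v) (bf (iu v) (iu v)) (bf u v) (bf u (iu v)) => a b c x y.
apply/eqP; rewrite eq_complex /=; apply/andP; split; apply/eqP; by field.
Qed.

(** As the domain is stable under multiplication by [i], the equality of the real parts for all
    [v] contains that of the imaginary parts. *)
Lemma form_opP (D : set E) u F : (forall v, D v -> md v) -> (forall v, D v -> D (iu v)) -> L2 F ->
  form_operator D (mag_form O A) u F <-> D u /\ forall v, D v -> bf u v = cip F v.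
Proof.
move=> Dm Di LF; have L v : D v -> L2 v by move=> /Dm[].
split=> [[Du _ H]|[Du H]]; split => // v Dv.
  have := H v Dv; rewrite polE ?inner2E//; [|exact: L|exact: Dm|exact: Dm].
  by move=> /eqP; rewrite eq_complex => /andP[/eqP].
by rewrite polE ?inner2E ?H//; [exact: Di|exact: L|exact: Dm|exact: Dm].
Qed.

Lemma test_iu phi : test_function O phi -> test_function O (iu phi).
Proof.
move=> /testP tp; apply/testP => c; rewrite reim_iu.
by case: c; [exact: (tp false)|apply: rtestN; exact: (tp true)].
Qed.

Lemma approx_iu u : approx O A u -> approx O A (iu u).
Proof.
move=> [du au]; split=> [|e e0]; first exact: md_iu.
have [phi tp [h1 h2]] := au e e0; exists (iu phi); first exact: test_iu.
have -> : ax (-1) (iu u) (iu phi) = iu (ax (-1) u phi).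
  by apply/funext => y; rewrite /ax /iu; ring.
by rewrite (bf_iu HA) ?cip_iu//; apply: (md_ax HA) => //; exact: (test_md HA).
Qed.
End generic.

Section full_domain.
Variable (A : R * R -> R * R).
Hypothesis HA : admissible setT A.
Variable CA : R.
Hypothesis A_bdd : forall j y, `|Acomp A j y| <= CA.
Local Notation md := (md setT A).
Local Notation mg := (mg setT A).
Local Notation bf := (bf setT A).
Variables (u F : E).
Hypotheses (du : md u) (LF : L2 F).
Hypothesis Eu : forall phi, test_function setT phi -> bf u phi = cip F phi.

Let Lu : L2 u. Proof. by case: du. Qed.
Let Lm j : L2 (mg j u). Proof. by case: du. Qed.
Let sm j c : sqi mu (reim c (mg j u)). Proof. exact: (L2P _).1 (Lm j) c. Qed.
Let sF c : sqi mu (reim c F). Proof. exact: (L2P _).1 LF c. Qed.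
Let su c : sqi mu (reim c u). Proof. exact: (L2P _).1 Lu c. Qed.

Lemma rot_sqi c j v : L2 v -> sqi mu (rot c (Acomp A j) v).
Proof.
move=> /L2P sv; have H d := sqi_bmul (A_meas HA j) (sv d) (A_bdd j).
by rewrite /rot; case: c; [apply: sqiN|]; exact: H.
Qed.

(** The terms of order zero of the equation of [u], when its real components are
    tested with real functions: the equation reads [- div (mg _ u) + lower = 0] in each component. *)
Definition lower c (y : R * R) : R := 16^-1 * (sqn y * reim c u y) - reim c F y -
  (rot c (Acomp A false) (mg false u) y + rot c (Acomp A true) (mg true u) y).

Lemma lower_sqi c m : sqi mu (fun y => \1_(box m) y * lower c y).
Proof.
pose b y := \1_(box m) y * sqn y.
have mb : measurable_fun (setT : set plane) (\1_(box m) : R * R -> R) by exact: measurable_indic (measurable_box m).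
have mB : measurable_fun (setT : set plane) b.
  by apply: measurable_funM mb _; exact: cont_meas2 (smooth_cont (@smooth_sqn R)).
have i1 y : `|\1_(box m) y : R| <= 1 by rewrite indicE; case: (_ \in _); rewrite ?normr1 ?normr0.
have bm y : `|b y| <= 2 * m ^+ 2.
  rewrite /b indicE; have [|_] := boolP (y \in _); last by rewrite mul0r normr0 mulr_ge0 ?sqr_ge0.
  rewrite inE => -[h1 h2]; rewrite mul1r ger0_norm ?sqn_ge0// /sqn.
  rewrite -(real_normK (num_real y.1)) -(real_normK (num_real y.2)) mulr_natl mulr2n.
  by apply: lerD; rewrite ler_pXn2r ?nnegrE// (le_trans _ h1).
have s1 := sqiZ 16^-1 (sqi_bmul mB (su c) bm).
have s2 := sqi_bmul mb (sqiB (sqiN (sF c)) (sqiD (rot_sqi c false (Lm false)) (rot_sqi c true (Lm true)))) i1.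
have := sqiD s1 s2; congr (sqi mu); apply/funext => y; rewrite /b /lower.
by move: (\1_(box m) y) => i; ring.
Qed.

Lemma lower_eq c psi : rtest setT psi ->
  \int[mu]_y (reim c (mg false u) y * partial false psi y + reim c (mg true u) y * partial true psi y
    + lower c y * psi y) = 0.
Proof.
move=> tp.
(* the test functions [psi] and [i psi] give the two components of the equation *)
pose phi : E := fun y => (if c then (0 +i* psi y) else (psi y +i* 0))%C.
have ccp d : reim d phi = fun y => if d == c then psi y else 0 by apply/funext => y; rewrite /reim /phi; case: (c); case: d.
have tphi : test_function setT phi.
  by apply/testP => d; rewrite ccp; case: (d == c) => //; exact: rtest0.
have [Lp Lw _ Lmp] := test_md HA tphi; have sp := rtest_sqi tp; have sj j := rtest_sqi (rtest_partial j tp).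
have i1 j := sqi_mul (sm j c) (sj j); have i2 j := sqi_mul (rot_sqi c j (Lm j)) sp.
have iF := sqi_mul (sF c) sp.
have e1 j : cip (mg j u) (mg j phi) = \int[mu]_y (reim c (mg j u) y * partial j psi y) - \int[mu]_y (rot c (Acomp A j) (mg j u) y * psi y).
  rewrite -RintegralB//; [|exact: i1|exact: i2].
  rewrite /cip -RintegralD//; try exact: sqi_mul ((L2P _).1 (Lm j) _) ((L2P _).1 (Lmp j) _).
  apply: Rint_ae.
  - by apply: measurable_funD; apply: measurable_funM; [exact: (sqi_meas (sm j _))|exact: (L2_cmeas (Lmp j) _)|exact: (sqi_meas (sm j _))|exact: (L2_cmeas (Lmp j) _)].
  - exact: intg_meas (intgB (i1 j) (i2 j)).
  apply: aeS2 (mg_test HA j false tphi) (mg_test HA j true tphi) => y -> ->.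
  have p0 : partial j (fun=> 0 : R) y = 0 by exact: partial_cst.
  by rewrite /rot !ccp; case: (c) => /=; rewrite p0 ?mulr0; ring.
have wE : cip (weighted u) (weighted phi) = \int[mu]_y (sqn y * reim c u y * psi y).
  have [_ Lwu _ _] := du.
  rewrite /cip -RintegralD//; try exact: sqi_mul ((L2P _).1 Lwu _) ((L2P _).1 Lw _).
  apply: eq_Rintegral => y _; rewrite !reim_weighted !ccp -eucl_sqr.
  by case: (c) => /=; ring.
have iw : intg mu (fun y => sqn y * reim c u y * psi y).
  have [_ Lwu _ _] := du; have := intgD (sqi_mul ((L2P _).1 Lwu false) ((L2P _).1 Lw false)) (sqi_mul ((L2P _).1 Lwu true) ((L2P _).1 Lw true)).
  congr (intg mu); apply/funext => y; rewrite !reim_weighted !ccp -eucl_sqr.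
  by case: (c) => /=; ring.
have FE : cip F phi = \int[mu]_y (reim c F y * psi y).
  rewrite /cip -RintegralD//; try exact: sqi_mul (sF _) ((L2P _).1 Lp _).
  by apply: eq_Rintegral => y _; rewrite !ccp; case: (c) => /=; ring.
have := Eu tphi; rewrite /bf !e1 wE FE => H.
rewrite (_ : Rintegral _ _ _ = \int[mu]_y (reim c (mg false u) y * partial false psi y - rot c (Acomp A false) (mg false u) y * psi y +
  (reim c (mg true u) y * partial true psi y - rot c (Acomp A true) (mg true u) y * psi y) + 16^-1 * (sqn y * reim c u y * psi y) - reim c F y * psi y)); last first.
  by apply: eq_Rintegral => y _; rewrite /lower; ring.
have ib j := intgB (i1 j) (i2 j); have iz := intgZ 16^-1 iw.
rewrite RintegralB//; last exact: intgD (intgD (ib _) (ib _)) iz.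
rewrite RintegralD//; last exact: intgD (ib _) (ib _).
rewrite RintegralD//; [|exact: ib|exact: ib].
by rewrite (RintegralB measurableT (i1 false) (i2 false)) (RintegralB measurableT (i1 true) (i2 true)) RintegralZl// H subrr.
Qed.

(** Equal to 1 on large discs, with gradients bounded independently of [n]. *)
Definition chi (n : nat) (y : R * R) : R := step (2 + (- n.+1%:R^-1) * sqn y).

Lemma smooth_chi n : smooth (chi n). Proof. exact: smooth_step_sqn. Qed.

Lemma partial_chi n j y : partial j (chi n) y =
  dstep (2 + (- n.+1%:R^-1) * sqn y) * (- n.+1%:R^-1 * (2 * pr j y)).
Proof.
have D := is_deriveD (is_derive_cst (2 : R) y (dir j)) (is_deriveZ (- n.+1%:R^-1 : R) (is_derive_sqn j y)).
rewrite /chi; apply: partialE; have D2 := is_derive_comp1 D (is_derive_step _).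
by apply: (is_derive_conv D2) => //; rewrite add0r.
Qed.

Lemma chi_out n y : ~ box (2 * n.+1%:R) y -> chi n y = 0.
Proof.
move=> yb; apply: step0; rewrite mulNr subr_le0 mulrC ler_pdivlMr ?ltr0Sn//.
rewrite leNgt; apply/negP => yn; apply: yb; have n1 : (1 : R) <= n.+1%:R by rewrite ler1n.
have H x : x ^+ 2 <= sqn y -> `|x| <= 2 * n.+1%:R.
  move=> xy; rewrite -(@ler_pXn2r _ 2) ?nnegrE ?mulr_ge0// real_normK ?num_real//.
  by apply: le_trans xy _; apply: le_trans (ltW yn) _; move: (n.+1%:R) n1 => t *; nra.
by split; apply: H; rewrite /sqn ?lerDl ?lerDr sqr_ge0.
Qed.

Lemma partial_chi_bound C n j y : (forall x, dstep x <= C) -> `|partial j (chi n) y| <= 6 * C.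
Proof.
move=> dC; rewrite partial_chi; set a := 2 + _.
have C0 : 0 <= C := le_trans (dstep_ge0 0) (dC 0).
have [a0|a0] := leP a 0; first by rewrite dstep0 ?mul0r ?normr0 ?mulr_ge0//; left.
have n0 : (0 : R) < n.+1%:R by rewrite ltr0Sn.
have n1 : (1 : R) <= n.+1%:R by rewrite ler1n.
have yn : sqn y < 2 * n.+1%:R.
  by move: a0; rewrite /a mulNr subr_gt0 mulrC ltr_pdivrMr.
rewrite normrM (ger0_norm (dstep_ge0 _)) [6 * C]mulrC; apply: ler_pM => //; first exact: dstep_ge0.
rewrite !normrM normrN normfV (ger0_norm (ltW n0)) (ger0_norm (ler0n _ 2)) mulrC ler_pdivrMr//.
have p2 : `|pr j y| ^+ 2 <= sqn y.
  by rewrite real_normK ?num_real// /pr /sqn; case: j; rewrite ?lerDl ?lerDr sqr_ge0.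
by move: (normr_ge0 (pr j y)) p2 yn n1; move: (`|pr j y|) (sqn y) (n.+1%:R) => p s t *; nra.
Qed.

Lemma chi_near y : exists N, forall n, (N <= n)%N -> chi n y = 1 /\ forall j, partial j (chi n) y = 0.
Proof.
have [N HN] := natr_gt (sqn y); exists N => n Nn.
have a1 : 1 <= 2 + (- n.+1%:R^-1) * sqn y.
  rewrite mulNr; have : n.+1%:R^-1 * sqn y <= 1.
    rewrite mulrC ler_pdivrMr ?ltr0Sn// mul1r; apply: le_trans (ltW HN) _.
    by rewrite ler_nat.
  by move: (_ * sqn y) => t; lra.
split; first exact: step1.
by move=> j; rewrite partial_chi dstep0 ?mul0r//; right.
Qed.

Local Opaque smooth partial reim rtest.

(** Truncate [w] by [chi n] and apply [compact_pairing] to both components.  The terms of the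
    potential cancel in the sum over the components, and the terms with the gradient of [chi n]
    disappear in the limit by dominated convergence. *)
Lemma full_domain w : md w -> bf u w = cip F w.
Proof.
move=> dw; have [Lw Lww Ew Lmw] := dw; have sw c := (L2P _).1 Lw c.
have [_ Lwu _ _] := du; have [C C0 dC] := @dstep_bounded R.
have Hw := iwg_wg Ew; have [_ _ Hg] := (iwgP _ _ _).1 Hw.
pose g c j := reim c (gj j (weak_grad setT w)).
have gE c j y : g c j y = reim c (mg j w) y - rot c (Acomp A j) w y by rewrite reim_mg addrK.
have sg c j : sqi mu (g c j).
  have := sqiB ((L2P _).1 (Lmw j) c) (rot_sqi c j Lw); congr (sqi mu).
  by apply/funext => y; rewrite -gE.
have chi01 n y : `|chi n y| <= 1 by rewrite ger0_norm ?step_ge0 ?step_le1.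
have mchi n : measurable_fun (setT : set plane) (chi n) := cont_meas2 (smooth_cont (smooth_chi n)).
have mpchi n j : measurable_fun (setT : set plane) (partial j (chi n)) := cont_meas2 (smooth_cont (smooth_partial j (smooth_chi n))).
have bchi n j y := partial_chi_bound n j y dC.
pose v n c y := chi n y * reim c w y.
pose G n c j y := chi n y * g c j y + partial j (chi n) y * reim c w y.
have sv n c : sqi mu (v n c) := sqi_bmul (mchi n) (sw c) (chi01 n).
have sG n c j : sqi mu (G n c j) := sqiD (sqi_bmul (mchi n) (sg c j) (chi01 n)) (sqi_bmul (mpchi n j) (sw c) (bchi n j)).
have wd n c j psi : rtest setT psi ->
    \int[mu]_x (v n c x * partial j psi x) = - \int[mu]_x (G n c j x * psi x).
  move=> tp; have tcp := rtestMl (smooth_chi n) tp; have sp := rtest_sqi tp.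
  have H := Hg j c _ tcp.
  have i1 := sqi_mul (sw c) (rtest_sqi (rtest_partial j tcp)).
  have i2 : intg mu (fun y => partial j (chi n) y * reim c w y * psi y).
    exact: sqi_mul (sqi_bmul (mpchi n j) (sw c) (bchi n j)) sp.
  have i3 : intg mu (fun y => g c j y * (chi n y * psi y)) := sqi_mul (sg c j) (rtest_sqi tcp).
  have -> : \int[mu]_x (v n c x * partial j psi x) =
     \int[mu]_x (reim c w x * partial j (fun y => chi n y * psi y) x - partial j (chi n) x * reim c w x * psi x).
    by apply: eq_Rintegral => x _; rewrite (partialM _ _ (smooth_chi n) (rtest_smooth tp)) /v; ring.
  have -> : \int[mu]_x (G n c j x * psi x) =
     \int[mu]_x (g c j x * (chi n x * psi x) + partial j (chi n) x * reim c w x * psi x).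
    by apply: eq_Rintegral => x _; rewrite /G; ring.
  by rewrite RintegralB// RintegralD// H opprD.
pose P c j := reim c (mg j u).
have dbl n c : ip mu (P c false) (G n c false) + ip mu (P c true) (G n c true) +
    ip mu (fun y => \1_(box (2 * n.+1%:R + 1)) y * lower c y) (v n c) = 0.
  apply: (@compact_pairing _ (2 * n.+1%:R) (lower c) (v n c) (P c) (G n c) (fun j => sm j c)
    (lower_sqi c) (lower_eq c) (sv n c) (sG n c) _ (wd n c)).
  by move=> y /chi_out; rewrite /v => ->; rewrite mul0r.
(* the integrands of the limit identity and of the terms with the gradient of the truncation *)
pose S y := \sum_c (\sum_j reim c (mg j u) y * reim c (mg j w) y + 16^-1 * (reim c (weighted u) y * reim c (weighted w) y) - reim c F y * reim c w y).
pose Tj j y := \sum_c reim c (mg j u) y * reim c w y.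
have im j c := sqi_mul (sm j c) ((L2P _).1 (Lmw j) c).
have iw c := sqi_mul ((L2P _).1 Lwu c) ((L2P _).1 Lww c).
have iF c := sqi_mul (sF c) (sw c).
have iSc c := intgB (intgD (intgD (im true c) (im false c)) (intgZ 16^-1 (iw c))) (iF c).
have iS : intg mu S.
  have := intgD (iSc true) (iSc false); congr (intg mu).
  by apply/funext => y; rewrite /S !big_bool.
have iT j : intg mu (Tj j).
  have := intgD (sqi_mul (sm j true) (sw true)) (sqi_mul (sm j false) (sw false)); congr (intg mu).
  by apply/funext => y; rewrite /Tj big_bool.
have ES : \int[mu]_y S y = bf u w - cip F w.
  rewrite (_ : Rintegral _ _ _ = \int[mu]_y ((P true true y * reim true (mg true w) y + P true false y * reim true (mg false w) y + 16^-1 * (reim true (weighted u) y * reim true (weighted w) y) - reim true F y * reim true w y) + (P false true y * reim false (mg true w) y + P false false y * reim false (mg false w) y + 16^-1 * (reim false (weighted u) y * reim false (weighted w) y) - reim false F y * reim false w y))); last first.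
    by apply: eq_Rintegral => y _; rewrite /S !big_bool.
  rewrite (RintegralD measurableT (iSc true) (iSc false)).
  have e c := RintegralB measurableT (intgD (intgD (im true c) (im false c)) (intgZ 16^-1 (iw c))) (iF c).
  have e1 c := RintegralD measurableT (intgD (im true c) (im false c)) (intgZ 16^-1 (iw c)).
  have e2 c := RintegralD measurableT (im true c) (im false c).
  have e3 c := RintegralZl 16^-1 measurableT (iw c).
  rewrite !e !e1 !e2 !e3 /bf /cip /ip.
  by move: (Rintegral _ _ _) (Rintegral _ _ _) (Rintegral _ _ _) (Rintegral _ _ _) (Rintegral _ _ _) (Rintegral _ _ _) (Rintegral _ _ _) (Rintegral _ _ _)=> *; ring.
pose f n y := chi n y * S y + (partial false (chi n) y * Tj false y + partial true (chi n) y * Tj true y).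
have If n : \int[mu]_y f n y = 0.
  have ig c j := sqi_mul (sm j c) (sG n c j).
  have il c := sqi_mul (lower_sqi c (2 * n.+1%:R + 1)) (sv n c).
  have id c := intgD (intgD (ig c false) (ig c true)) (il c).
  have -> : \int[mu]_y f n y = \int[mu]_y (
     (P false false y * G n false false y + P false true y * G n false true y + \1_(box (2 * n.+1%:R + 1)) y * lower false y * v n false y) +
     (P true false y * G n true false y + P true true y * G n true true y + \1_(box (2 * n.+1%:R + 1)) y * lower true y * v n true y)).
    apply: eq_Rintegral => y _; have vb c : \1_(box (2 * n.+1%:R + 1)) y * lower c y * v n c y = lower c y * v n c y.
      have [yb|/chi_out y0] := pselect (box (2 * n.+1%:R) y); last by rewrite /v y0 mul0r !mulr0.
      rewrite indicE mem_set ?mul1r//.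
      by case: yb => h1 h2; split; apply: le_trans (_ : 2 * n.+1%:R <= _) => //; rewrite lerDl.
    rewrite !vb /f /S /Tj !big_bool /= /G !gE /v /lower /P /rot !reim_weighted -eucl_sqr.
    move: (chi n y) (partial _ _ _) (partial _ _ _) (eucl y) (Acomp _ _ _) (Acomp _ _ _) => x1 x2 x3 x4 x5 x6.
    move: (reim _ u y) (reim _ u y) (reim _ F y) (reim _ F y) (reim _ w y) (reim _ w y) => y1 y2 y3 y4 y5 y6.
    move: (reim _ (mg _ u) y) (reim _ (mg _ u) y) (reim _ (mg _ u) y) (reim _ (mg _ u) y) => z1 z2 z3 z4.
    move: (reim _ (mg _ w) y) (reim _ (mg _ w) y) (reim _ (mg _ w) y) (reim _ (mg _ w) y) => t1 t2 t3 t4.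
    by ring.
  rewrite (RintegralD measurableT (id false) (id true)).
  have e c := RintegralD measurableT (intgD (ig c false) (ig c true)) (il c).
  have e1 c := RintegralD measurableT (ig c false) (ig c true).
  by rewrite !e !e1; have := dbl n false; have := dbl n true; rewrite /ip => -> ->; rewrite addr0.
have mf n : measurable_fun (setT : set plane) (f n).
  exact: measurable_funD (measurable_funM (mchi n) (intg_meas iS)) (measurable_funD (measurable_funM (mpchi n false) (intg_meas (iT false))) (measurable_funM (mpchi n true) (intg_meas (iT true)))).
have cf y : f n y @[n --> \oo] --> S y.
  apply: cvg_near_cst; have [N HN] := chi_near y; exists N => // n /= Nn.
  by rewrite /f; have [-> z] := HN n Nn; rewrite !z !mul0r mul1r !addr0.
have iB : intg mu (fun y => `|S y| + (6 * C * `|Tj false y| + 6 * C * `|Tj true y|)).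
  by apply: intgD (integrable_norm iS) (intgD (intgZ _ (integrable_norm (iT false))) (intgZ _ (integrable_norm (iT true)))).
have [|_ L] := Rint_dct mf cf iB.
  move=> n y; rewrite /f; apply: le_trans (ler_normD _ _) _; apply: lerD.
    by rewrite normrM ler_piMl.
  by apply: le_trans (ler_normD _ _) _; apply: lerD; rewrite normrM ler_wpM2r.
have : \int[mu]_y S y = 0.
  apply: (cvg_unique (@Rhausdorff R) L); apply: cvg_near_cst; apply: nearW => n; exact: If.
by rewrite ES => /eqP; rewrite subr_eq0 => /eqP.
Qed.
End full_domain.
End graphs.

(** * Identification of the domains and of the inverses *)

Section domains.
Context {R : realType} (B : R * R -> R).
Hypotheses (cB : continuous B) (sB : compact_support B).
Local Notation mu := (leb2 R).
Local Notation plane := (measurableTypeR R * measurableTypeR R)%type.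
Local Notation E := (R * R -> R[i]).
Implicit Types (u v w phi F : E) (c j : bool).

(** The potential is bounded, so that the magnetic gradient is square integrable if and only if
    the gradient is. *)
Lemma dom_sP s v : dom_s v <-> md setT (vpot_s B s) v.
Proof.
have HA := vpot_s_admissible cB sB s; have [C AC] := vpot_s_bound cB sB s.
split=> [[[Lv [g [Hg L1 L2']]] Lw]|[Lv Lw Ev Lm]].
  have Ev : exists g, is_weak_grad setT v g by exists g.
  split => // j; apply/L2P => c.
  have Lg : L2 (gj j g) by case: j.
  have sr := sqiD ((L2P _).1 Lg c) (rot_sqi HA AC c j Lv).
  apply: sqi_ae sr _ _; first exact: (mg_cmeas HA j (L2_cmeas Lv) Ev c).
  by apply: aeS (ae_mg HA j c Hg) => y ->.
split=> //; split => //; exists (weak_grad setT v).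
have Lg j : L2 (gj j (weak_grad setT v)).
  apply/L2P => c; have := sqiB ((L2P _).1 (Lm j) c) (rot_sqi HA AC c j Lv).
  by congr (sqi mu); apply/funext => y; rewrite reim_mg addrK.
by split; [exact: iwg_wg|exact: (Lg false)|exact: (Lg true)].
Qed.

Lemma maxdomP v : maxdom_oo B v <-> md (@punctured R) (vpot_oo B) v.
Proof.
split=> [[L1 L2' [E1 [m1 m2]]]|[L1 L2' E1 m]]; first by split => // -[].
by split => //; split => //; split; [exact: (m false)|exact: (m true)].
Qed.

Lemma dom_ooP v : dom_oo B v <-> approx (@punctured R) (vpot_oo B) v.
Proof.
have HA := vpot_oo_admissible cB sB.
have fn u phi : md (@punctured R) (vpot_oo B) u -> test_function (@punctured R) phi ->
    form_norm_oo B (fun y => u y - phi y) = Num.sqrt (bf (@punctured R) (vpot_oo B) (ax (-1) u phi) (ax (-1) u phi)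
     + cip (ax (-1) u phi) (ax (-1) u phi)).
  move=> du tp; have da := md_ax HA (-1) du (test_md HA tp).
  by rewrite sbE /form_norm_oo /form_oo mag_formE// norm2E//; case: da.
split=> [[/maxdomP dv av]|[dv av]]; split => //.
- move=> e e0; have se0 : 0 < Num.sqrt e by rewrite sqrtr_gt0.
  have [phi tp b] := av (Num.sqrt e) se0; exists phi => //.
  move: b; rewrite fn// ltr_sqrt// => b.
  have h1 := bf_ge0 (@punctured R) (vpot_oo B) (ax (-1) v phi); have h2 := cip_ge0 (ax (-1) v phi).
  by move: b h1 h2; move: (bf _ _ _ _) (cip _ _) => *; split; lra.
- exact/maxdomP.
- move=> e e0; have [phi tp [h1 h2]] := av _ (divr_gt0 (exprn_gt0 2 e0) (ltr0Sn _ 3)).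
  exists phi => //; rewrite fn// -[X in _ < X](ger0_norm (ltW e0)) -sqrtr_sqr ltr_sqrt ?exprn_gt0//.
  move: h1 h2 (exprn_gt0 2 e0); move: (bf _ _ _ _) (cip _ _) (e ^+ 2) => *; lra.
Qed.
End domains.

Section approximation.
Context {R : realType}.
Local Notation mu := (leb2 R).
Local Notation plane := (measurableTypeR R * measurableTypeR R)%type.
Local Notation E := (R * R -> R[i]).
Implicit Types (u v w phi F : E) (c j : bool).

Lemma cip_tri u v w : L2 u -> L2 v -> L2 w ->
  cip (ax (-1) u w) (ax (-1) u w) <= 2 * cip (ax (-1) u v) (ax (-1) u v) + 2 * cip (ax (-1) v w) (ax (-1) v w).
Proof.
move=> Lu Lv Lw; have h := cip_ge0 (ax 1 (ax (-2) u v) w); have La := L2_ax (-2) Lu Lv.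
move: h; rewrite !cip_ax// [cip (ax _ _ _) w]cipC cip_axr// [cip w u]cipC [cip w v]cipC.
by move: (cip u u) (cip v v) (cip w w) (cip u v) (cip u w) (cip v w) => *; lra.
Qed.

Lemma ae_origin : {ae mu, forall y, y != (0, 0) :> R * R}.
Proof.
exists [set (0, 0)]; split; [by apply: compact_measurable2; exact: compact_set1|exact: mu_origin|].
by move=> y /= /negP; rewrite negbK => /eqP.
Qed.

Variables (O : set (R * R)) (A : R * R -> R * R).
Hypothesis HA : admissible O A.

Lemma bf_tri u v w : md O A u -> md O A v -> md O A w ->
  bf O A (ax (-1) u w) (ax (-1) u w) <=
    2 * bf O A (ax (-1) u v) (ax (-1) u v) + 2 * bf O A (ax (-1) v w) (ax (-1) v w).
Proof.
move=> du dv dw; have h := bf_ge0 O A (ax 1 (ax (-2) u v) w); have da := md_ax HA (-2) du dv.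
move: h; rewrite !(bf_ax HA)// [bf _ _ (ax _ _ _) w]bfC (bf_axr HA)// [bf _ _ w u]bfC [bf _ _ w v]bfC.
by move: (bf _ _ u u) (bf _ _ v v) (bf _ _ w w) (bf _ _ u v) (bf _ _ u w) (bf _ _ v w) => *; lra.
Qed.

Lemma test_approx w : test_function O w -> approx O A w.
Proof.
move=> tw; split; first exact: test_md.
move=> e e0; exists w => //; have Lw := test_L2 tw; have dw := test_md HA tw.
by rewrite (bf_ax HA)// cip_ax//; move: (bf _ _ _ _) (cip _ _) => x y; split; lra.
Qed.

(** The confinement makes the form definite: [eucl y * d y = 0] almost everywhere. *)
Lemma bf_null d : md O A d -> bf O A d d = 0 -> cip d d = 0.
Proof.
move=> [Ld Lw _ _] b0.
have w0 c : ip mu (reim c (weighted d)) (reim c (weighted d)) = 0.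
  move: b0; rewrite /bf {1 2}/cip.
  have := ip_ge0 mu (reim false (mg O A false d)); have := ip_ge0 mu (reim true (mg O A false d)).
  have := ip_ge0 mu (reim false (mg O A true d)); have := ip_ge0 mu (reim true (mg O A true d)).
  have := ip_ge0 mu (reim false (weighted d)); have := ip_ge0 mu (reim true (weighted d)).
  rewrite /cip; case: c; move: (ip mu (reim false (weighted d)) _) (ip mu (reim true (weighted d)) _) => x y;
    by move: (ip _ _ _) (ip _ _ _) (ip _ _ _) (ip _ _ _) => *; lra.
have d0 c : {ae mu, forall y, reim c d y = 0}.
  apply: aeS2 ae_origin (ip0_ae ((L2P _).1 Lw c) (w0 c)) => y y0 /eqP.
  rewrite reim_weighted mulf_eq0 => /orP[/eqP /eucl0 yE|/eqP //].
  by rewrite yE eqxx in y0.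
have z c : ip mu (reim c d) (reim c d) = 0.
  rewrite (ip_ae2 (sqi_meas ((L2P _).1 Ld c)) (measurable_cst _) (d0 c)).
  by rewrite /ip; under eq_Rintegral do rewrite mulr0; rewrite Rintegral_cst// mul0r.
by rewrite /cip !z addr0.
Qed.

(** The function [u] is not compared with [v] itself but with the test functions near [v]. *)
Lemma approx_null u v : md O A u -> approx O A v -> bf O A (ax (-1) u v) (ax (-1) u v) = 0 ->
  approx O A u.
Proof.
move=> du [dv av] b0; split=> // e e0; have c0 := bf_null (md_ax HA (-1) du dv) b0.
have [phi tp [h1 h2]] := av _ (divr_gt0 e0 (ltr0Sn _ 1)); exists phi => //.
have Lu : L2 u by case: du. have Lv : L2 v by case: dv.
have := cip_tri Lu Lv (test_L2 tp); have := bf_tri du dv (test_md HA tp); rewrite b0 c0.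
by move: h1 h2; move: (bf _ _ _ _) (bf _ _ _ _) (cip _ _) (cip _ _) => *; split; lra.
Qed.
End approximation.

Section solutions.
Context {R : realType} (B : R * R -> R).
Hypotheses (cB : continuous B) (sB : compact_support B).
Local Notation E := (R * R -> R[i]).
Variable F : E.
Hypothesis LF : L2 F.

(** The inverse picks an unspecified element of the graph.  The solution of [weak_solution]
    belongs to the graph by [full_domain], and any two elements differ by a null function, by
    testing the difference of their equations with their difference. *)
Lemma L_s_solution s (u := operator_inv (L_s B s) F) : approx setT (vpot_s B s) u /\
  forall v, approx setT (vpot_s B s) v -> bf setT (vpot_s B s) u v = cip F v.
Proof.
have HA := vpot_s_admissible cB sB s; have [C AC] := vpot_s_bound cB sB s.
have [v [[dv av] Hv]] := weak_solution HA (coercive HA) LF.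
have Ev w : md setT (vpot_s B s) w -> bf setT (vpot_s B s) v w = cip F w.
  by apply: (full_domain HA AC dv LF) => phi tp; apply: Hv; exact: test_approx.
have P w : L_s B s w F <-> md setT (vpot_s B s) w /\ forall x, md setT (vpot_s B s) x -> bf setT (vpot_s B s) w x = cip F x.
  rewrite /L_s /form_s (form_opP HA)//; last first.
  - by move=> x /(dom_sP cB sB s) dx; apply/(dom_sP cB sB s); exact: md_iu.
  - by move=> x /(dom_sP cB sB s).
  split=> -[dw Hw]; split; try exact/(dom_sP cB sB s).
    by move=> x dx; apply: Hw; apply/(dom_sP cB sB s).
  by move=> x /(dom_sP cB sB s); exact: Hw.
have : L_s B s u F.
  by rewrite /u /operator_inv; case: xgetP => [w -> //|/(_ v)[]]; apply/P.
move=> /P[du Hu]; split=> [|w [dw _]]; last exact: Hu.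
apply: (approx_null HA du (conj dv av)).
have da := md_ax HA (-1) du dv; rewrite (bf_ax HA)//.
by rewrite (Hu _ dv) (Hu _ du) (Ev _ dv); have := Ev _ du; rewrite bfC (Hu _ dv) => ->; ring.
Qed.

Lemma L_oo_solution (u := operator_inv (L_oo B) F) : approx (@punctured R) (vpot_oo B) u /\
  forall v, approx (@punctured R) (vpot_oo B) v -> bf (@punctured R) (vpot_oo B) u v = cip F v.
Proof.
have HA := vpot_oo_admissible cB sB; have [v Hv] := weak_solution HA (coercive HA) LF.
have P w : L_oo B w F <-> approx (@punctured R) (vpot_oo B) w /\ forall x, approx (@punctured R) (vpot_oo B) x -> bf (@punctured R) (vpot_oo B) w x = cip F x.
  rewrite /L_oo /form_oo (form_opP HA)//; last first.
  - by move=> x /(dom_ooP cB sB) dx; apply/(dom_ooP cB sB); exact: approx_iu.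
  - by move=> x /(dom_ooP cB sB)[].
  split=> -[dw Hw]; split; try exact/(dom_ooP cB sB).
    by move=> x dx; apply: Hw; apply/(dom_ooP cB sB).
  by move=> x /(dom_ooP cB sB); exact: Hw.
by apply/P; rewrite /u /operator_inv; case: xgetP => [w -> //|/(_ v)[]]; apply/P.
Qed.
End solutions.

(** * Comparison of energies and convergence *)

Section convergence.
Context {R : realType} (B : R * R -> R).
Hypotheses (cB : continuous B) (sB : compact_support B).
Local Notation mu := (leb2 R).
Local Notation plane := (measurableTypeR R * measurableTypeR R)%type.
Local Notation E := (R * R -> R[i]).
Variable F : E.
Hypothesis LF : L2 F.
Local Notation P := (@punctured R).

Definition cocut (z : R) (y : R * R) : R := 1 - cut z y.

Lemma cocut_meas z : 0 < z -> measurable_fun (setT : set plane) (cocut z).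
Proof. by move=> z0; apply: measurable_funB => //; exact: cont_meas2 (smooth_cont (smooth_cut z0)). Qed.

Lemma cocut_01 z y : 0 <= cocut z y <= 1.
Proof. by rewrite /cocut subr_ge0 cut_le1/= lerBlDr lerDl cut_ge0. Qed.

Lemma cocut_L2 z f : 0 < z -> L2 f -> L2 (rm (cocut z) f).
Proof.
move=> z0 /L2P sf; apply/L2P => c; rewrite reim_rm.
apply: sqi_bmul (cocut_meas z0) (sf c) (_ : forall y, `|cocut z y| <= 1) => y.
by have /andP[h0 h1] := cocut_01 z y; rewrite ger0_norm.
Qed.

(** The cutoffs tend to 1 off the origin, and [|F|^2] dominates. *)
Lemma cocut_small : cip (rm (cocut n.+1%:R) F) (rm (cocut n.+1%:R) F) @[n --> \oo] --> (0 : R).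
Proof.
have [iN _] := cip_sqmod LF.
pose f n y := cocut n.+1%:R y ^+ 2 * sqmod F y.
(* at the origin the cutoffs vanish, hence the exceptional value of the limit *)
pose G (y : R * R) := \1_[set (0, 0)] y * sqmod F y.
have ef n : cip (rm (cocut n.+1%:R) F) (rm (cocut n.+1%:R) F) = \int[mu]_y f n y.
  have [_ <-] := cip_sqmod (cocut_L2 (ltr0Sn R n) LF).
  by apply: eq_Rintegral => y _; rewrite /sqmod !reim_rm /f /sqmod; ring.
have mf n : measurable_fun (setT : set plane) (f n).
  apply: measurable_funM; last exact: intg_meas iN.
  by apply: measurable_funX; apply: cocut_meas; exact: ltr0Sn.
have cf y : f n y @[n --> \oo] --> G y.
  have [->|y0] := eqVneq y (0, 0).
    apply: cvg_near_cst; apply: nearW => n.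
    have k0 : sqn ((0, 0) : R * R) <= kappa n.+1%:R.
      by rewrite /sqn /= expr0n /= addr0 ltW// kappa_gt0// ltr0Sn.
    by rewrite /f /G indicE mem_set// mul1r /cocut (cut0 (ltr0Sn R n) k0) subr0 expr1n mul1r.
  have [N HN] := natr_gt (ln (1 + ln (1 + (sqn y)^-1)) * 2).
  apply: cvg_near_cst; exists N => // n /= Nn.
  have h : ln (1 + ln (1 + (sqn y)^-1)) <= n.+1%:R / 2.
    by rewrite ler_pdivlMr//; apply: le_trans (ltW HN) _; rewrite ler_nat.
  rewrite /f /G /cocut (cut1 (ltr0Sn R n) y0 h) subrr expr0n mul0r indicE memNset ?mul0r//=.
  exact/eqP.
have fb n y : `|f n y| <= sqmod F y.
  have /andP[h0 h1] := cocut_01 n.+1%:R y.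
  rewrite /f ger0_norm; last by rewrite mulr_ge0 ?sqr_ge0 ?sqmod_ge0.
  by apply: ler_piMl; [exact: sqmod_ge0|exact: exprn_ile1].
have [iG L] := Rint_dct mf cf iN fb.
have G0 : \int[mu]_y G y = 0.
  rewrite (@Rint_ae _ _ _ mu G (fun=> 0)) ?Rintegral_cst ?mul0r//; first exact: intg_meas iG.
  apply: aeS (@ae_origin R) => y y0.
  by rewrite /G indicE memNset ?mul0r//=; apply/eqP.
under eq_fun do rewrite ef.
by rewrite G0 in L.
Qed.

Lemma cut_loss_ge0 (C z : R) : 0 < z -> 0 <= z^-1 + 48 * C ^+ 2 * (1 + z) / z ^+ 2.
Proof.
move=> z0; apply: addr_ge0; first by rewrite invr_ge0 ltW.
apply: divr_ge0; last exact: sqr_ge0.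
by apply: mulr_ge0; [apply: mulr_ge0 => //; exact: sqr_ge0|rewrite addr_ge0// ltW].
Qed.

(** The two errors of the cutoff, in the form ([cut_bf]) and in the pairing with [F], multiplied
    by a given constant. *)
Lemma cut_choice (C K e : R) : 0 < e -> 0 <= K -> exists z, [/\ 0 < z,
  (z^-1 + 48 * C ^+ 2 * (1 + z) / z ^+ 2) * K <= e &
  cip (rm (cocut z) F) (rm (cocut z) F) * K <= e].
Proof.
move=> e0 K0; have K1 : 0 < K + 1 by rewrite ltr_wpDl.
have [N1 _ H1] : \forall n \near \oo, cip (rm (cocut n.+1%:R) F) (rm (cocut n.+1%:R) F) <= e / (K + 1).
  have /cvgrPdist_le/(_ _ (divr_gt0 e0 K1)) := cocut_small.
  by apply: filterS => n; rewrite sub0r normrN ger0_norm// cip_ge0.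
pose c := (1 + 96 * C ^+ 2) * (K + 1).
have [N2 H2] := natr_gt (c / e).
pose n := (N1 + N2)%N; have n0 : (0 : R) < n.+1%:R by rewrite ltr0Sn.
exists n.+1%:R; split => //.
  have c1 : c <= e * n.+1%:R.
    rewrite -ler_pdivrMl// mulrC; apply: le_trans (ltW H2) _.
    by rewrite ler_nat ltnS leq_addl.
  have n1 : (1 : R) <= n.+1%:R by rewrite ler1n.
  apply: (@le_trans _ _ (c / n.+1%:R)); last by rewrite ler_pdivrMr.
  move: n0 n1; rewrite /c; move: (n.+1%:R) => z z0 z1.
  have C2 := sqr_ge0 C.
  rewrite (_ : (_ + _) * K = (z + 48 * C ^+ 2 * (1 + z)) * K / z ^+ 2); last by field; rewrite gt_eqF.
  rewrite (_ : _ / z = ((1 + 96 * C ^+ 2) * z) * (K + 1) / z ^+ 2); last by field; rewrite gt_eqF.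
  rewrite ler_wpM2r ?invr_ge0 ?sqr_ge0//; apply: ler_pM => //.
  - by apply: addr_ge0; [exact: ltW|apply: mulr_ge0; [exact: mulr_ge0|rewrite addr_ge0// ltW]].
  - have z10 : 0 <= z - 1 by rewrite subr_ge0.
    by move: (mulr_ge0 C2 z10); move: (C ^+ 2) => x x0; lra.
  - by rewrite lerDl.
apply: le_trans (_ : e / (K + 1) * K <= _).
  by rewrite ler_wpM2r// H1//= leq_addr.
rewrite mulrAC ler_pdivrMr//; apply: ler_wpM2l; first exact: ltW.
by rewrite lerDl.
Qed.

(** A compact subset of the punctured plane stays at a positive distance of the origin. *)
Lemma test_away phi : test_function P phi ->
  exists2 d : R, 0 < d & forall y, phi y != 0 -> d <= eucl y.
Proof.
move=> /testP tp; have [K0 [cK0 sK0 _ H0]] := rtest_out (tp false).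
have [K1 [cK1 sK1 _ H1]] := rtest_out (tp true).
have [|d d0 Hd] := compact_away (compactU cK0 cK1); first by move=> y [/sK0|/sK1].
exists d => // y py; apply: Hd; apply: contrapT => /not_orP[/H0 h0 /H1 h1].
by move: py h0 h1; rewrite /reim; case: (phi y) => a b + /= a0 b0; rewrite a0 b0 eqxx.
Qed.

Lemma testT phi : test_function P phi -> test_function setT phi.
Proof. by move=> /testP tp; apply/testP => c; apply: rtestS (tp c). Qed.

Section fixed_time.
Variables (M R0 : R).
Hypotheses (R00 : 0 < R0) (BM : forall y, `|B y| <= M) (B0 : forall y, R0 < eucl y -> B y = 0).
Local Notation bs s := (bf setT (vpot_s B s)).
Local Notation bo := (bf P (vpot_oo B)).

Lemma bf_far s phi d : test_function P phi -> (forall y, phi y != 0 -> d <= eucl y) ->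
  R0 <= expR (s / 2) * d -> bs s phi phi = bo phi phi.
Proof.
move=> tp pd sd; apply: bf_agree (vpot_s_admissible cB sB s) (vpot_oo_admissible cB sB) (testT tp) tp _ => y /pd dy.
apply/esym/(vpot_ooE cB R00 BM B0); apply: le_trans sd _.
by rewrite ler_wpM2l// expR_ge0.
Qed.

Variables (us U : E) (s e z C : R).
Hypotheses (e0 : 0 < e) (e1 : e <= 1) (z0 : 0 < z) (dC : forall x, dstep x <= C).
Hypotheses (au : approx setT (vpot_s B s) us)
  (Eu : forall v, approx setT (vpot_s B s) v -> bs s us v = cip F v).
Hypotheses (aU : approx P (vpot_oo B) U)
  (EU : forall v, approx P (vpot_oo B) v -> bo U v = cip F v).
Let K : R := 16 * cip F F + 2.
Hypotheses (hz1 : (z^-1 + 48 * C ^+ 2 * (1 + z) / z ^+ 2) * K <= e)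
  (hz2 : cip (rm (cocut z) F) (rm (cocut z) F) * (2 * K / e) <= e)
  (sz : R0 <= expR (s / 2) * Num.sqrt (kappa z)).

Let Hs := vpot_s_admissible cB sB s.
Let Ho := vpot_oo_admissible cB sB.

(** Approximate the solution by a test function, whose form is at most [K] by
    the a priori bound [cip F us <= 8 |F|^2].  Its cutoff is admissible in the variational
    principle of the limit problem; the errors add up to [4 e]. *)
Lemma energy_upper : cip F us <= cip F U + 4 * e.
Proof.
have [du aus] := au; have [dU _] := aU; have Lus : L2 us by case: du.
have [phi tp [h1 h2]] := aus e e0; have ap := test_approx Hs tp.
have dp := test_md Hs tp; have Lp := test_L2 tp.
have Euu := Eu au; have Eup := Eu ap.
(* a priori bound, by Cauchy-Schwarz and coercivity *)
have Eb : cip F us <= 8 * cip F F.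
  have c8 := coercive_approx Hs (coercive Hs) au.
  have cs := cip_CS LF Lus; rewrite Euu in c8.
  move: c8 cs (cip_ge0 F); move: (cip us us) (cip F us) (cip F F) => x y w h cs w0.
  have : y ^+ 2 <= 8 * w * y by apply: le_trans cs _; nra.
  by have [y0|y0] := leP y 0; nra.
have hb : bs s phi phi <= K.
  have := bf_ge0 setT (vpot_s B s) (ax (-(1/2)) us phi).
  move: h1; rewrite !(bf_ax Hs)// Euu Eup /K => h1 h3.
  by move: Eb h1 h3 e1; move: (cip F us) (cip F phi) (bs s phi phi) (cip F F) => *; lra.
(* [J1] to [J4]: almost minimality, the variational principle of the limit problem, the cost of the cutoff, and the change in the pairing with [F] *)
have J1 : cip F us <= 2 * cip F phi - bs s phi phi + e.
  by move: h1; rewrite (bf_ax Hs)// Euu Eup; move: (cip F us) (cip F phi) (bs s phi phi) => *; lra.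
have tr := cut_test_punctured z0 tp; have ar := test_approx Ho tr.
have J2 : 2 * cip F (rm (cut z) phi) - bo (rm (cut z) phi) (rm (cut z) phi) <= cip F U.
  have := bf_ge0 P (vpot_oo B) (ax (-1) U (rm (cut z) phi)).
  rewrite (bf_ax Ho)//; last exact: test_md.
  rewrite (EU ar) (EU aU); move: (cip F U) (cip F _) (bo _ _) => *; lra.
have J3 : bo (rm (cut z) phi) (rm (cut z) phi) <= bs s phi phi + e.
  rewrite -(bf_far tr _ sz); last first.
    move=> y; rewrite /rm => ny; have [yk|yk] := leP (sqn y) (kappa z).
      by move: ny; rewrite cut0// mul0r eqxx.
    by rewrite -[eucl y]ger0_norm ?eucl_ge0// -sqrtr_sqr ler_sqrt ?sqr_ge0// eucl_sqr ltW.
  apply: le_trans (cut_bf z0 Hs dC tp) _.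
  rewrite -addrA mulrDl mul1r lerD2l; apply: le_trans hz1.
  exact: ler_wpM2l (cut_loss_ge0 C z0) _ _ hb.
have J4 : 2 * (cip F phi - cip F (rm (cut z) phi)) <= 2 * e.
  have -> : cip F phi - cip F (rm (cut z) phi) = cip (rm (cocut z) F) phi.
    have -> : cip F phi - cip F (rm (cut z) phi) = cip F (ax (-1) phi (rm (cut z) phi)).
      by rewrite cip_axr ?mulN1r//; exact: test_L2 tr.
    by congr (_ + _); apply: eq_Rintegral => y _; rewrite reim_ax !reim_rm /cocut; ring.
  have cs := cip_CS (cocut_L2 z0 LF) Lp; have cp := coercive Hs tp.
  have := ler_wpM2l (cip_ge0 (rm (cocut z) F)) (le_trans cp (ler_wpM2l (ler0n _ 2) hb)).
  move: hz2; rewrite mulrA ler_pdivrMr// => hz2' h5.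
  have h6 : cip (rm (cocut z) F) phi ^+ 2 <= e ^+ 2.
    by rewrite expr2; apply: le_trans cs _; apply: le_trans h5 _.
  rewrite ler_pM2l//; apply: le_trans (ler_norm _) _.
  by rewrite -(@ler_pXn2r _ 2) ?nnegrE ?(ltW e0)// real_normK ?num_real.
move: J1 J2 J3 J4; move: (cip F us) (cip F U) (cip F phi) (cip F _) (bo _ _) (bs s _ _) => *; lra.
Qed.

(** Since [phi] has the same energy for both problems, the excess of its energy over
    the minimum is at most [5 e] by [energy_upper], and coercivity turns the excess into a distance. *)
Lemma solutions_close phi : test_function P phi ->
  bo (ax (-1) U phi) (ax (-1) U phi) <= e -> cip (ax (-1) U phi) (ax (-1) U phi) <= e ->
  bs s phi phi = bo phi phi ->
  cip (ax (-1) us U) (ax (-1) us U) <= 100 * e.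
Proof.
move=> tp hb hc bb; have tT := testT tp; have ap := test_approx Hs tT.
have [du aus] := au; have [dU _] := aU; have Lus : L2 us by case: du. have LU : L2 U by case: dU.
have dp := test_md Hs tT; have Lp := test_L2 tp; have dpo := test_md Ho tp.
have ad : approx setT (vpot_s B s) (ax (-1) us phi).
  split; first exact: (md_ax Hs).
  move=> d d0; have [psi tpsi [h1 h2]] := aus d d0.
  exists (ax (-1) psi phi); first exact: test_ax.
  have -> : ax (-1) (ax (-1) us phi) (ax (-1) psi phi) = ax (-1) us psi.
    by apply/funext => y; rewrite /ax rmorphN1; ring.
  by [].
have c8 := coercive_approx Hs (coercive Hs) ad.
have up := energy_upper.
have tri := cip_tri Lus Lp LU; have sy := cipBC LU Lp.
move: hb c8; rewrite (bf_ax Hs)// (bf_ax Ho)// bb (Eu au) (Eu ap) (EU aU) (EU (test_approx Ho tp)).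
rewrite -sy in tri => hb c8.
move: tri hc hb c8 up e0; move: (cip (ax _ us U) _) (cip (ax _ us phi) _) (cip (ax _ U phi) _) => x1 x2 x3.
by move: (cip F us) (cip F U) (cip F phi) (bo phi phi) => *; lra.
Qed.
End fixed_time.
End convergence.

Theorem proposition4 (R : realType) (B : R * R -> R)
    (B_continuous : continuous B) (B_support : compact_support B)
    (flux_nonint : flux B \isn't a Num.int)
    (F : R * R -> R[i]) (F_L2 : L2 F) :
  norm2 (fun y => operator_inv (L_s B s) F y - operator_inv (L_oo B) F y)
    @[s --> +oo] --> 0.
Proof.
have [M [R0 [_ R00 BM B0]]] := field_bounds B_continuous B_support.
have [C C0 dC] := @dstep_bounded R.
have [aU EU] := L_oo_solution B_continuous B_support F_L2.
apply/cvgrPdist_le => d d0.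
(* 100 is the constant of [solutions_close] *)
pose e := Num.min 1 (d ^+ 2 / 100).
have e0 : 0 < e by rewrite lt_min ltr01 divr_gt0 ?exprn_gt0.
have e1 : e <= 1 by rewrite ge_min lexx.
pose K : R := 16 * cip F F + 2.
have K0 : 0 <= K by rewrite addr_ge0 ?mulr_ge0 ?cip_ge0.
have K2 : K <= 2 * K / e.
  by rewrite ler_pdivlMr// mulrC; apply: ler_pM => //; [exact: ltW|rewrite (le_trans e1)// ler1n].
have [z [z0 hz1 hz2]] := cut_choice F_L2 C e0 (le_trans K0 K2).
have {}hz1 := le_trans (ler_wpM2l (cut_loss_ge0 C z0) K2) hz1.
have [_ aU'] := aU; have [phi tp [hb hc]] := aU' e e0.
have [r r0 pr] := test_away tp.
near=> s.
have [au Eu] := L_s_solution B_continuous B_support F_L2 s.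
have sz : R0 <= expR (s / 2) * Num.sqrt (kappa z).
  by near: s; apply: expR_large; rewrite sqrtr_gt0 kappa_gt0.
have sr : R0 <= expR (s / 2) * r by near: s; exact: expR_large.
have bb := bf_far B_continuous B_support R00 BM B0 tp pr sr.
have := solutions_close B_continuous B_support F_L2 R00 BM B0 e0 e1 z0 dC au Eu aU EU hz1 hz2 sz tp hb hc bb.
set u := operator_inv _ F; set U := operator_inv _ F => h.
have [[Lu _ _ _] _] := au; have [[LU _ _ _] _] := aU.
rewrite sub0r normrN ger0_norm ?norm2_ge0// -(@ler_pXn2r _ 2) ?nnegrE ?norm2_ge0 ?(ltW d0)//.
rewrite norm2E; last exact: L2B.
rewrite sbE; apply: le_trans h _; rewrite mulrC -ler_pdivlMr//.
by rewrite ge_min lexx orbT.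
Unshelve. all: by end_near. Qed.
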